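(* Let $d\ge 2$ and let $X,X_1,X_2,\ldots$ be i.i.d. $\mathbb{R}^d$-valued random vectors with a spherically symmetric distribution. Suppose that $(a_n)$ and $(b_n)$ are sequences of positive numbers with $b_n=o(a_n)$ such that $$\mathbb{P}\bigl(|X|>a_n+tb_n\bigr)=\frac{1+o(1)}{n}e^{-t}\qquad\text{as } n\to\infty,$$ for all $t=t_n$ with $|t|\le \frac{d-1}{2}\log(a_n/b_n)$ (that is, for every real sequence $(t_n)$ satisfying this bound). Let $M^{(2)}_n:=\max_{1\le i<j\le n}|X_i-X_j|$ and $$c_d:=\frac{(d-1)2^{d-4}\Gamma(d/2)}{\sqrt{\pi}}.$$ Then, as $n\to\infty$, $$\frac{M^{(2)}_n-2a_n}{b_n}+\frac{d-1}{2}\log\frac{a_n}{b_n}-\log\log\frac{a_n}{b_n}-\log c_d\ \stackrel{d}{\longrightarrow}\ V,$$ where $V$ has the Gumbel distribution $\mathbb{P}(V\le x)=e^{-e^{-x}}$, $x\in\mathbb{R}$.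
   Context: $|\cdot|$ is the Euclidean norm on $\mathbb{R}^d$. $\stackrel{d}{\longrightarrow}$ denotes convergence in distribution. All limits are as $n\to\infty$; expressions such as $\log\log(a_n/b_n)$ are considered for $n$ large enough that they are defined. *)

(* Defs.v *)
From HB Require Import structures.
From mathcomp Require Import all_boot all_order all_algebra finmap.
From mathcomp Require Import all_classical all_reals all_analysis.
From mathcomp Require Import measurable_realfun.

Set Implicit Arguments.
Unset Strict Implicit.
Unset Printing Implicit Defensive.

Import Order.TTheory GRing.Theory Num.Theory.
Import numFieldNormedType.Exports.

Local Open Scope classical_set_scope.
Local Open Scope ring_scope.

(* R^d is 'rV[R]_d with the product sigma-algebra generated by the coordinate
   projections, as the library does for n.-tuple; it is the Borel one. *)
Definition measure_rV_display : measure_display -> measure_display.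
Proof. exact. Qed.

Section measurable_rV.
Context {R : realType}.
Variable n : nat.

Let coord : 'I_n -> 'rV[R]_n -> R := fun i x => x ord0 i.

Let rV_set0 : g_sigma_preimage coord set0.
Proof. exact: sigma_algebra0. Qed.

Let rV_setC A : g_sigma_preimage coord A -> g_sigma_preimage coord (~` A).
Proof. exact: sigma_algebraC. Qed.

Let rV_bigcup (F : _^nat) : (forall i, g_sigma_preimage coord (F i)) ->
  g_sigma_preimage coord (\bigcup_i (F i)).
Proof. exact: sigma_algebra_bigcup. Qed.

HB.instance Definition _ := @isMeasurable.Build
  (measure_rV_display default_measure_display)
  'rV[R]_n (g_sigma_preimage coord) rV_set0 rV_setC rV_bigcup.

Lemma measurable_rV_coord (i : 'I_n) :
  measurable_fun [set: 'rV[R]_n] (fun x : 'rV[R]_n => x ord0 i).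
Proof.
move=> _ Y mY; rewrite setTI; apply: sub_sigma_algebra => /=.
rewrite -bigcup_seq/=; exists i => /=; first by rewrite mem_index_enum.
by exists Y => //; rewrite setTI.
Qed.

End measurable_rV.

(* The norm `|x| on 'rV[R]_d is the sup norm, hence the separate definition. *)
Definition euclidean_norm (R : realType) (d : nat) (x : 'rV[R]_d) : R :=
  Num.sqrt (\sum_(i < d) x ord0 i ^+ 2).

Section probability_notions.
Context {disp disp' : measure_display} {T : measurableType disp}
  {T' : measurableType disp'} {R : realType}.
Implicit Type P : probability T R.

Definition mutually_independent P (I : choiceType) (X : I -> {RV P >-> T'}) :=
  forall (J : {fset I}) (B : I -> set T'), (forall i, measurable (B i)) ->
    P (\bigcap_(i in [set` J]) X i @^-1` B i)
      = (\prod_(i <- J) P (X i @^-1` B i))%E.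

Definition identically_distributed P (I : Type) (X : I -> {RV P >-> T'}) :=
  forall i j (B : set T'), measurable B ->
    distribution P (X i) B = distribution P (X j) B.

End probability_notions.

(* Invariance under every orthogonal transformation x |-> x *m Q. *)
Definition spherically_symmetric (R : realType) (d : nat)
    (mu : set 'rV[R]_d -> \bar R) :=
  forall Q : 'M[R]_d, Q *m Q^T = 1%:M ->
    forall B : set 'rV[R]_d, measurable B ->
      pushforward mu (fun x => x *m Q) B = mu B.

(* Convergence of the distribution functions at every continuity point of the
   limiting one; V may live on another probability space than the Z n. *)
Definition converges_in_distribution (R : realType)
    (disp disp' : measure_display) (T : measurableType disp)
    (T' : measurableType disp') (P : probability T R) (P' : probability T' R)
    (Z : nat -> {RV P >-> R}) (V : {RV P' >-> R}) :=
  forall x : R, {for x, continuous (cdf V)} ->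
    (fun n => cdf (Z n) x) @ \oo --> cdf V x.

Definition gumbel (R : realType) (disp : measure_display)
    (T : measurableType disp) (P : probability T R) (V : {RV P >-> R}) :=
  forall x : R, cdf V x = (expR (- expR (- x)))%:E.

Arguments mutually_independent {disp disp' T T' R} P {I} X.
Arguments identically_distributed {disp disp' T T' R} P {I} X.
Arguments converges_in_distribution {R disp disp' T T'} P P' Z V.
Arguments gumbel {R disp T} P V.

Definition Gamma (R : realType) (z : R) : R :=
  \int[lebesgue_measure]_(t in `]0, +oo[) (t `^ (z - 1) * expR (- t)).

Definition c_ (R : realType) (d : nat) : R :=
  (d%:R - 1) * 2 ^ (d%:Z - 4) * Gamma (d%:R / 2) / Num.sqrt pi.

(* In a sequence X, the points are X 1, X 2, ...; X 0 is the generic copy. *)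
Section maximum_interpoint_distance.
Context {disp : measure_display} {T : measurableType disp} {R : realType}
  {P : probability T R} {d : nat}.
Variable X : nat -> {RV P >-> 'rV[R]_d}.

(* Distances are nonnegative, so starting the maximum at 0 is harmless. *)
Definition M2 (n : nat) (w : T) : R :=
  \big[Num.max/0]_(1 <= i < n.+1)
    \big[Num.max/0]_(i.+1 <= j < n.+1)
      euclidean_norm (X i w - X j w).

Definition normalized_M2 (a b : nat -> R) (n : nat) (w : T) : R :=
  (M2 n w - 2 * a n) / b n + (d%:R - 1) / 2 * ln (a n / b n)
    - ln (ln (a n / b n)) - ln (c_ R d).

Lemma measurable_bigmax (s : seq nat) (f : nat -> T -> R) :
  (forall i, measurable_fun [set: T] (f i)) ->
  measurable_fun [set: T] (fun w => \big[Num.max/0]_(i <- s) f i w).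
Proof.
move=> mf; elim: s => [|i s IH].
  rewrite (_ : (fun _ => _) = cst 0); last by apply/funext => w; rewrite big_nil.
  exact: measurable_cst.
rewrite (_ : (fun _ => _) =
  f i \max (fun w => \big[Num.max/0]_(j <- s) f j w)); last first.
  by apply/funext => w; rewrite big_cons.
exact: measurable_maxr.
Qed.

Lemma measurable_M2 n : measurable_fun [set: T] (M2 n).
Proof.
apply: measurable_bigmax => i; apply: measurable_bigmax => j.
have msqrt : measurable_fun [set: R] (@Num.sqrt R).
  exact: (continuous_measurable_fun (@sqrt_continuous R)).
apply: (measurableT_comp msqrt).
apply: measurable_sum => k; apply: measurable_funX.
rewrite (_ : (fun _ => _) = (fun w => X i w ord0 k - X j w ord0 k)); last first.
  by apply/funext => w; rewrite !mxE.
apply: measurable_funB.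
  exact: (measurableT_comp (measurable_rV_coord k)).
exact: (measurableT_comp (measurable_rV_coord k)).
Qed.

HB.instance Definition _ n :=
  @isMeasurableFun.Build _ _ T R (M2 n) (measurable_M2 n).

Lemma measurable_normalized_M2 a b n :
  measurable_fun [set: T] (normalized_M2 a b n).
Proof.
apply: measurable_funB => //; apply: measurable_funB => //.
apply: measurable_funD => //; apply: measurable_funM => //.
by apply: measurable_funB => //; exact: measurable_M2.
Qed.

HB.instance Definition _ a b n := @isMeasurableFun.Build _ _ T R
  (normalized_M2 a b n) (measurable_normalized_M2 a b n).

End maximum_interpoint_distance.

(* Main.v *)
Require Import Defs.
From HB Require Import structures.
From mathcomp Require Import all_boot all_order all_algebra finmap.
From mathcomp Require Import all_classical all_reals all_analysis.
From mathcomp Require Import measurable_realfun gauss_integral.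
From mathcomp Require Import lra ring.

Set Implicit Arguments.
Unset Strict Implicit.
Unset Printing Implicit Defensive.

Import Order.TTheory GRing.Theory Num.Theory.
Import numFieldNormedType.Exports.

Local Open Scope classical_set_scope.
Local Open Scope ring_scope.

(** The normalized maximum is at most x when no two of the n points are further
apart than the radius 2 a + s b, with s = x - L + log log (a / b) + log c_d and
L = (d - 1) / 2 * log (a / b). The number of far pairs is close to a Poisson
variable whose mean tends to exp (- x), so that it vanishes with probability
tending to exp (- exp (- x)).

Poisson approximation. Add the points one at a time. A new point is far from
each of the m previous ones with probability p. Whether it is far from i is
independent of the points other than i, and two far pairs sharing a point have
probability at most q. Hence the probability that there is no far pair is
multiplied by 1 - m p, up to m^2 (p^2 + 2 q) (pair_free_step), and the product
of these factors is exp (- p n (n - 1) / 2) up to a multiple of n^3 (p^2 + q)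
(pair_free_Poisson). Since n^2 p converges, it remains to see that n^3 q tends
to 0. For this one counts only the pairs of points of excess at most K = log log
(a / b) / 2, where the excess of y is (|y| - a) / b: some point has a larger
excess with probability about exp (- K), which tends to 0 (pair_free_le_M2), and
q is then at most p times a bound, uniform over the position of the shared
point, that is o(1 / n) (pr_far_chain_le, section_bound_cvg).

The mean. Fix a point y of excess t. By the law of cosines, |y - z|^2 = (|y| +
|z|)^2 - 2 |y| |z| (1 + cos), so that z is far from y when its excess exceeds s
- t + u (1 + cos), with u close to a / (2 b) (far_pair_sub_cone,
cone_sub_far_pair). Direction and length of z are independent
(angle_norm_independent), and the tail of the excess is exp (- t) / n; hence z
is far with probability close to exp (t - s) phi(u) / n, where phi(u) is the
mean of exp (- u (1 + cos)) (pr_cone_le, pr_cone_ge). Under the law of the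
excess, exp t integrates to 1 / n times the length of the range of t
(exponential_moment_window_le, exponential_moment_window_ge), here equivalent to
L. Therefore n^2 p is equivalent to exp (- s) L phi(a / (2 b)), and the decay of
phi as a constant times u^(- (d - 1) / 2) (angular_laplace_asymptotic) makes the
limit 2 exp (- x) (mean_upper_cvg, mean_lower_cvg).

The function phi. Symmetry alone determines the even moments of the cosine, by
comparing the moments in the direction of e + s e' with those in the direction
of e (moment_orthogonal, momentS); they are ratios of Gaussian moments
(sphere_momentE). After expansion of the exponential, phi(u) is the mean of the
N-th moment for a Poisson variable N of mean u (cosine_laplace). As N
concentrates around u and the even moments decay like N^(- (d - 1) / 2), so does
phi(u); the constant is a Gaussian moment, that is Gamma (d / 2) up to a factor
(Gamma_half). *)

(** * Poisson approximation for pairs *)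

Section real_probability.
Context {disp : measure_display} {T : measurableType disp} {R : realType}.
Variable P : probability T R.
Implicit Types A B : set T.

Definition pr A : R := fine (P A).

Lemma prE A : measurable A -> P A = (pr A)%:E.
Proof. by move=> mA; rewrite /pr fineK// fin_num_measure. Qed.

Lemma pr_ge0 A : 0 <= pr A.
Proof. by rewrite /pr fine_ge0. Qed.

Lemma pr_le1 A : measurable A -> pr A <= 1.
Proof. by move=> mA; rewrite -lee_fin -prE// probability_le1. Qed.

Lemma pr_disjointU A B : measurable A -> measurable B -> A `&` B = set0 ->
  pr (A `|` B) = pr A + pr B.
Proof.
move=> mA mB AB0; rewrite /pr measureU// fineD// fin_num_measure//.
Qed.

Lemma pr_split A B : measurable A -> measurable B ->
  pr A = pr (A `&` B) + pr (A `&` ~` B).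
Proof.
move=> mA mB; rewrite -pr_disjointU.
- by rewrite -setIUr setUv setIT.
- exact: measurableI.
- by apply: measurableI => //; exact: measurableC.
- by rewrite setIACA setICr setI0.
Qed.

Lemma le_pr A B : measurable A -> measurable B -> A `<=` B -> pr A <= pr B.
Proof.
move=> mA mB AB; rewrite (pr_split mB mA) (setIidr AB) lerDl pr_ge0//.
Qed.

Lemma prU A B : measurable A -> measurable B ->
  pr (A `|` B) = pr A + pr B - pr (A `&` B).
Proof.
move=> mA mB; have mBA : measurable (B `&` ~` A).
  by apply: measurableI => //; exact: measurableC.
have -> : A `|` B = A `|` (B `&` ~` A) by rewrite setUIr setUv setIT.
rewrite pr_disjointU//; last by rewrite setIC -setIA setICl setI0.
by rewrite (pr_split mB mA) (setIC B A); ring.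
Qed.

Lemma pr_bigU_le (J : seq nat) (F : nat -> set T) (x : R) :
  (forall i, measurable (F i)) -> (forall i, i \in J -> pr (F i) <= x) ->
  pr (\big[setU/set0]_(i <- J) F i) <= (size J)%:R * x.
Proof.
move=> mF; elim: J => [|i J IH] FJ.
  by rewrite big_nil /pr measure0 mul0r.
rewrite big_cons prU//; last by apply: bigsetU_measurable => *; exact: mF.
have := FJ i (mem_head _ _).
have : pr (\big[setU/set0]_(i <- J) F i) <= (size J)%:R * x.
  by apply: IH => j jJ; apply: FJ; rewrite inE jJ orbT.
have := pr_ge0 (F i `&` \big[setU/set0]_(i <- J) F i).
rewrite /= -natr1; lra.
Qed.

(** Bonferroni's inequality, with the same bound for all the overlaps. *)
Lemma pr_bigU_ge (J : seq nat) (F : nat -> set T) (x y : R) :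
  uniq J -> (forall i, measurable (F i)) ->
  (forall i, i \in J -> x <= pr (F i)) ->
  (forall i j, i \in J -> j \in J -> i != j -> pr (F i `&` F j) <= y) ->
  0 <= y ->
  (size J)%:R * x - (size J)%:R ^+ 2 * y <= pr (\big[setU/set0]_(i <- J) F i).
Proof.
move=> + mF + + y0; elim: J => [|i J IH] /=.
  by move=> _ _ _; rewrite big_nil /pr measure0 /=; lra.
move=> /andP[iJ uJ] xF Fy.
have mU : measurable (\big[setU/set0]_(i <- J) F i).
  by apply: bigsetU_measurable => *; exact: mF.
rewrite big_cons prU//.
have := xF i (mem_head _ _).
have : (size J)%:R * x - (size J)%:R ^+ 2 * y <= pr (\big[setU/set0]_(i <- J) F i).
  apply: IH => // [j jJ|j k jJ kJ]; first by apply: xF; rewrite inE jJ orbT.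
  by apply: Fy; rewrite inE ?jJ ?kJ orbT.
have : pr (F i `&` \big[setU/set0]_(i <- J) F i) <= (size J)%:R * y.
  rewrite big_distrr /=; apply: pr_bigU_le => [j|j jJ].
    exact: measurableI.
  by apply: Fy; rewrite ?mem_head ?inE ?jJ ?orbT//; apply: contraNneq iJ => ->.
rewrite -natr1; move: (size J)%:R (ler0n R (size J)) => m m0 h1 h2 h3.
have : 0 <= m * y by rewrite mulr_ge0.
by lra.
Qed.

End real_probability.

Section pair_free.
Context {disp : measure_display} {T : measurableType disp} {R : realType}.
Variable P : probability T R.
Variable A : nat -> nat -> set T.
Hypothesis mA : forall i j, measurable (A i j).
Hypothesis symA : forall i j, A i j = A j i.

Definition pair_free (J : seq nat) : set T :=
  [set w | forall i j, i \in J -> j \in J -> i != j -> ~ A i j w].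

Lemma pair_freeE (J : seq nat) :
  pair_free J = \bigcap_(i in [set` J]) \bigcap_(j in [set` J])
                  (if i != j then ~` A i j else setT).
Proof.
apply/seteqP; split => w /= Jw.
  by move=> i /= iJ j /= jJ; case: ifPn => // ij; exact: Jw.
by move=> i j iJ jJ ij; have := Jw i iJ j jJ; rewrite /= ij.
Qed.

Lemma measurable_pair_free (J : seq nat) : measurable (pair_free J).
Proof.
rewrite pair_freeE; apply: bigcap_measurableType => i _.
apply: bigcap_measurableType => j _; case: ifP => // _; exact: measurableC.
Qed.

Lemma pair_free_cons v (J : seq nat) : v \notin J ->
  pair_free (v :: J) = pair_free J `&` ~` \big[setU/set0]_(i <- J) A v i.
Proof.
move=> vJ; rewrite -bigcup_seq; apply/seteqP; split => w /=.
  move=> h; split.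
    by move=> i j iJ jJ; apply: h; rewrite inE ?iJ ?jJ orbT.
  move=> [i /= iJ]; apply: h; rewrite ?mem_head ?inE ?iJ ?orbT//.
  by apply: contraNneq vJ => ->.
move=> [h1 h2] i j; rewrite !inE => /orP[/eqP ->|iJ] /orP[/eqP ->|jJ] ij.
- by rewrite eqxx in ij.
- by move=> Aw; apply: h2; exists j.
- by rewrite symA => Aw; apply: h2; exists i.
- exact: h1.
Qed.

Lemma pair_free_subset (I J : seq nat) : {subset I <= J} ->
  pair_free J `<=` pair_free I.
Proof. by move=> IJ w Jw i j iI jI; apply: Jw; exact: IJ. Qed.

Variables p q : R.
Hypothesis q0 : 0 <= q.
Hypothesis prA : forall i j, i != j -> pr P (A i j) = p.
Hypothesis prAA : forall i j k, i != j -> i != k -> j != k ->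
  pr P (A i j `&` A i k) <= q.
Hypothesis indep : forall (J : seq nat) i j, i != j -> i \notin J -> j \notin J ->
  pr P (pair_free J `&` A i j) = pr P (pair_free J) * p.

Let mU v (J : seq nat) : measurable (\big[setU/set0]_(i <- J) A v i).
Proof. by apply: bigsetU_measurable => *; exact: mA. Qed.

(** Lets an index be dropped, to create independence, at a cost proportional to
the size. *)
Lemma pair_free_rem_le i (J : seq nat) : uniq J -> i \in J ->
  pr P (pair_free (rem i J)) <= pr P (pair_free J) + (size J)%:R * p.
Proof.
move=> uJ iJ; have miJ := measurable_pair_free (rem i J).
rewrite (pr_split P miJ (mU i (rem i J))).
have -> : pair_free (rem i J) `&` ~` (\big[setU/set0]_(i0 <- rem i J) A i i0)
    = pair_free J.
  rewrite -pair_free_cons; last by rewrite mem_rem_uniqF.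
  by rewrite /pair_free; apply/seteqP; split=> w h j k jJ kJ;
    apply: h; rewrite ?(perm_mem (perm_to_rem iJ))// -(perm_mem (perm_to_rem iJ)).
rewrite addrC lerD2l.
have p0 : 0 <= p by rewrite -(@prA 0%N 1%N)// pr_ge0.
apply: (@le_trans _ _ (pr P (\big[setU/set0]_(i0 <- rem i J) A i i0))).
  by apply: le_pr => //; exact: measurableI.
apply: (@le_trans _ _ ((size (rem i J))%:R * p)).
  apply: pr_bigU_le => // j; rewrite mem_rem_uniq// inE => /andP[ji _].
  by rewrite prA// eq_sym.
by rewrite ler_wpM2r// ler_nat size_rem// leq_pred.
Qed.

(** Adding the index v destroys pair-freeness through one of the events A v i.
They overlap with probability at most q, and, once i is removed from J, A v i is
independent of what J does. *)
Lemma pair_free_step v (J : seq nat) (m := (size J)%:R : R) :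
  uniq J -> v \notin J ->
  `|pr P (pair_free (v :: J)) - pr P (pair_free J) * (1 - m * p)|
    <= m ^+ 2 * (p ^+ 2 + 2 * q).
Proof.
move=> uJ vJ; have mJ := measurable_pair_free J.
have m0 : 0 <= m by exact: ler0n.
have p0 : 0 <= p by rewrite -(@prA 0%N 1%N)// pr_ge0.
have := pr_split P mJ (mU v J); rewrite -pair_free_cons// big_distrr/= => Jsplit.
have ivP i : i \in J -> v != i by apply: contraTneq => <-.
have mJA i : measurable (pair_free J `&` A v i) by exact: measurableI.
have remE i : i \in J -> pr P (pair_free (rem i J) `&` A v i) =
    pr P (pair_free (rem i J)) * p.
  move=> iJ; apply: indep; rewrite ?ivP//.
    by apply: contra vJ; exact: mem_rem.
  by rewrite mem_rem_uniqF.
have sub_rem i : pair_free J `<=` pair_free (rem i J).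
  by apply: pair_free_subset => j; exact: mem_rem.
have ub : pr P (\big[setU/set0]_(i <- J) (pair_free J `&` A v i))
    <= m * ((pr P (pair_free J) + m * p) * p).
  apply: pr_bigU_le => // i iJ.
  apply: (@le_trans _ _ (pr P (pair_free (rem i J) `&` A v i))).
    apply: le_pr => //; last by apply: setSI; exact: sub_rem.
    by apply: measurableI => //; exact: measurable_pair_free.
  by rewrite remE// ler_wpM2r//; exact: pair_free_rem_le.
(* Putting i back costs at most m q, the probability that A v i occurs together
with a pair containing i; the last term accounts for the overlaps. *)
have lb : m * (pr P (pair_free J) * p - m * q) - m ^+ 2 * q <=
    pr P (\big[setU/set0]_(i <- J) (pair_free J `&` A v i)).
  apply: pr_bigU_ge => //; last first.
    move=> i j iJ jJ ij; apply: le_trans (prAA (ivP _ iJ) (ivP _ jJ) ij).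
    apply: le_pr; do ?exact: measurableI.
    by move=> w [[_ ?] [_ ?]].
  move=> i iJ; have miJ := measurable_pair_free (rem i J).
  have mV := mU i (rem i J).
  have : pr P (pair_free (rem i J)) * p >= pr P (pair_free J) * p.
    by rewrite ler_wpM2r// le_pr.
  rewrite -remE//.
  have : pr P (A v i `&` \big[setU/set0]_(j <- rem i J) A i j) <= m * q.
    rewrite big_distrr/=.
    apply: (@le_trans _ _ ((size (rem i J))%:R * q)).
      apply: pr_bigU_le => [j|j]; first exact: measurableI.
      rewrite mem_rem_uniq// inE => /andP[ji jJ]; rewrite symA.
      by apply: prAA; [rewrite eq_sym ivP|rewrite eq_sym|exact: ivP].
    by rewrite ler_wpM2r// ler_nat size_rem// leq_pred.
  rewrite (pr_split P (measurableI _ _ miJ (mA v i)) mV) => h1.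
  have : pr P (pair_free (rem i J) `&` A v i `&`
      \big[setU/set0]_(j <- rem i J) A i j) <= m * q.
    apply: le_trans h1; apply: le_pr; try by repeat apply: measurableI.
    by move=> w [[_ ?] ?].
  have : pr P (pair_free (rem i J) `&` A v i `&` ~`
      \big[setU/set0]_(j <- rem i J) A i j) <= pr P (pair_free J `&` A v i).
    apply: le_pr => //.
      by apply: measurableI; [exact: measurableI|exact: measurableC].
    move=> w [[h2 h3] h4]; split => // j k.
    rewrite !(perm_mem (perm_to_rem iJ)) => jJ kJ.
    have : pair_free (i :: rem i J) w by rewrite pair_free_cons// mem_rem_uniqF.
    exact.
  lra.
have := pr_ge0 P (pair_free J); have := pr_le1 P mJ; move: Jsplit ub lb.
move: (pr P (pair_free J)) (pr P (pair_free (v :: J))) (pr P (\big[_/_]_(_ <- _) _)).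
move=> x y z -> ub lb x1 x0; rewrite ler_norml; apply/andP; split.
  have : 0 <= m ^+ 2 * q by rewrite mulr_ge0// sqr_ge0.
  lra.
have : 0 <= m ^+ 2 * p ^+ 2 by rewrite mulr_ge0// sqr_ge0.
lra.
Qed.

End pair_free.

Lemma expRN_sub_le (R : realType) (y : R) : 0 <= y ->
  `|expR (- y) - (1 - y)| <= y ^+ 2.
Proof.
move=> y0; have y1 : 0 < 1 + y by lra.
have lb := expR_ge1Dx (- y).
have ub : expR (- y) <= (1 + y)^-1.
  by rewrite expRN lef_pV2 ?posrE ?expR_gt0//; exact: expR_ge1Dx.
have : (1 + y)^-1 <= 1 - y + y ^+ 2.
  rewrite -(ler_pM2l y1) divff ?gt_eqF//.
  have : 0 <= y ^+ 3 by exact: exprn_ge0.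
  by rewrite !exprS expr0; lra.
by rewrite ler_norml; move: ub lb; move: (expR _) ((1 + y)^-1) => e f; lra.
Qed.

(** The factors 1 - m p of the successive steps multiply up to the exponential,
each of them being exp (- m p) up to (m p)^2. *)
Lemma pair_free_Poisson {disp : measure_display} {T : measurableType disp}
    {R : realType} (P : probability T R) (A : nat -> nat -> set T)
    (mA : forall i j, measurable (A i j)) (symA : forall i j, A i j = A j i)
    (p q : R) (q0 : 0 <= q)
    (prA : forall i j, i != j -> pr P (A i j) = p)
    (prAA : forall i j k, i != j -> i != k -> j != k ->
      pr P (A i j `&` A i k) <= q)
    (indep : forall (J : seq nat) i j, i != j -> i \notin J -> j \notin J ->
      pr P (pair_free A J `&` A i j) = pr P (pair_free A J) * p)
    (J : seq nat) (m := (size J)%:R : R) :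
  uniq J -> m * p <= 1 ->
  `|pr P (pair_free A J) - expR (- (p * (m * (m - 1)) / 2))|
    <= m ^+ 3 * (2 * (p ^+ 2 + q)).
Proof.
rewrite {}/m; elim: J => [|v J IH] /=.
  move=> _ _; rewrite !mul0r mulr0 mul0r oppr0 expR0.
  have -> : pair_free A [::] = setT by apply/seteqP; split.
  by rewrite /pr probability_setT subrr normr0 expr0n mul0r.
move=> /andP[vJ uJ]; have p0 : 0 <= p by rewrite -(@prA 0%N 1%N)// pr_ge0.
rewrite -natr1; have := pair_free_step mA symA q0 prA prAA indep uJ vJ.
have := IH uJ; have : 0 <= (size J)%:R * ((size J)%:R - 1) :> R.
  by case: (size J) => [|k]; rewrite ?mul0r// mulr_ge0// subr_ge0 ler1n.
move: (size J)%:R (ler0n R (size J)) => m m0 mm1 {}IH step mp1.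
have mp : m * p <= 1 by apply: le_trans mp1; rewrite ler_wpM2r// lerDl.
have mp0 : 0 <= m * p by exact: mulr_ge0.
have := IH mp; move: step.
have -> : - (p * ((m + 1) * (m + 1 - 1)) / 2) =
   - (p * (m * (m - 1)) / 2) + - (m * p) by field.
rewrite expRD.
have : expR (- (p * (m * (m - 1)) / 2)) * `|expR (- (m * p)) - (1 - m * p)|
    <= 1 * (m * p) ^+ 2.
  apply: ler_pM => //; rewrite ?expR_ge0// ?expRN_sub_le//.
  rewrite -[leRHS]expR0 ler_expR.
  have := mulr_ge0 p0 mm1.
  by move: (p * _) => z; lra.
move: (expR (- (p * _ / 2))) (expR_ge0 (- (p * (m * (m - 1)) / 2))) => f f0.
move: (expR _) (pr _ _) (pr _ _) => e y x.
rewrite -[X in X * `|_| <= _](ger0_norm f0) -normrM => he hs hi.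
have -> : x - f * e = (x - y * (1 - m * p)) + (1 - m * p) * (y - f) - f * (e - (1 - m * p)).
  by ring.
apply: le_trans (ler_normB _ _) _; apply: le_trans (lerD (ler_normD _ _) he) _.
rewrite normrM (@ger0_norm _ (1 - m * p)); last by rewrite subr_ge0.
have : (1 - m * p) * `|y - f| <= m ^+ 3 * (2 * (p ^+ 2 + q)).
  apply: le_trans hi; rewrite -[leRHS]mul1r ler_wpM2r//; lra.
have : 0 <= (m ^+ 2 * 2 + 3 * m + 1) * (2 * (p ^+ 2 + q)).
  by rewrite mulr_ge0// ?addr_ge0 ?mulr_ge0 ?exprn_ge0// addr_ge0// exprn_ge0.
move: hs; rewrite exprMn; lra.
Qed.

(** * Independence of disjoint families *)

Section independence.
Context {disp disp' : measure_display} {T : measurableType disp}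
  {T' : measurableType disp'} {R : realType}.
Variables (P : probability T R) (X : nat -> {RV P >-> T'}).

(** The sets E with P (E F) = P E P F form a Dynkin system. *)
Lemma indep_g_sigma_algebra (C : set (set T)) (F : set T) :
  setI_closed C -> C `<=` measurable -> measurable F ->
  (forall E, C E -> P (E `&` F) = P E * P F)%E ->
  forall E, <<s C >> E -> measurable E /\ (P (E `&` F) = P E * P F)%E.
Proof.
move=> CI Cm mF CF E; rewrite -setI_closed_g_dynkin_g_sigma_algebra//.
apply: (@smallest_sub _ _ _ [set E | measurable E /\
  (P (E `&` F) = P E * P F)%E]); last by move=> B CB; split; [exact: Cm|exact: CF].
split.
- by split=> //; rewrite setTI probability_setT mul1e.
- move=> B [mB BF]; split; first exact: measurableC.
  have := pr_split P mF mB; rewrite (setIC F B) (setIC F) => h.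
  have mCB : measurable (~` B) by exact: measurableC.
  rewrite !prE//; last exact: measurableI.
  rewrite -EFinM; congr EFin.
  have hB : pr P (B `&` F) = pr P B * pr P F by rewrite /pr BF fineM// fin_num_measure.
  have hC : pr P (~` B) = 1 - pr P B.
    rewrite /pr probability_setC// fineB// fin_num_measure//.
  by rewrite hC mulrBl mul1r -hB h addrC addKr.
- move=> G tG GF; split; first by apply: bigcup_measurable => k _; exact: (GF k).1.
  rewrite setI_bigcupl measure_bigcup//=; last 2 first.
    by move=> k _; apply: measurableI => //; exact: (GF k).1.
    by apply: trivIset_setIr.
  rewrite (_ : P (\bigcup_k G k) = (\sum_(i <oo) P (G i))%E); last first.
    rewrite measure_bigcup//=; last by move=> k _; exact: (GF k).1.
    by apply: eq_eseriesl => i; rewrite in_setT.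
  transitivity (\sum_(0 <= i <oo) (P (G i) * P F))%E.
    rewrite (@eq_eseriesl _ _ xpredT); last by move=> i; rewrite in_setT.
    by apply: eq_eseriesr => i _; exact: (GF i).2.
  rewrite [RHS]muleC [in RHS]prE//. rewrite -nneseriesZl//.
  by apply: eq_eseriesr => i _; rewrite muleC prE.
Qed.

Definition cylinders (S : set nat) : set (set T) :=
  [set E | exists2 J : {fset nat}, [set` J] `<=` S &
     exists2 B : nat -> set T', (forall i, measurable (B i)) &
       E = \bigcap_(i in [set` J]) X i @^-1` B i].

Lemma measurable_cylinders S : cylinders S `<=` measurable.
Proof.
move=> E [J _ [B mB ->]]; apply: bigcap_measurableType => i _.
by rewrite -[X in measurable X]setTI; exact: measurable_funP.
Qed.

Lemma cylinders_setI_closed S : setI_closed (cylinders S).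
Proof.
move=> E F [J JS [B mB ->]] [K KS [C mC ->]]; exists (J `|` K)%fset.
  by move=> i /=; rewrite in_fsetU => /orP[/JS|/KS].
exists (fun i => (if i \in J then B i else setT) `&`
                 (if i \in K then C i else setT)).
  by move=> i; apply: measurableI; case: ifP.
apply/seteqP; split => w /=.
  move=> [h1 h2] i /=; rewrite in_fsetU => iJK; split.
    by case: ifPn => // iJ; exact: h1.
  by case: ifPn => // iK; exact: h2.
move=> h; split => i /= iJ.
  by have := h i; rewrite /= in_fsetU iJ /= => /(_ isT)[].
by have := h i; rewrite /= in_fsetU iJ orbT /= => /(_ isT)[].
Qed.

Lemma cylinders_coord S j (B : set T') : S j -> measurable B ->
  cylinders S (X j @^-1` B).
Proof.
move=> Sj mB; exists [fset j]%fset; first by move=> i /=; rewrite in_fset1 => /eqP ->.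
exists (fun=> B) => //; apply/seteqP; split => w /=.
  by move=> Bw i /=; rewrite in_fset1 => /eqP ->.
by apply; rewrite /= in_fset1.
Qed.

Hypothesis indepX : mutually_independent P X.

(** Two applications of Dynkin's theorem, one for each of the two families. *)
Lemma indep_disjoint_families (S S' : set nat) (E F : set T) :
  S `&` S' = set0 -> <<s cylinders S >> E -> <<s cylinders S' >> F ->
  (P (E `&` F) = P E * P F)%E.
Proof.
move=> SS'.
have cyl E' F' : cylinders S E' -> cylinders S' F' ->
    (P (E' `&` F') = P E' * P F')%E.
  move=> [J JS [B mB ->]] [K KS [C mC ->]].
  have JK i : i \in J -> i \in K -> False.
    by move=> /JS Si /KS S'i; have : (S `&` S') i by []; rewrite SS'.
  pose D i := if i \in J then B i else C i.
  have mD i : measurable (D i) by rewrite /D; case: ifP.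
  rewrite (_ : _ `&` _ = \bigcap_(i in [set` (J `|` K)%fset]) X i @^-1` D i); last first.
    apply/seteqP; split => w /=.
      move=> [h1 h2] i /=; rewrite in_fsetU /D; case: ifPn => [iJ _|_ /= iK].
        exact: h1.
      exact: h2.
    move=> h; split => i /= iJ; have := h i; rewrite /D /= in_fsetU iJ ?orbT/=.
      by move/(_ isT).
    by case: ifPn => [/JK/(_ iJ)//|_ /(_ isT)].
  have bE := indepX J mB; have bF := indepX K mC; have bD := indepX (J `|` K)%fset mD.
  rewrite bD bE bF (perm_big (J ++ K)%SEQ) ?big_cat/=; last first.
    apply: uniq_perm; rewrite ?fset_uniq// ?cat_uniq ?fset_uniq ?andbT/=.
      by apply/hasPn => i /= iK; apply/negP => /JK /(_ iK).
    by move=> i; rewrite in_fsetU mem_cat.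
  congr (_ * _)%E; apply: eq_big_seq => i iJ; rewrite /D ?iJ//.
  by case: ifPn => // /JK.
move=> SE S'F.
have indepT G : cylinders S' G -> (P (G `&` setT) = P G * P setT)%E.
  by move=> _; rewrite setIT probability_setT mule1.
have [mF _] := indep_g_sigma_algebra (@cylinders_setI_closed S')
  (@measurable_cylinders S') measurableT indepT S'F.
apply: (indep_g_sigma_algebra (@cylinders_setI_closed S)
  (@measurable_cylinders S) mF _ SE).2 => G SG.
rewrite setIC muleC.
apply: (indep_g_sigma_algebra (@cylinders_setI_closed S')
  (@measurable_cylinders S') (measurable_cylinders SG) _ S'F).2 => H S'H.
by rewrite setIC muleC; exact: cyl.
Qed.

Lemma measurable_cylinders_pair S i j (E : set (T' * T')) : S i -> S j ->
  measurable E -> <<s cylinders S >> [set w | E (X i w, X j w)].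
Proof.
move=> Si Sj mE.
have mX k : S k -> measurable_fun [set: g_sigma_algebraType (cylinders S)]
    (X k : g_sigma_algebraType (cylinders S) -> T').
  move=> Sk _ B mB; rewrite setTI; apply: sub_sigma_algebra.
  exact: cylinders_coord.
have := measurable_fun_pair (mX i Si) (mX j Sj).
by move=> /(_ measurableT E mE); rewrite setTI.
Qed.

End independence.

Section product_law.
Context {d d1 d2 : measure_display} {T : measurableType d}
  {T1 : measurableType d1} {T2 : measurableType d2} {R : realType}.
Variables (P : probability T R) (Y : {mfun T >-> T1}) (Z : {mfun T >-> T2}).

(** The product measure is determined by its values on rectangles. *)
Lemma indep_product_law :
  (forall B C, measurable B -> measurable C ->
    P (Y @^-1` B `&` Z @^-1` C) = P (Y @^-1` B) * P (Z @^-1` C))%E ->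
  forall S, measurable S ->
    P [set w | S (Y w, Z w)] = (distribution P Y \x distribution P Z)%E S.
Proof.
move=> YZ S mS; pose YZf w := (Y w, Z w).
have mYZ : measurable_fun setT YZf by apply: measurable_fun_pair.
pose YZm : {mfun T >-> (T1 * T2)%type} := mfun_Sub (mem_set mYZ).
have -> : P [set w | S (Y w, Z w)] = distribution P YZm S by [].
by apply/esym/product_measure_unique.

Qed.
End product_law.

(** * Euclidean geometry and spherical symmetry *)

Section euclidean_space.
Context {R : realType} {d : nat}.
Implicit Types x y e : 'rV[R]_d.

Definition dot x y : R := (x *m y^T) ord0 ord0.

Local Notation nrm := (@euclidean_norm R d).

Lemma dotE x y : dot x y = \sum_(i < d) x ord0 i * y ord0 i.
Proof. by rewrite /dot mxE; apply: eq_bigr => i _; rewrite mxE. Qed.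

Lemma dotC x y : dot x y = dot y x.
Proof. by rewrite !dotE; apply: eq_bigr => i _; rewrite mulrC. Qed.

Lemma dotDl x y e : dot (x + y) e = dot x e + dot y e.
Proof. by rewrite /dot mulmxDl mxE. Qed.

Lemma dotZl k x e : dot (k *: x) e = k * dot x e.
Proof. by rewrite /dot -scalemxAl mxE. Qed.

Lemma dotNl x e : dot (- x) e = - dot x e.
Proof. by rewrite /dot mulNmx mxE. Qed.

Lemma dotDr x y e : dot x (y + e) = dot x y + dot x e.
Proof. by rewrite dotC dotDl !(dotC x). Qed.

Lemma dotZr k x e : dot x (k *: e) = k * dot x e.
Proof. by rewrite dotC dotZl dotC. Qed.

Lemma dotNr x e : dot x (- e) = - dot x e.
Proof. by rewrite dotC dotNl dotC. Qed.

Lemma dot_mulmx x y (Q : 'M[R]_d) : dot (x *m Q) y = dot x (y *m Q^T).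
Proof. by rewrite /dot trmx_mul trmxK mulmxA. Qed.

Lemma dot_ge0 x : 0 <= dot x x.
Proof. by rewrite dotE sumr_ge0// => i _; rewrite -expr2 sqr_ge0. Qed.

Lemma nrmE x : nrm x = Num.sqrt (dot x x).
Proof. by rewrite dotE /euclidean_norm; under eq_bigr do rewrite expr2. Qed.

Lemma nrm_ge0 x : 0 <= nrm x.
Proof. by rewrite nrmE sqrtr_ge0. Qed.

Lemma sqr_nrm x : nrm x ^+ 2 = dot x x.
Proof. by rewrite nrmE sqr_sqrtr// dot_ge0. Qed.

Lemma nrm_eq0 x : nrm x = 0 -> x = 0.
Proof.
move=> x0; have := sqr_nrm x; rewrite x0 expr0n/= dotE => /esym/eqP.
rewrite psumr_eq0; last by move=> i _; rewrite -expr2 sqr_ge0.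
move=> /allP x_eq0; apply/rowP => i; rewrite mxE; apply/eqP.
by have /= := x_eq0 i (mem_index_enum _); rewrite mulf_eq0 orbb.
Qed.

Lemma nrmZ k x : nrm (k *: x) = `|k| * nrm x.
Proof.
rewrite !nrmE dotZl dotZr mulrA -expr2 sqrtrM ?sqr_ge0// sqrtr_sqr//.
Qed.

Lemma nrmN x : nrm (- x) = nrm x.
Proof. by rewrite !nrmE dotNl dotNr opprK. Qed.

Lemma nrmB_sqr x y :
  nrm (x - y) ^+ 2 = nrm x ^+ 2 + nrm y ^+ 2 - 2 * dot x y.
Proof. by rewrite !sqr_nrm dotDl !dotDr !dotNr !dotNl (dotC y x); ring. Qed.

(** Expanding the squared norm of |y| x - |x| y, divided by |x| |y|. *)
Lemma dot_le_nrm x y : dot x y <= nrm x * nrm y.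
Proof.
have [/nrm_eq0 ->|x0] := eqVneq (nrm x) 0.
  by rewrite -(scale0r 0) dotZl mul0r mulr_ge0// nrm_ge0.
have [/nrm_eq0 ->|y0] := eqVneq (nrm y) 0.
  by rewrite -(scale0r 0) dotZr mul0r mulr_ge0// nrm_ge0.
have xy0 : 0 < nrm x * nrm y by rewrite mulr_gt0 ?lt_def ?nrm_ge0 ?x0 ?y0.
have := dot_ge0 (nrm y *: x - nrm x *: y).
rewrite dotDl !dotDr !dotNr !dotNl !dotZl !dotZr (dotC y x) -!sqr_nrm => h.
rewrite -subr_ge0 -(pmulr_rge0 _ xy0); move: h; lra.
Qed.

Lemma normr_dot_le x y : `|dot x y| <= nrm x * nrm y.
Proof.
rewrite ler_norml dot_le_nrm andbT lerNl -dotNr.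
by rewrite -[leRHS](congr1 ( *%R _) (nrmN y)) dot_le_nrm.
Qed.

Lemma nrm_mulmx x (Q : 'M[R]_d) : Q *m Q^T = 1%:M -> nrm (x *m Q) = nrm x.
Proof. by move=> QQ; rewrite !nrmE dot_mulmx -mulmxA QQ mulmx1. Qed.

(** The reflection exchanging the two unit vectors. *)
Lemma orthogonal_transitive x y : nrm x = 1 -> nrm y = 1 ->
  exists2 Q : 'M[R]_d, Q *m Q^T = 1%:M & x *m Q^T = y.
Proof.
move=> x1 y1; have [<-|xy] := eqVneq x y.
  by exists 1%:M; rewrite trmx1 mulmx1.
pose w := x - y.
have w0 : dot w w != 0.
  rewrite -sqr_nrm expf_eq0/=; apply: contra xy => /eqP/nrm_eq0/eqP.
  by rewrite subr_eq0.
pose M := w^T *m w; pose c := 2 / dot w w.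
pose Q : 'M[R]_d := 1%:M - c *: M.
have QT : Q^T = Q by rewrite /Q linearB/= trmx1 linearZ/= trmx_mul trmxK.
have dotM u : u *m w^T = (dot u w)%:M.
  by apply/rowP => i; rewrite [RHS]mxE !ord1 eqxx mulr1n.
have MM : M *m M = dot w w *: M.
  by rewrite /M mulmxA -(mulmxA w^T) dotM mul_mx_scalar -scalemxAl.
exists Q; rewrite QT.
  rewrite {1}/Q mulmxBl mul1mx -scalemxAl /Q mulmxBr mulmx1 -scalemxAr MM.
  rewrite scalerBr !scalerA -/c (_ : c * c * dot w w = c + c); last first.
    by rewrite -mulrA {2}/c divfK// mulr_natr mulr2n.
  by rewrite scalerDl opprB addrK subrK.
rewrite /Q mulmxBr mulmx1 -scalemxAr mulmxA dotM mul_scalar_mx scalerA.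
have wE : dot w w = 2 * dot x w.
  have xx : dot x x = 1 by rewrite -sqr_nrm x1 expr1n.
  have yy : dot y y = 1 by rewrite -sqr_nrm y1 expr1n.
  by rewrite /w !dotDl !dotDr !dotNr !dotNl xx yy (dotC y x); ring.
have -> : c * dot x w = 1.
  by rewrite /c mulrAC -wE divff.
by rewrite scale1r /w opprB addrC subrK.
Qed.

Lemma measurable_dot e : measurable_fun [set: 'rV[R]_d] (fun x => dot x e).
Proof.
rewrite (_ : (fun x => _) = fun x => \sum_(i < d) x ord0 i * e ord0 i); last first.
  by apply/funext => x; rewrite dotE.
apply: measurable_sum => i; apply: measurable_funM => //.
exact: measurable_rV_coord.
Qed.

Lemma measurable_dot2 :
  measurable_fun setT (fun z : ('rV[R]_d * 'rV[R]_d)%type => dot z.1 z.2).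
Proof.
rewrite (_ : (fun z => _) = fun z : ('rV[R]_d * 'rV[R]_d)%type =>
    \sum_(i < d) z.1 ord0 i * z.2 ord0 i); last first.
  by apply/funext => z; rewrite dotE.
apply: measurable_sum => i; apply: measurable_funM => //.
  exact: (measurableT_comp (measurable_rV_coord i)).
exact: (measurableT_comp (measurable_rV_coord i)).
Qed.

Lemma measurable_nrm : measurable_fun [set: 'rV[R]_d] nrm.
Proof.
have msqrt : measurable_fun [set: R] (@Num.sqrt R).
  exact: (continuous_measurable_fun (@sqrt_continuous R)).
apply: (measurableT_comp msqrt).
apply: measurable_sum => k; apply: measurable_funX; exact: measurable_rV_coord.
Qed.

End euclidean_space.

Section spherical_symmetry.
Context {R : realType} {d : nat}.
Variable mu : probability 'rV[R]_d R.
Hypothesis mu_sph : spherically_symmetric mu.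

Local Notation nrm := (@euclidean_norm R d).

(** An orthogonal map taking one direction to the other preserves the law and the
norm. *)
Lemma sph_direction e e' (S : set (R * R)) : nrm e = 1 -> nrm e' = 1 ->
  measurable S ->
  mu [set x | S (dot x e, nrm x)] = mu [set x | S (dot x e', nrm x)].
Proof.
move=> e1 e'1 mS; have [Q QQ eQ] := orthogonal_transitive e1 e'1.
have mE : measurable [set x | S (dot x e, nrm x)].
  have := measurable_fun_pair (measurable_dot e) measurable_nrm.
  by move=> /(_ measurableT S mS); rewrite setTI.
rewrite -(mu_sph QQ mE) /pushforward; congr (mu _).
apply/seteqP; split=> x /=; rewrite dot_mulmx eQ nrm_mulmx//.
Qed.

End spherical_symmetry.

(** * Independence of direction and length *)

Section product_sections.
Context {d1 d2 : measure_display} {T1 : measurableType d1}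
  {T2 : measurableType d2} {R : realType}.
Variables (m1 : {sigma_finite_measure set T1 -> \bar R})
  (m2 : {sigma_finite_measure set T2 -> \bar R}).
Local Open Scope ereal_scope.

Lemma product_measure_xsections (W : set (T1 * T2)) :
  (m1 \x m2) W = \int[m1]_x m2 [set y | W (x, y)].
Proof.
apply: eq_integral => x _ /=; congr (m2 _).
by apply/seteqP; split => y; rewrite /xsection/= in_setE.
Qed.

Lemma product_measure_ysections (W : set (T1 * T2)) : measurable W ->
  (m1 \x m2) W = \int[m2]_y m1 [set x | W (x, y)].
Proof.
move=> mW; rewrite (@product_measure_unique _ _ _ _ _ _ _ (m1 \x^ m2))//.
  apply: eq_integral => y _ /=; congr (m1 _).
  by apply/seteqP; split => x; rewrite /ysection/= in_setE.
by move=> A B mA mB; exact: product_measure2E.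
Qed.

End product_sections.

Section angle_independence.
Context {R : realType} {d : nat}.
Variable mu : probability 'rV[R]_d R.
Hypothesis mu_sph : spherically_symmetric mu.

Local Notation nrm := (@euclidean_norm R d).
Local Notation rV2 := ('rV[R]_d * 'rV[R]_d)%type.

Let mnrm1 : measurable_fun setT (fun z : rV2 => nrm z.1).
Proof. exact: (measurableT_comp measurable_nrm). Qed.

Let mnrm2 : measurable_fun setT (fun z : rV2 => nrm z.2).
Proof. exact: (measurableT_comp measurable_nrm). Qed.

Lemma measurable_preimageT d1 d2 (T1 : measurableType d1)
    (T2 : measurableType d2) (f : T1 -> T2) (S : set T2) :
  measurable_fun setT f -> measurable S -> measurable [set x | S (f x)].
Proof. by move=> mf mS; rewrite -[X in measurable X]setTI; exact: mf. Qed.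

Lemma measurable_preimage_gt d1 (T1 : measurableType d1) (f : T1 -> R) r :
  measurable_fun setT f -> measurable [set x | r < f x].
Proof.
move=> mf; rewrite (_ : [set x | _] = [set x | `]r, +oo[%classic (f x)]).
  exact: measurable_preimageT.
by apply/seteqP; split => x /=; rewrite in_itv/= andbT.
Qed.

Lemma measurable_nrm_gt r : measurable [set x | r < nrm x].
Proof. by apply: measurable_preimage_gt; exact: measurable_nrm. Qed.

Lemma measurable_inv : measurable_fun setT (fun x : R => x^-1).
Proof.
rewrite (_ : (fun x => _) = fun x : R => x * ((x ^+ 2) `^ (-1))).
  apply: measurable_funM => //.
  by apply: (measurableT_comp (measurable_powR _)); exact: measurable_funX.
apply/funext => x; rewrite powR_inv1 ?sqr_ge0//.
by have [->|x0] := eqVneq x 0; [rewrite mul0r invr0|rewrite expr2 invfM mulVKf].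
Qed.

Lemma measurable_inv_nrm : measurable_fun setT (fun x : 'rV[R]_d => (nrm x)^-1).
Proof. exact: (measurableT_comp measurable_inv measurable_nrm). Qed.

Lemma measurable_cosine (e : 'rV[R]_d) :
  measurable_fun setT (fun x => dot x e / nrm x).
Proof.
by apply: measurable_funM; [exact: measurable_dot|exact: measurable_inv_nrm].
Qed.

(** The direction and the length are independent: integrate the first indicator
below over x for fixed y, which makes y/|y| the reference direction, and over y
for fixed x, which makes x/|x| the reference direction. *)
Lemma angle_norm_independent e (S : set (R * R)) : nrm e = 1 -> measurable S ->
  (mu [set x | 0 < nrm x]%R *
   mu [set x | 0 < nrm x /\ S (dot x e / nrm x, nrm x)]%R =
  \int[mu]_(y in [set y | 0 < nrm y]%R)
     mu [set x | 0 < nrm x /\ S (dot y e / nrm y, nrm x)]%R)%E.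
Proof.
move=> e1 mS; pose NZ := [set x : 'rV[R]_d | 0 < nrm x].
have mNZ : measurable NZ by exact: measurable_nrm_gt.
pose D := [set z : rV2 | 0 < nrm z.1 /\ 0 < nrm z.2].
have mD : measurable D.
  by apply: measurableI; [exact: (measurable_preimageT measurable_fst mNZ)
    |exact: (measurable_preimageT measurable_snd mNZ)].
pose W1 := [set z : rV2 | D z /\ S (dot z.1 z.2 / nrm z.1 / nrm z.2, nrm z.1)].
pose W2 := [set z : rV2 | D z /\ S (dot z.2 e / nrm z.2, nrm z.1)].
have mW1 : measurable W1.
  apply: measurableI => //; apply: measurable_preimageT mS.
  apply: measurable_fun_pair => //; apply: measurable_funM.
    apply: measurable_funM; first exact: measurable_dot2.
    exact: (measurableT_comp measurable_inv_nrm).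
  exact: (measurableT_comp measurable_inv_nrm).
have mW2 : measurable W2.
  apply: measurableI => //; apply: measurable_preimageT mS.
  apply: measurable_fun_pair => //.
  exact: (measurableT_comp (measurable_cosine e)).
have unit x : 0 < nrm x -> nrm ((nrm x)^-1 *: x) = 1.
  by move=> x0; rewrite nrmZ ger0_norm ?invr_ge0 ?nrm_ge0// mulVf// gt_eqF.
have NZD : [set: 'rV[R]_d] = NZ `|` ~` NZ by rewrite setUv.
have W12 : (mu \x mu)%E W1 = (mu \x mu)%E W2.
  rewrite !product_measure_xsections; apply: eq_integral => x _.
  have [x0|x0] := ltP 0 (nrm x); last first.
    congr (mu _); apply/seteqP.
    by split => y [[/= x0' _] _]; move: x0; rewrite leNgt x0'.
  have mS' : measurable [set z : R * R | 0 < z.2 /\ S (z.1 / z.2, nrm x)].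
    apply: measurableI; first exact: measurable_preimage_gt.
    apply: measurable_preimageT mS; apply: measurable_fun_pair => //.
    by apply: measurable_funM => //; exact: (measurableT_comp measurable_inv).
  have := sph_direction mu_sph (unit x x0) e1 mS'.
  set A := [set _ | _]; set B := [set _ | _] => AB.
  transitivity (mu A); last transitivity (mu B) => //; congr (mu _).
    apply/seteqP; split => y; rewrite /W1 /D /A/= dotZr dotC [_^-1 * _]mulrC.
      by case=> -[_ y0] Sy.
    by case=> y0 Sy.
  by apply/seteqP; split => y; rewrite /W2 /D /B/=; [case|case=> -[]].
have -> : (\int[mu]_(y in NZ)
     mu [set x | 0 < nrm x /\ S (dot y e / nrm y, nrm x)]%R = (mu \x mu) W2)%E.
  rewrite (product_measure_ysections _ _ mW2) integral_mkcond.
  apply: eq_integral => y _; rewrite patchE; case: ifPn.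
    rewrite in_setE => y0; congr (mu _); rewrite /W2 /D.
    by apply/seteqP; split => x /=; [case|case=> -[]].
  rewrite notin_setE => y0; rewrite (_ : [set x | _] = set0) ?measure0//.
  by apply/seteqP; split => x //= -[[]].
rewrite -W12 (product_measure_ysections _ _ mW1).
set m0 := (mu [set x | _ /\ _]).
rewrite (_ : (\int[mu]_y _ = \int[mu]_(y in NZ) m0)%E).
  by rewrite integral_cst// muleC.
rewrite [in RHS]integral_mkcond.
apply: eq_integral => y _; rewrite patchE; case: ifPn; last first.
  rewrite notin_setE => y0; rewrite (_ : [set x | _] = set0) ?measure0//.
  by apply/seteqP; split => x //= -[[]].
rewrite in_setE => y0.
have mS' : measurable [set z : R * R | 0 < z.2 /\ S (z.1 / z.2, z.2)].
  apply: measurableI; first exact: measurable_preimage_gt.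
  apply: measurable_preimageT mS; apply: measurable_fun_pair => //.
  by apply: measurable_funM => //; exact: (measurableT_comp measurable_inv).
have := sph_direction mu_sph (unit y y0) e1 mS'.
set A := [set _ | _]; set B := [set _ | _] => AB.
transitivity (mu A) => //; congr (mu _).
apply/seteqP; split => x; rewrite /W1 /D /A/= dotZr [_^-1 * _]mulrC -!mulrA.
  by case=> -[x0 _]; rewrite (mulrC _^-1).
by case=> x0; rewrite (mulrC _^-1).
Qed.

End angle_independence.

(** * Moments of the cosine *)

(** The field is infinite, and a nonzero polynomial has finitely many roots. *)
Lemma poly_eq_horner (R : realType) (p q : {poly R}) :
  (forall s, p.[s] = q.[s]) -> p = q.
Proof.
move=> pq; apply/eqP; rewrite -subr_eq0; apply/eqP.
apply: (@roots_geq_poly_eq0 _ _ [seq k%:R | k <- iota 0 (size (p - q))]).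
- by apply/allP => _ /mapP[k _ ->]; rewrite rootE hornerD hornerN pq subrr.
- rewrite map_inj_uniq ?iota_uniq// => i j /eqP.
  by rewrite eqr_nat => /eqP.
- by rewrite size_map size_iota.
Qed.

Lemma coef_1DXsqr_exp (R : realType) m :
  ((1 + 'X^2 : {poly R}) ^+ m)`_0 = 1 /\ ((1 + 'X^2 : {poly R}) ^+ m)`_2 = m%:R.
Proof.
elim: m => [|m [IH0 IH2]]; first by rewrite expr0 !coef1.
rewrite exprS mulrDl mul1r !coefD !coefXnM/= IH0 IH2 addr0.
by rewrite -natr1.
Qed.

Section cosine_moments.
Context {R : realType} {d : nat}.
Variable mu : probability 'rV[R]_d R.
Hypothesis mu_sph : spherically_symmetric mu.

Local Notation nrm := (@euclidean_norm R d).
Local Notation NZ := [set x : 'rV[R]_d | 0 < nrm x].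

Definition cosine (e x : 'rV[R]_d) := dot x e / nrm x.

Lemma measurable_cosine_pow e n : measurable_fun setT (fun x => cosine e x ^+ n).
Proof. by apply: measurable_funX; exact: measurable_cosine. Qed.

Lemma normr_cosine_le1 e x : nrm e = 1 -> `|cosine e x| <= 1.
Proof.
move=> e1; have := nrm_ge0 x; rewrite le_eqVlt => /orP[/eqP x0|x0].
  by rewrite /cosine -x0 invr0 mulr0 normr0.
rewrite /cosine normrM normfV (gtr0_norm x0) ler_pdivrMr// mul1r.
by rewrite (le_trans (normr_dot_le _ _))// e1 mulr1.
Qed.

Lemma bounded_integrable (D : set 'rV[R]_d) (f : 'rV[R]_d -> R) C :
  measurable D -> measurable_fun setT f -> (forall x, `|f x| <= C) ->
  mu.-integrable D (EFin \o f).
Proof.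
move=> mD mf fC; apply: measurable_bounded_integrable => //.
- by rewrite (le_lt_trans (probability_le1 _ _))// ltry.
- exact: measurable_funS mf.
- by exists C; split; [exact: num_real|move=> M CM x _; apply: le_trans (fC x) (ltW CM)].
Qed.

(** The case of sph_direction for functions of the cosine alone. *)
Lemma cosine_integral_invariant e e' (g : R -> \bar R) :
  nrm e = 1 -> nrm e' = 1 -> measurable_fun setT g -> (forall r, 0 <= g r)%E ->
  (\int[mu]_(x in NZ) g (cosine e x) = \int[mu]_(x in NZ) g (cosine e' x))%E.
Proof.
move=> e1 e'1 mg g0; pose F e x := (dot x e, nrm x).
have mF f : measurable_fun setT (F f).
  by apply: measurable_fun_pair; [exact: measurable_dot|exact: measurable_nrm].
pose D := [set z : R * R | 0 < z.2].
have mD : measurable D by exact: measurable_preimage_gt.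
pose G (z : R * R) := g (z.1 / z.2).
have mG : measurable_fun setT G.
  apply: (measurableT_comp mg); apply: measurable_funM => //.
  exact: (measurableT_comp measurable_inv).
have push f : (\int[mu]_(x in NZ) g (cosine f x) =
    \int[pushforward mu (F f)]_(z in D) G z)%E.
  rewrite ge0_integral_pushforward//; first exact: measurable_funS mG.
  by move=> z _; exact: g0.
rewrite !push.
pose Fe : {mfun 'rV[R]_d >-> (R * R)%type} := mfun_Sub (mem_set (mF e)).
pose Fe' : {mfun 'rV[R]_d >-> (R * R)%type} := mfun_Sub (mem_set (mF e')).
transitivity (\int[distribution mu Fe]_(z in D) G z)%E => //.
transitivity (\int[distribution mu Fe']_(z in D) G z)%E => //.
apply: eq_measure_integral.
by move=> B mB _; exact: (sph_direction mu_sph e1 e'1 mB).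
Qed.

Definition moment e n : R := \int[mu]_(x in NZ) cosine e x ^+ n.

Let mNZ : measurable NZ. Proof. exact: measurable_nrm_gt. Qed.

Let integrable_mix e e' i j : nrm e = 1 -> nrm e' = 1 ->
  mu.-integrable NZ (EFin \o (fun x => cosine e x ^+ i * cosine e' x ^+ j)).
Proof.
move=> e1 e'1; apply: (@bounded_integrable _ _ 1) => //.
  by apply: measurable_funM; exact: measurable_cosine_pow.
by move=> x; rewrite normrM !normrX mulr_ile1 ?exprn_ile1// normr_cosine_le1.
Qed.

Lemma moment_even_invariant e e' m : nrm e = 1 -> nrm e' = 1 ->
  moment e (2 * m) = moment e' (2 * m).
Proof.
move=> e1 e'1; rewrite /moment /Rintegral; congr fine.
apply: (cosine_integral_invariant (g := fun r => (r ^+ (2 * m))%:E)) => //.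
  by apply: measurableT_comp => //; exact: measurable_funX.
by move=> r; rewrite lee_fin exprM exprn_ge0// sqr_ge0.
Qed.

Lemma Rintegral_sum (I : Type) (s : seq I) (f : I -> 'rV[R]_d -> R) :
  (forall i, mu.-integrable NZ (EFin \o f i)) ->
  \int[mu]_(x in NZ) (\sum_(i <- s) f i x) = \sum_(i <- s) \int[mu]_(x in NZ) f i x.
Proof.
move=> intf; rewrite /Rintegral.
under eq_integral do rewrite -sumEFin.
rewrite (integral_sum mNZ intf) -sum_fine// => i _.
by apply: integrable_fin_num => //; exact: intf.
Qed.

(** The moment in the direction of e + s e' is (1 + s^2)^m times the one in the
direction of e: compare the coefficients of s^2. *)
Lemma moment_orthogonal e e' m : nrm e = 1 -> nrm e' = 1 -> dot e e' = 0 ->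
  (2 * m + 1)%:R * \int[mu]_(x in NZ) (cosine e x ^+ (2 * m) * cosine e' x ^+ 2)
    = moment e (2 * m.+1).
Proof.
move=> e1 e'1 ee'; set n := (2 * m.+1)%N.
pose N j := \int[mu]_(x in NZ) (cosine e x ^+ (n - j) * cosine e' x ^+ j).
pose p := \poly_(j < n.+1) (N j *+ 'C(n, j)).
have pE s : p.[s] = \int[mu]_(x in NZ) (cosine e x + s * cosine e' x) ^+ n.
  rewrite horner_poly; under [RHS]eq_Rintegral do rewrite exprDn.
  rewrite Rintegral_sum => [|j]; last first.
    have := integrable_mix (n - j) j e1 e'1.
    move=> /(integrableZl mNZ (s ^+ j *+ 'C(n, j))); apply: eq_integrable => //.
    by move=> x _ /=; rewrite -EFinM (exprMn _ s) mulrnAl mulrCA.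
  apply: eq_bigr => j _; rewrite mulrnAl mulrC -mulrnAl /N.
  rewrite -RintegralZl//; last exact: integrable_mix.
  by apply: eq_Rintegral => x _ /=; rewrite (exprMn _ s) mulrnAl mulrCA.
have pq : p = moment e n *: (1 + 'X^2) ^+ m.+1.
  apply: poly_eq_horner => s; rewrite pE hornerZ horner_exp hornerD hornerXn hornerC.
  have s1 : 0 < 1 + s ^+ 2 by rewrite ltr_wpDr// sqr_ge0.
  pose k := (Num.sqrt (1 + s ^+ 2))^-1.
  have k2 : k ^+ 2 = (1 + s ^+ 2)^-1 by rewrite /k exprVn sqr_sqrtr// ltW.
  have f1 : nrm (k *: (e + s *: e')) = 1.
    rewrite nrmZ nrmE dotDl !dotDr !dotZl !dotZr (dotC e' e) ee' -!sqr_nrm e1 e'1.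
    rewrite expr1n !mulr0 addr0 add0r mulr1 -expr2 ger0_norm ?invr_ge0 ?sqrtr_ge0//.
    by rewrite mulVf// gt_eqF// sqrtr_gt0.
  rewrite /n (moment_even_invariant m.+1 e1 f1) /moment.
  rewrite mulrC -RintegralZl//; last first.
    apply: (@bounded_integrable _ _ 1) => //; first exact: measurable_cosine_pow.
    by move=> x; rewrite normrX exprn_ile1// normr_cosine_le1.
  apply: eq_Rintegral => x _; rewrite /cosine dotZr dotDr dotZr.
  rewrite -(mulrA k) (exprMn _ k) (exprM k) k2 [RHS]mulrA exprVn mulfV ?mul1r; last first.
    by rewrite expf_neq0// gt_eqF.
  by rewrite mulrDl -mulrA.
have := congr1 (fun q : {poly R} => q`_2) pq; rewrite coefZ (coef_1DXsqr_exp R m.+1).2.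
rewrite coef_poly /n mulnS /= /N /n mulnS addKn => h.
have : 'C(2 + 2 * m, 2) = (m.+1 * (2 * m + 1))%N.
  rewrite bin2 -[RHS]doubleK -muln2; congr (_./2).
  by rewrite add2n addn1 mulnAC; congr (_ * _)%N; rewrite [RHS]mulnC mulnS.
move=> c2; move: h; rewrite c2 -[X in X = _]mulr_natl natrM -mulrA.
rewrite [LHS]mulrC => /mulIf; apply.
by rewrite pnatr_eq0.
Qed.

Local Notation basis i := (delta_mx ord0 i : 'rV[R]_d).

Lemma dot_basis (x : 'rV[R]_d) i : dot x (basis i) = x ord0 i.
Proof.
rewrite dotE (bigD1 i)//= mxE !eqxx mulr1 big1 ?addr0// => j ji.
by rewrite mxE eqxx (negPf ji) mulr0.
Qed.

Lemma nrm_basis i : nrm (basis i) = 1.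
Proof. by rewrite nrmE dot_basis mxE !eqxx sqrtr1. Qed.

(** The squares of the cosines along an orthonormal basis add up to 1; multiply
by an even power of one of them and integrate, the mixed terms being given by
moment_orthogonal. *)
Lemma momentS i m :
  (2 * m + d)%:R * moment (basis i) (2 * m.+1) =
  (2 * m + 1)%:R * moment (basis i) (2 * m).
Proof.
have -> : moment (basis i) (2 * m) = \int[mu]_(x in NZ)
    (\sum_(j < d) cosine (basis i) x ^+ (2 * m) * cosine (basis j) x ^+ 2).
  apply: eq_Rintegral => x; rewrite in_setE /= => x0.
  rewrite -mulr_sumr (_ : \sum_j _ = 1) ?mulr1//.
  under eq_bigr do rewrite /cosine dot_basis exprMn exprVn expr2.
  by rewrite -mulr_suml -dotE -sqr_nrm mulfV// expf_neq0// gt_eqF.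
rewrite Rintegral_sum => [|j]; last by apply: integrable_mix; exact: nrm_basis.
rewrite mulr_sumr (bigD1 i)//=.
have -> : \int[mu]_(x in NZ) (cosine (basis i) x ^+ (2 * m) * cosine (basis i) x ^+ 2)
   = moment (basis i) (2 * m.+1).
  by apply: eq_Rintegral => x _; rewrite -exprD mulnS addnC.
rewrite (eq_bigr (fun=> moment (basis i) (2 * m.+1))) => [|j ji]; last first.
  apply: moment_orthogonal; rewrite ?nrm_basis//.
  by rewrite dot_basis mxE eqxx (negPf ji).
rewrite sumr_const cardC1 card_ord -[_ *+ d.-1]mulr_natl -mulrDl -natrD.
by congr (_%:R * _); rewrite -addnA add1n prednK// (leq_ltn_trans (leq0n i)).
Qed.

Lemma momentE e m : nrm e = 1 ->
  moment e (2 * m) = fine (mu NZ) * \prod_(j < m) ((2 * j + 1)%:R / (2 * j + d)%:R).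
Proof.
move=> e1; have d0 : (0 < d)%N.
  rewrite lt0n; apply/eqP => d0; move: e1; rewrite nrmE dotE big1 ?sqrtr0.
    by move/eqP; rewrite eq_sym oner_eq0.
  by move=> i _; have := ltn_ord i; rewrite [X in (_ < X)%N]d0.
pose i := Ordinal d0; rewrite (moment_even_invariant m e1 (nrm_basis i)).
elim: m => [|m IH].
  rewrite big_ord0 mulr1 /moment muln0.
  under eq_Rintegral do rewrite expr0.
  by rewrite Rintegral_cst// mul1r.
have md : (2 * m + d)%:R != 0 :> R by rewrite pnatr_eq0 addn_eq0 (gtn_eqF d0) andbF.
apply: (mulfI md); rewrite momentS IH big_ord_recr/=.
by move: md; move: (2 * m + d)%:R (_ + 1)%:R => z y z0; field.
Qed.

End cosine_moments.

(** * Half-line moments of the Gaussian and the Gamma function *)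

Lemma exprn_expRN_le (R : realType) n (x : R) : 0 < x ->
  x ^+ n * expR (- x) <= n.+1`!%:R / x.
Proof.
move=> x0; have := expR_ge1Dxn n (ltW x0).
rewrite ler_pdivlMr// mulrAC -exprSr expRN ler_pdivrMr ?expR_gt0// => h.
rewrite -ler_pdivrMl ?ltr0n ?fact_gt0// mulrC.
by apply: le_trans h; rewrite lerDr.
Qed.

Section gauss_moments.
Context {R : realType}.
Local Notation lebesgue := (@lebesgue_measure R).

Let gf k (x : R) := `|x| ^+ k * gauss_fun x.

Let gf_ge0 k x : 0 <= gf k x.
Proof. by rewrite mulr_ge0 ?gauss_fun_ge0// exprn_ge0. Qed.

Let measurable_gf k : measurable_fun setT (gf k).
Proof.
apply: measurable_funM; last exact: measurable_gauss_fun.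
by apply: measurable_funX; exact: normr_measurable.
Qed.

Let is_derive_gauss (x : R) : is_derive x 1 gauss_fun (gauss_fun x * (- (x *+ 2))).
Proof.
have dq : is_derive x 1 (fun y : R => - y ^+ 2) (- (x *+ 2)).
  have d2 : is_derive x 1 (fun y : R => y ^+ 2) (x *+ 2).
    apply: DeriveDef; first exact: exprn_derivable.
    by rewrite exp_derive/= /GRing.scale/= mulr1 expr1 mulr_natl.
  exact: (is_deriveN d2).
exact: (@is_derive1_comp _ expR (fun y => - y ^+ 2)).
Qed.

Let is_derive_everywhere_cont (f df : R -> R) a b :
  (forall x : R, is_derive x (1 : R) f (df x)) -> derivable_oo_LRcontinuous f a b.
Proof.
move=> fdf; have cf x : f y @[y --> x] --> f x.
  by apply/differentiable_continuous/derivable1_diffP; exact: ex_derive.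
split => [x _||]; first exact: ex_derive.
  by apply: cvg_at_right_filter; exact: cf.
by apply: cvg_at_left_filter; exact: cf.
Qed.

Let is_derive_half_gauss (x : R) :
  is_derive x (1 : R) (fun x => - (gauss_fun x / 2)) (x * gauss_fun x).
Proof.
have := is_deriveZ (- 2^-1) (is_derive_gauss x).
rewrite (_ : _ \*: _ = (fun y => - (gauss_fun y / 2))); last first.
  by apply/funext => y /=; rewrite -[LHS]/(- 2^-1 * gauss_fun y) mulNr mulrC.
move/is_derive_eq; apply.
rewrite -[LHS]/(- 2^-1 * (gauss_fun x * (x *- 2))).
by rewrite mulr2n; field.
Qed.

Let gf_by_parts k n : (0 < n)%N ->
  (\int[lebesgue]_(x in `[0%R, n%:R]) (gf k.+2 x)%:E =
   (k.+1%:R / 2)%:E * \int[lebesgue]_(x in `[0%R, n%:R]) (gf k x)%:E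
   - (n%:R ^+ k.+1 * gauss_fun n%:R / 2)%:E)%E.
Proof.
move=> n0.
have dF x : is_derive x (1 : R) (fun x : R => x ^+ k.+1) (k.+1%:R * x ^+ k).
  apply: DeriveDef; first exact: exprn_derivable.
  by rewrite exp_derive/= /GRing.scale/= mulr1.
have dG := is_derive_half_gauss.
have Fd1 (f df : R -> R) : (forall x : R, is_derive x (1 : R) f (df x)) ->
    {in `]0, n%:R[, derive1 f =1 df}.
  by move=> fdf x _; rewrite derive1E derive_val.
have cg : {within `[0, n%:R], continuous (fun x : R => x * gauss_fun x)}.
  apply: continuous_subspaceT => x; apply: cvgM; first exact: cvg_id.
  exact: continuous_gauss_fun.
have cf : {within `[0, n%:R], continuous (fun x : R => k.+1%:R * x ^+ k)}.
  apply: continuous_subspaceT => x; apply: cvgM; first exact: cvg_cst.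
  exact: exprn_continuous.
have mI : measurable_fun (`[0, n%:R]%classic : set R) (fun x => (gf k x)%:E).
  exact/measurable_funTS/measurable_EFinP.
have := @integration_by_parts R (fun x => x ^+ k.+1) (fun x => - (gauss_fun x / 2))
  (fun x => k.+1%:R * x ^+ k) (fun x => x * gauss_fun x) 0 n%:R _ cf
  (is_derive_everywhere_cont _ _ dF) (Fd1 _ _ dF) cg
  (is_derive_everywhere_cont _ _ dG) (Fd1 _ _ dG).
rewrite ltr0n => /(_ n0).
rewrite expr0n/= mul0r subr0 => byp.
transitivity (\int[lebesgue]_(x in `[0%R, n%:R]) (x ^+ k.+1 * (x * gauss_fun x))%:E)%E.
  apply: eq_integral => x; rewrite in_setE/= in_itv/= => /andP[x0 _].
  by rewrite /gf ger0_norm// mulrA -exprSr.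
rewrite byp addeC -ge0_integralZl//; last by move=> x _; rewrite lee_fin.
congr (_ + _)%E; last by rewrite mulrN mulrA.
rewrite -[RHS]oppeK -integral_ge0N/=; last first.
  by move=> x _; rewrite -EFinM lee_fin mulr_ge0.
congr (- _)%E; apply: eq_integral => x; rewrite in_setE/= in_itv/= => /andP[x0 _].
rewrite /gf ger0_norm// -?EFinM -?EFinN; congr EFin.
by field.
Qed.

Let cvg_boundary k :
  ((n%:R : R) ^+ k.+1 * gauss_fun n%:R / 2) @[n --> \oo] --> (0 : R).
Proof.
pose u n : R := n%:R ^+ k.+1 * gauss_fun n%:R.
suff : u @ \oo --> (0 : R).
  move=> h; have h2 : u n / 2 @[n --> \oo] --> (0 / 2 : R) by exact: cvgMr_tmp.
  by rewrite mul0r in h2.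
rewrite -(cvg_shiftS u).
have bound : \forall n \near \oo, (0 : R) <= u n.+1 <= k.+2`!%:R * harmonic n.
  apply: nearW => n; rewrite mulr_ge0 ?gauss_fun_ge0//=.
  apply: le_trans (exprn_expRN_le k.+1 (ltr0Sn R n)).
  by rewrite ler_wpM2l// ler_expR lerN2 expr2 ler_peMr// ler1n.
have h0 : k.+2`!%:R * harmonic n @[n --> \oo] --> (k.+2`!%:R * 0 : R).
  by apply: cvgMl_tmp; exact: cvg_harmonic.
rewrite mulr0 in h0.
by apply: (squeeze_cvgr bound _ h0); exact: cvg_cst.
Qed.

Local Notation EH k := (\int[lebesgue]_(x in `[0%R, +oo[) (gf k x)%:E)%E.

Let EH_rec k : (EH k.+2 = (k.+1%:R / 2)%:E * EH k)%E.
Proof.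
have cA := @ge0_cvgn_integral R lebesgue _ (gf_ge0 k.+2) (measurable_gf k.+2).
have cB := @ge0_cvgn_integral R lebesgue _ (gf_ge0 k) (measurable_gf k).
have c0 : ((n%:R ^+ k.+1 * gauss_fun n%:R / 2)%:E @[n --> \oo] --> (0%:E : \bar R))%E.
  by apply: cvg_EFin; [exact: nearW|exact: cvg_boundary].
have cE : (k.+1%:R / 2)%:E \is a @fin_num R by [].
have def : ((k.+1%:R / 2)%:E * EH k +? - 0%:E)%E.
  by rewrite fin_num_adde_defl// fin_numN.
have := cvgeB def (cvgeZl cE cB) c0; rewrite sube0 => h.
have e : {near \oo, (fun n : nat =>
    (k.+1%:R / 2)%:E * \int[lebesgue]_(x in `[0%R, n%:R]) (gf k x)%:E -
    (n%:R ^+ k.+1 * gauss_fun n%:R / 2)%:E)%E =1 (fun n : nat =>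
    \int[lebesgue]_(x in `[0%R, n%:R]) (gf k.+2 x)%:E)%E}.
  by exists 1%N => // n /= n1; rewrite gf_by_parts.
have cA' : ((\int[lebesgue]_(x in `[0%R, n%:R]) (gf k.+2 x)%:E)%E
    @[n --> \oo] --> ((k.+1%:R / 2)%:E * EH k))%E.
  by apply: (cvg_trans (near_eq_cvg e)); exact: h.
exact: (cvg_unique _ cA cA').
Qed.

Let EH0 : EH 0 = (Num.sqrt pi / 2)%:E.
Proof.
rewrite -integral0y_gauss; apply: eq_integral => x _.
by rewrite /gf expr0 mul1r.
Qed.

Let EH1 : EH 1 = (2^-1)%:E.
Proof.
have dG x : is_derive x (1 : R) (fun x => - (gauss_fun x / 2)) (x * gauss_fun x).
  exact: is_derive_half_gauss.
transitivity (\int[lebesgue]_(x in `[0%R, +oo[) (x * gauss_fun x)%:E)%E.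
  apply: eq_integral => x; rewrite in_setE/= in_itv/= => /andP[x0 _].
  by rewrite /gf expr1 ger0_norm.
rewrite (@ge0_continuous_FTC2y _ _ (fun x => - (gauss_fun x / 2)) 0 0).
- by rewrite /gauss_fun expr0n oppr0 expR0 -EFinB; congr EFin; field.
- by move=> x x0; rewrite mulr_ge0// gauss_fun_ge0.
- apply: continuous_subspaceT => x; apply: cvgM; first exact: cvg_id.
  exact: continuous_gauss_fun.
- have h : - (gauss_fun x / 2) @[x --> +oo%R] --> (- (0 / 2) : R).
    by apply: cvgN; apply: cvgMr_tmp; exact: cvg_gauss_fun.
  by rewrite mul0r oppr0 in h.
- by move=> x _; exact: ex_derive.
- by have [] := is_derive_everywhere_cont 0 1 dG.
- by move=> x _; rewrite derive1E derive_val.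
Qed.

Let EH_fin k : EH k \is a fin_num.
Proof.
suff : (EH k \is a fin_num) && (EH k.+1 \is a fin_num) by case/andP.
elim: k => [|k /andP[IH IH1]]; first by rewrite EH0 EH1.
by rewrite IH1 EH_rec fin_numM.
Qed.

(** The half-line moments of the Gaussian; gauss_moment k is half the value of
the Gamma function at (k + 1) / 2. *)
Definition gauss_moment k : R :=
  fine (\int[lebesgue]_(x in `[0%R, +oo[) (`|x| ^+ k * gauss_fun x)%:E).

Lemma gauss_moment0 : gauss_moment 0 = Num.sqrt pi / 2.
Proof. by rewrite /gauss_moment EH0. Qed.

Lemma gauss_momentSS k : gauss_moment k.+2 = k.+1%:R / 2 * gauss_moment k.
Proof. by rewrite /gauss_moment EH_rec fineM. Qed.

Lemma gauss_moment_gt0 k : 0 < gauss_moment k.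
Proof.
suff /andP[] : (0 < gauss_moment k) && (0 < gauss_moment k.+1) by [].
elim: k => [|k /andP[IH IH1]].
  by rewrite gauss_moment0 /gauss_moment EH1/= divr_gt0 ?sqrtr_gt0 ?pi_gt0/=.
by rewrite IH1 gauss_momentSS mulr_gt0// divr_gt0.
Qed.

(** Integrate x^(k+1) <= (l x^k + x^(k+2) / l) / 2. *)
Lemma gauss_momentS_le k :
  gauss_moment k.+1 <= Num.sqrt (k.+1%:R / 2) * gauss_moment k.
Proof.
pose l : R := Num.sqrt (k.+1%:R / 2).
have l0 : 0 < l by rewrite sqrtr_gt0 divr_gt0.
have l2 : l ^+ 2 = k.+1%:R / 2 by rewrite sqr_sqrtr// divr_ge0.
have -> : Num.sqrt (k.+1%:R / 2) * gauss_moment k =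
    l / 2 * gauss_moment k + (2 * l)^-1 * gauss_moment k.+2.
  rewrite -/l gauss_momentSS -l2; field; exact: lt0r_neq0.
have mgfE j : measurable_fun (`[0%R, +oo[%classic : set R) (fun x => (gf j x)%:E).
  exact/measurable_funTS/measurable_EFinP.
have c1 : 0 <= l / 2 by rewrite divr_ge0// ltW.
have c2 : 0 <= (2 * l)^-1 by rewrite invr_ge0 mulr_ge0// ltW.
have E : (\int[lebesgue]_(x in `[0%R, +oo[) (l / 2 * gf k x + (2 * l)^-1 * gf k.+2 x)%:E
    = (l / 2)%:E * EH k + ((2 * l)^-1)%:E * EH k.+2)%E.
  have Z c j : 0 <= c ->
      (\int[lebesgue]_(x in `[0%R, +oo[) (c%:E * (gf j x)%:E) = c%:E * EH j)%E.
    move=> c0; apply: ge0_integralZl_EFin => //; last exact: mgfE.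
    by move=> x _; rewrite lee_fin.
  rewrite -(Z _ k c1) -(Z _ k.+2 c2).
  have mZ c j : measurable_fun (`[0%R, +oo[%classic : set R)
      (fun x => (c%:E * (gf j x)%:E)%E).
    by apply: measurable_funeM; exact: mgfE.
  rewrite -ge0_integralD//; do ?[exact: mZ
    | by move=> x _; rewrite -EFinM lee_fin mulr_ge0].
have -> : l / 2 * gauss_moment k + (2 * l)^-1 * gauss_moment k.+2 =
    fine ((l / 2)%:E * EH k + ((2 * l)^-1)%:E * EH k.+2)%E.
  by rewrite fineD ?fin_numM// !fineM.
rewrite -E /gauss_moment; apply: fine_le.
- exact: EH_fin.
- by rewrite E fin_numD !fin_numM// EH_fin.
apply: ge0_le_integral => //.
- by move=> x _; rewrite lee_fin; exact: gf_ge0.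
- exact: mgfE.
- apply/measurable_EFinP/measurable_funTS; apply: measurable_funD;
    apply: measurable_funM => //; exact: measurable_gf.
- move=> x; rewrite /= in_itv/= => /andP[x0 _]; rewrite lee_fin /gf ger0_norm//.
  rewrite -subr_ge0 (_ : _ - _ = x ^+ k * gauss_fun x * (l - x) ^+ 2 / (2 * l)).
    apply: divr_ge0; last by rewrite mulr_ge0// ltW.
    apply: mulr_ge0; last exact: sqr_ge0.
    by apply: mulr_ge0; [exact: exprn_ge0|exact: gauss_fun_ge0].
  by rewrite !exprS expr0; field; exact: lt0r_neq0.
Qed.

(** Substitute t = x^2 in the integral that defines the Gamma function. *)
Lemma Gamma_half d : (2 <= d)%N -> Gamma (d%:R / 2 : R) = 2 * gauss_moment d.-1.
Proof.
case: d => [//|[//|d]] _ /=.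
pose G (t : R) := Num.sqrt t ^+ d * expR (- t).
have G0 t : 0 <= G t by rewrite mulr_ge0 ?expR_ge0// exprn_ge0.
have cG : continuous G.
  move=> t; apply: cvgM.
    apply: (@cvg_comp _ _ _ Num.sqrt (fun x : R => x ^+ d)); first exact: sqrt_continuous.
    exact: exprn_continuous.
  apply: (@cvg_comp _ _ _ (fun t => - t) expR); first by apply: cvgN; exact: cvg_id.
  exact: continuous_expR.
have mG : measurable_fun setT G by exact: continuous_measurable_fun.
have -> : Gamma (d.+2%:R / 2) = fine (\int[lebesgue]_(t in `[0%R, +oo[) (G t)%:E).
  rewrite /Gamma /Rintegral; congr fine; rewrite -integral_itv_obnd_cbnd.
    apply: eq_integral => t; rewrite in_setE/= in_itv/= => /andP[t0 _].
    congr EFin; congr (_ * _).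
    have -> : d.+2%:R / 2 - 1 = 2^-1 * d%:R :> R.
      by rewrite -addn2 natrD; field.
    by rewrite powRrM powR12_sqrt ?ltW// powR_mulrn// sqrtr_ge0.
  exact/measurable_funTS/measurable_EFinP.
have cA := @ge0_cvgn_integral R lebesgue _ G0 mG.
have cB := @ge0_cvgn_integral R lebesgue _ (gf_ge0 d.+1) (measurable_gf d.+1).
have sub n : (\int[lebesgue]_(t in `[0%R, (n ^ 2)%N%:R]) (G t)%:E =
    2%:E * \int[lebesgue]_(t in `[0%R, n%:R]) (gf d.+1 t)%:E)%E.
  have dF : derive1 (fun x : R => x ^+ 2) = (fun x => x *+ 2).
    apply/funext => x; rewrite exp_derive1 /= expr1 -[LHS]/(2%:R * x).
    by rewrite mulr_natl.
  have cdF (x : R) : (fun x => x *+ 2) @ x --> x *+ 2.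
    by apply: cvgMn; exact: cvg_id.
  have := @integration_by_substitution_increasing R (fun x => x ^+ 2) G 0 n%:R.
  rewrite dF expr0n/= -natrX => ->//.
  - transitivity (\int[lebesgue]_(x in `[0%R, n%:R]) (2%:E * (gf d.+1 x)%:E))%E.
      apply: eq_integral => x; rewrite in_setE/= in_itv/= => /andP[x0 _].
      rewrite -EFinM; congr EFin.
      rewrite -[LHS]/(G (x ^+ 2) * (x *+ 2)) /G sqrtr_sqr /gf ger0_norm//.
      by rewrite /gauss_fun (exprS x d) -mulr_natl; ring.
    apply: ge0_integralZl_EFin => //.
    + by move=> x _; rewrite lee_fin.
    + by apply/measurable_EFinP/measurable_funTS; exact: measurable_gf.
  - move=> x y; rewrite !in_itv/= => /andP[x0 _] /andP[y0 _] xy.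
    by rewrite ltr_pXn2r.
  - by move=> x _; exact: cdF.
  - by apply/cvg_ex; exists (0 *+ 2 : R); apply: cvg_at_right_filter; exact: cdF.
  - by apply/cvg_ex; exists (n%:R *+ 2 : R); apply: cvg_at_left_filter; exact: cdF.
  - apply: (is_derive_everywhere_cont _ _ (df := fun x => x *+ 2)) => x.
    by apply: DeriveDef; [exact: exprn_derivable|rewrite -derive1E dF].
  - exact: continuous_subspaceT.
have sq : (n ^ 2)%N @[n --> \oo] --> \oo.
  move=> S [N _ NS]; exists N => // n /= Nn; apply: NS => /=.
  by rewrite (leq_trans Nn)//; case: (n) => // m; rewrite -mulnn leq_pmulr.
have cA2 := cvg_comp _ _ sq cA.
have cE : 2%:E \is a @fin_num R by [].
have cB2 := cvgeZl cE cB.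
have e : (fun n : nat => \int[lebesgue]_(t in `[0%R, n%:R]) (G t)%:E)%E
      \o (fun n => (n ^ 2)%N) =
    (fun n : nat => 2%:E * \int[lebesgue]_(t in `[0%R, n%:R]) (gf d.+1 t)%:E)%E.
  by apply/funext => n; exact: sub.
rewrite e in cA2.
have -> : (\int[lebesgue]_(t in `[0%R, +oo[) (G t)%:E = 2%:E * EH d.+1)%E.
  exact: (cvg_unique _ cA2 cB2).
by rewrite fineM//; exact: EH_fin.
Qed.


End gauss_moments.

(** * Moments of a coordinate on the sphere and Poisson averages *)

Section beta_weights.
Context {R : realType}.
Local Notation H := (@gauss_moment R).

(** The moment of order 2m of a coordinate of a uniform point on the unit sphere
of dimension d - 1. *)
Definition sphere_moment d m : R :=
  \prod_(j < m) ((2 * j + 1)%:R / (2 * j + d)%:R).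

Lemma sphere_moment_ge0 d m : 0 <= sphere_moment d m.
Proof. by apply: prodr_ge0 => j _; rewrite divr_ge0. Qed.

Lemma sphere_moment_le1 d m : (0 < d)%N -> sphere_moment d m <= 1.
Proof.
move=> d0; rewrite /sphere_moment; elim: m => [|m IH]; first by rewrite big_ord0.
rewrite big_ord_recr/= mulr_ile1// ?divr_ge0//; first exact: sphere_moment_ge0.
by rewrite ler_pdivrMr ?mul1r ?ler_nat ?ltr0n ?leq_add2l// addn_gt0 d0 orbT.
Qed.

(** A standard Gaussian vector is the product of its length and of an independent
uniform direction; the formula divides the moment of one of its coordinates by
that of its length. *)
Lemma sphere_momentE k m :
  sphere_moment k.+1 m = H (2 * m) * H k / (H 0 * H (2 * m + k)).
Proof.
have H0 j : H j != 0 by rewrite gt_eqF// gauss_moment_gt0.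
elim: m => [|m IH].
  by rewrite /sphere_moment big_ord0 muln0 add0n divff// mulf_neq0.
rewrite /sphere_moment big_ord_recr/= -/(sphere_moment _ _) IH.
rewrite !mulnS !add2n !addSn !gauss_momentSS addn1 addnS.
have := H0 (2 * m + k)%N; have := H0 0%N.
have : (2 * m + k).+1%:R != 0 :> R by rewrite pnatr_eq0.
move: (H (2 * m)) (H k) (H 0) (H (2 * m + k)) => x y z t.
by move: (_.+1%:R) (_.+1%:R) => a b *; field; apply/and3P; split.
Qed.

(** Both bounds come from the bounds on the ratio of two successive Gaussian
moments. *)
Lemma gauss_moment_ratio k m : (2 * m)%:R / (2 * m + k.+1)%:R * H (2 * m + k).+1
  <= Num.sqrt m%:R * H (2 * m + k) <= H (2 * m + k).+1.
Proof.
set n := (2 * m + k)%N.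
have Hp j : 0 < H j by exact: gauss_moment_gt0.
have h1 := gauss_momentS_le (R := R) n.
have h2 := gauss_momentS_le (R := R) n.+1; rewrite gauss_momentSS in h2.
have m2 : (2 * m)%:R = 2 * m%:R :> R by rewrite natrM.
have nE : n.+1%:R = 2 * m%:R + k.+1%:R :> R by rewrite /n -addnS natrD natrM.
have nE2 : n.+2%:R = 2 * m%:R + k.+1%:R + 1 :> R by rewrite -nE natr1.
rewrite addnS -/n nE m2.
have x0 : 0 <= m%:R :> R by [].
have y1 : 1 <= k.+1%:R :> R by rewrite ler1n.
rewrite nE nE2 in h1 h2; move: x0 y1 h1 h2.
move: (m%:R) (k.+1%:R) (H n) (H n.+1) (Hp n) (Hp n.+1) => x y a b a0 b0 x0 y1 h1 h2.
have z0 : 0 < 2 * x + y by lra.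
apply/andP; split.
  apply: (@le_trans _ _ (2 * x / (2 * x + y) * (Num.sqrt ((2 * x + y) / 2) * a))).
    by rewrite ler_wpM2l// divr_ge0//; lra.
  rewrite mulrA ler_wpM2r ?(ltW a0)// -[leLHS]ger0_norm; last first.
    by rewrite mulr_ge0 ?sqrtr_ge0// divr_ge0//; lra.
  rewrite -sqrtr_sqr ler_sqrt// exprMn sqr_sqrtr; last by rewrite divr_ge0//; lra.
  rewrite [leLHS](_ : _ = x * (2 * x / (2 * x + y))); last by field; lra.
  by rewrite ler_piMr// ler_pdivrMr//; lra.
have s0 : 0 < Num.sqrt ((2 * x + y + 1) / 2) by rewrite sqrtr_gt0; lra.
rewrite -(ler_pM2l s0); apply: le_trans h2; rewrite mulrA ler_wpM2r ?(ltW a0)//.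
rewrite -sqrtrM; last by lra.
rewrite -[leRHS]ger0_norm; last by lra.
rewrite -sqrtr_sqr ler_sqrt ?sqr_ge0//.
nra.
Qed.

Lemma sphere_moment_bounds k m (G := H k / H 0) : (0 < m)%N ->
  G * ((2 * m)%:R / (2 * m + k)%:R) ^+ k <=
  sphere_moment k.+1 m * Num.sqrt m%:R ^+ k <= G.
Proof.
move=> m0; rewrite sphere_momentE.
have Hp j : 0 < H j by exact: gauss_moment_gt0.
have G0 : 0 < G by rewrite divr_gt0.
have -> : H (2 * m) * H k / (H 0 * H (2 * m + k)) * Num.sqrt m%:R ^+ k =
    G * (Num.sqrt m%:R ^+ k * H (2 * m) / H (2 * m + k)).
  rewrite /G; field; apply/andP.
  by split; rewrite gt_eqF.
rewrite ler_pM2l// ler_piMr ?(ltW G0)//; last first.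
  rewrite ler_pdivrMr// mul1r; elim: k {G G0} => [|k IH].
    by rewrite expr0 mul1r addn0.
  have /andP[_ h] := gauss_moment_ratio k m.
  rewrite exprS addnS; apply: le_trans h; rewrite -mulrA.
  by rewrite ler_wpM2l ?sqrtr_ge0.
rewrite andbT ler_pdivlMr//.
suff h j : (j <= k)%N -> ((2 * m)%:R / (2 * m + k)%:R) ^+ j * H (2 * m + j) <=
    Num.sqrt m%:R ^+ j * H (2 * m) by exact: h.
elim: j => [_|j IH jk]; first by rewrite !expr0 !mul1r addn0.
have /andP[h _] := gauss_moment_ratio j m.
have := IH (ltnW jk); rewrite -(ler_pM2l (_ : 0 < Num.sqrt m%:R)); last first.
  by rewrite sqrtr_gt0 ltr0n.
rewrite [leRHS]mulrA -exprS; apply: le_trans.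
rewrite mulrCA exprSr -mulrA ler_wpM2l ?exprn_ge0 ?divr_ge0//.
apply: le_trans h; rewrite addnS ler_wpM2r ?(ltW (Hp _))//.
have pos i : 0 < (2 * m + i)%:R :> R by rewrite ltr0n addn_gt0 muln_gt0 m0.
by rewrite ler_wpM2l// lef_pV2 ?posrE ?pos -?addnS// ler_nat leq_add2l.
Qed.

End beta_weights.

Section poisson_average.
Context {R : realType}.
Implicit Types (u : R) (f g : nat -> R).

(** The expectation of f under the Poisson law with mean u. *)
Definition poisson_mean u f : \bar R :=
  (\sum_(0 <= n <oo) (expR (- u) * (u ^+ n / n`!%:R) * f n)%:E)%E.

Lemma eseries_cvg (f : R^nat) l : series f @ \oo --> l ->
  (\sum_(0 <= n <oo) (f n)%:E = l%:E)%E.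
Proof.
move=> fl; apply/cvg_lim => //.
under eq_fun do rewrite sumEFin.
by apply: cvg_EFin; [exact: nearW|exact: fl].
Qed.

Let weight_ge0 u n : 0 <= u -> 0 <= expR (- u) * (u ^+ n / n`!%:R).
Proof. by move=> u0; rewrite mulr_ge0 ?expR_ge0// divr_ge0// exprn_ge0. Qed.

Lemma poisson_mean_ge0 u f : 0 <= u -> (forall n, 0 <= f n) ->
  (0 <= poisson_mean u f)%E.
Proof.
by move=> u0 f0; apply: nneseries_ge0 => n _ _; rewrite lee_fin mulr_ge0// weight_ge0.
Qed.

Lemma le_poisson_mean u f g : 0 <= u -> (forall n, 0 <= f n) ->
  (forall n, f n <= g n) -> (poisson_mean u f <= poisson_mean u g)%E.
Proof.
move=> u0 f0 fg; apply: lee_nneseries => n _; rewrite lee_fin.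
  by move=> _; rewrite mulr_ge0// weight_ge0.
by rewrite ler_wpM2l// weight_ge0.
Qed.

Lemma poisson_meanD u f g : 0 <= u -> (forall n, 0 <= f n) ->
  (forall n, 0 <= g n) ->
  (poisson_mean u (fun n => f n + g n)%R = poisson_mean u f + poisson_mean u g)%E.
Proof.
move=> u0 f0 g0; rewrite /poisson_mean -nneseriesD.
- by apply: eq_eseriesr => n _; rewrite -EFinD mulrDr.
- by move=> n _ _; rewrite lee_fin mulr_ge0// weight_ge0.
- by move=> n _ _; rewrite lee_fin mulr_ge0// weight_ge0.
Qed.

Lemma poisson_meanZ u (c : R) f : 0 <= u -> (forall n, 0 <= f n) ->
  (poisson_mean u (fun n => c * f n)%R = c%:E * poisson_mean u f)%E.
Proof.
move=> u0 f0; rewrite /poisson_mean -nneseriesZl.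
  by apply: eq_eseriesr => n _; rewrite -EFinM mulrCA.
by move=> n _; rewrite lee_fin mulr_ge0// weight_ge0.
Qed.

Let exp_series (x : R) : series (fun n => x ^+ n / n`!%:R) @ \oo --> expR x.
Proof. exact: is_cvg_series_exp_coeff. Qed.

(** Turns a closed form of a power series into the value of a Poisson mean. *)
Lemma poisson_mean_cvg u f (l : R) :
  series (fun n => u ^+ n / n`!%:R * f n) @ \oo --> l ->
  poisson_mean u f = (expR (- u) * l)%:E.
Proof.
move=> fl; apply: eseries_cvg.
rewrite (_ : series _ = (fun N => expR (- u) *
  series (fun n => u ^+ n / n`!%:R * f n) N)); first exact: cvgMl_tmp.
apply/funext => N; rewrite /series/= mulr_sumr.
by apply: eq_bigr => n _; rewrite -mulrA.
Qed.

Lemma poisson_mean_pow u t :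
  poisson_mean u (fun n => t ^+ n) = (expR (u * (t - 1)))%:E.
Proof.
rewrite (@poisson_mean_cvg _ _ (expR (u * t))).
  by rewrite -expRD; congr (expR _)%:E; ring.
rewrite (_ : (fun n => _) = (fun n => (u * t) ^+ n / n`!%:R)); last first.
  by apply/funext => n; rewrite exprMn mulrAC.
exact: exp_series.
Qed.

(** Only even moments of the cosine survive, and a Poisson variable of large mean
is even with probability close to one half. *)
Lemma poisson_mean_even u :
  poisson_mean u (fun n => (~~ odd n)%:R) = ((1 + expR (- (2 * u))) / 2)%:E.
Proof.
rewrite (@poisson_mean_cvg _ _ ((expR u + expR (- u)) / 2)).
  congr (_%:E); rewrite !mulrA mulrDr -!expRD addNr expR0.
  by congr ((1 + expR _) / 2); ring.
rewrite (_ : series _ = (fun N => (series (fun n => u ^+ n / n`!%:R) N +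
    series (fun n => (- u) ^+ n / n`!%:R) N) / 2)).
  by apply: cvgMr_tmp; apply: cvgD; exact: exp_series.
apply/funext => N; rewrite /series/= -big_split/= mulr_suml.
apply: eq_bigr => n _; rewrite exprNn -signr_odd.
by case: (odd n); rewrite /= ?expr0 ?expr1; field; rewrite pnatr_eq0 -lt0n fact_gt0.
Qed.

(** The variance controls how often a Poisson variable is far from its mean. *)
Lemma poisson_mean_variance u :
  poisson_mean u (fun n => (n%:R - u) ^+ 2) = u%:E.
Proof.
have shift (f : nat -> R) l : series (fun n => u ^+ n / n`!%:R * f n.+1) @ \oo --> l ->
    series (fun n => u ^+ n / n`!%:R * (n%:R * f n)) @ \oo --> u * l.
  move=> fl; rewrite -cvg_shiftS.
  rewrite (_ : [sequence _]_n = (fun N => u *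
     series (fun n => u ^+ n / n`!%:R * f n.+1) N)); first exact: cvgMl_tmp.
  apply/funext => N; rewrite /series/= big_nat_recl// mul0r mulr0 add0r mulr_sumr.
  apply: eq_bigr => n _; rewrite exprS factS natrM.
  have f0 : n`!%:R != 0 :> R by rewrite pnatr_eq0 -lt0n fact_gt0.
  have n0 : n.+1%:R != 0 :> R by rewrite pnatr_eq0.
  by move: f0 n0; move: (n`!%:R) (n.+1%:R) => y z y0 z0; field; apply/andP.
have S0 := @exp_series u.
have S1 : series (fun n => u ^+ n / n`!%:R * n%:R) @ \oo --> u * expR u.
  have h : series (fun n => u ^+ n / n`!%:R * (n%:R * 1)) @ \oo --> u * expR u.
    by apply: shift; under eq_fun do rewrite mulr1.
  by under eq_fun do rewrite -[n in _ * n]mulr1.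
have S2 : series (fun n => u ^+ n / n`!%:R * (n%:R * n%:R)) @ \oo -->
    u * (u * expR u + expR u).
  apply: shift; rewrite (_ : series _ = (fun N =>
    series (fun n => u ^+ n / n`!%:R * n%:R) N + series (fun n => u ^+ n / n`!%:R) N)).
    exact: cvgD.
  apply/funext => N; rewrite /series/= -big_split/=.
  by apply: eq_bigr => n _; rewrite -natr1 mulrDr mulr1.
rewrite (@poisson_mean_cvg _ _ (u * (u * expR u + expR u) - 2 * u * (u * expR u)
   + u ^+ 2 * expR u)).
  rewrite (_ : _ + _ = u * expR u); last by ring.
  by rewrite mulrCA -expRD addNr expR0 mulr1.
rewrite (_ : series _ = (fun N => series (fun n => u ^+ n / n`!%:R * (n%:R * n%:R)) N
    - 2 * u * series (fun n => u ^+ n / n`!%:R * n%:R) N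
    + u ^+ 2 * series (fun n => u ^+ n / n`!%:R) N)).
  by apply: cvgD; [apply: cvgB => //|]; apply: cvgMl_tmp.
apply/funext => N; rewrite /series/= !mulr_sumr -sumrN -!big_split/=.
by apply: eq_bigr => n _; ring.
Qed.

End poisson_average.

(** * The angular Laplace transform and its decay *)

Section angular_laplace.
Context {R : realType}.
Local Notation H := (@gauss_moment R).

Lemma normr_expr_sub1_le k (z : R) : 0 <= z <= 2 ->
  `|z ^+ k - 1| <= k%:R * 2 ^+ k * `|z - 1|.
Proof.
move=> /andP[z0 z2]; elim: k => [|k IH].
  by rewrite expr0 subrr normr0 !mul0r.
have -> : z ^+ k.+1 - 1 = z * (z ^+ k - 1) + (z - 1) by rewrite exprS; ring.
apply: le_trans (ler_normD _ _) _; rewrite normrM (ger0_norm z0).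
have h1 : z * `|z ^+ k - 1| <= 2 * (k%:R * 2 ^+ k * `|z - 1|).
  by apply: ler_pM.
have h2 : `|z - 1| <= 2 ^+ k.+1 * `|z - 1|.
  by rewrite ler_peMl// exprn_ege1// ler1n.
apply: le_trans (lerD h1 h2) _.
by rewrite -natr1 exprS; move: (2 ^+ k) `|z - 1| => a b; lra.
Qed.

Lemma Bernoulli_le k (r : R) : 0 <= r <= 1 -> 1 - r ^+ k <= k%:R * (1 - r).
Proof.
move=> /andP[r0 r1]; elim: k => [|k IH]; first by rewrite expr0 subrr mul0r.
have -> : 1 - r ^+ k.+1 = r * (1 - r ^+ k) + (1 - r) by rewrite exprS; ring.
have h : r * (1 - r ^+ k) <= 1 * (k%:R * (1 - r)).
  by apply: ler_pM => //; rewrite subr_ge0 exprn_ile1.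
by apply: le_trans (lerD h (lexx _)) _; rewrite -natr1; lra.
Qed.

(** The moment of order n of a coordinate of a uniform point on the unit sphere
of dimension d - 1, whatever the parity of n. *)
Definition coordinate_moment d n : R :=
  if odd n then 0 else sphere_moment d n./2.

Lemma coordinate_moment_ge0 d n : 0 <= coordinate_moment d n.
Proof. by rewrite /coordinate_moment; case: ifP => // _; exact: sphere_moment_ge0. Qed.

Lemma coordinate_moment_le1 d n : (0 < d)%N -> coordinate_moment d n <= 1.
Proof. by rewrite /coordinate_moment; case: ifP => // _; exact: sphere_moment_le1. Qed.

(** The Laplace transform of 1 - c, with c a coordinate of a uniform point on the
unit sphere of dimension d - 1. *)
Definition angular_laplace d (u : R) : R :=
  fine (poisson_mean u (coordinate_moment d)).

Lemma angular_laplaceE d u : (0 < d)%N -> 0 <= u ->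
  poisson_mean u (coordinate_moment d) = (angular_laplace d u)%:E.
Proof.
move=> d0 u0; rewrite /angular_laplace fineK// ge0_fin_numE; last first.
  by apply: poisson_mean_ge0 => // n; exact: coordinate_moment_ge0.
apply: le_lt_trans (ltry (expR (u * (1 - 1)))); rewrite -poisson_mean_pow.
apply: le_poisson_mean => // n; first exact: coordinate_moment_ge0.
by rewrite expr1n coordinate_moment_le1.
Qed.

Lemma angular_laplace_ge0 d u : 0 <= u -> 0 <= angular_laplace d u.
Proof.
move=> u0; apply: fine_ge0; apply: poisson_mean_ge0 => // n.
exact: coordinate_moment_ge0.
Qed.

Variable k : nat.
Let G := H k / H 0.
Let c0 := Num.sqrt 2 ^+ k * G.

Let G_gt0 : 0 < G. Proof. by rewrite divr_gt0// gauss_moment_gt0. Qed.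

Let c0_gt0 : 0 < c0.
Proof. by rewrite mulr_gt0// exprn_gt0// sqrtr_gt0. Qed.

Let B : R := 2 ^+ k.+1 * k%:R ^+ 2.
Let C : R := k%:R * 2 ^+ k.+1.

Let collect_terms (s y p q g : R) : s != 0 ->
  p * (g * (2 * q ^+ 2 / s ^+ 2)) + g * (q * p * (s^-1 + y ^+ 2 / s ^+ 3)) =
  g * (q * (2 * p) / (2 * s) + 2 * p * q ^+ 2 / s ^+ 2
       + q * (2 * p) / (2 * s ^+ 3) * y ^+ 2).
Proof. by move=> s0; field. Qed.

(** A Poisson variable n of mean s^2 is close to s^2, and then the n-th moment is
close to c0 / s^k; its values below s^2 / 2 are exponentially unlikely. *)
Let pointwise (s : R) n : 1 <= s ->
  `|s ^+ k * coordinate_moment k.+1 n - c0 * (~~ odd n)%:R| <=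
  c0 * (C / (2 * s) + B / s ^+ 2) * 1 ^+ n +
  (c0 * C / (2 * s ^+ 3) * (n%:R - s ^+ 2) ^+ 2
   + (s ^+ k + c0) * expR (s ^+ 2 / 4) * expR (- 2^-1) ^+ n).
Proof.
move=> s1; have s0 : 0 < s by lra.
have B0 : 0 <= B by rewrite mulr_ge0 ?exprn_ge0.
have C0 : 0 <= C by rewrite mulr_ge0 ?exprn_ge0.
have sk0 : 0 < s ^+ k by rewrite exprn_gt0.
have sge := ltW s0; have cge := ltW c0_gt0.
have T1 : 0 <= c0 * (C / (2 * s) + B / s ^+ 2).
  apply: mulr_ge0 => //; apply: addr_ge0; apply: divr_ge0 => //.
    exact: mulr_ge0.
  exact: exprn_ge0.
have T2 : 0 <= c0 * C / (2 * s ^+ 3) * (n%:R - s ^+ 2) ^+ 2.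
  apply: mulr_ge0; last exact: sqr_ge0.
  by apply: divr_ge0; [exact: mulr_ge0|apply: mulr_ge0 => //; exact: exprn_ge0].
have T3 : 0 <= (s ^+ k + c0) * expR (s ^+ 2 / 4) * expR (- 2^-1) ^+ n.
  apply: mulr_ge0; last by rewrite exprn_ge0 ?expR_ge0.
  by apply: mulr_ge0; [apply: addr_ge0 => //; exact: ltW|exact: expR_ge0].
rewrite expr1n mulr1 /coordinate_moment; case: ifPn => [on|en].
  by rewrite !mulr0 subrr normr0 !addr_ge0.
rewrite mulr1; have [nu|nu] := leP n%:R (s ^+ 2 / 2).
  have h : (s ^+ k + c0) * 1 <= (s ^+ k + c0) * (expR (s ^+ 2 / 4) * expR (- 2^-1) ^+ n).
    have scge : 0 <= s ^+ k + c0 by apply: addr_ge0 => //; exact: ltW.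
    rewrite ler_wpM2l// -expRM_natl -expRD -[leLHS]expR0 ler_expR.
    by move: nu; move: (n%:R) (s ^+ 2) => a b; lra.
  rewrite mulr1 mulrA in h.
  apply: (@le_trans _ _ (s ^+ k + c0)); last by lra.
  apply: le_trans (ler_normB _ _) _; rewrite (gtr0_norm c0_gt0) lerD2r.
  rewrite ger0_norm ?mulr_ge0 ?sphere_moment_ge0 ?(ltW sk0)//.
  by rewrite ler_piMr ?(ltW sk0)// sphere_moment_le1.
set m := n./2; have nm : n = (2 * m)%N by rewrite mul2n -[LHS]odd_double_half (negPf en).
have n0 : 0 < n%:R :> R by apply: lt_trans nu; rewrite divr_gt0 ?exprn_gt0.
have m0 : (0 < m)%N by move: n0; rewrite nm ltr0n muln_gt0.
have /andP[] := @sphere_moment_bounds R k m m0; rewrite -/G -nm.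
set q := sphere_moment _ _ * _ => q1 q2.
pose z := s / Num.sqrt n%:R.
have sn0 : 0 < Num.sqrt n%:R :> R by rewrite sqrtr_gt0.
have z0 : 0 <= z by rewrite divr_ge0// ltW.
have z2E : z ^+ 2 = s ^+ 2 / n%:R by rewrite /z exprMn exprVn sqr_sqrtr// ltW.
have z2 : z ^+ 2 <= 2 by rewrite z2E ler_pdivrMr//; move: nu; lra.
have zle2 : z <= 2 by rewrite leNgt; apply/negP => z3; nra.
have -> : s ^+ k * sphere_moment k.+1 m = Num.sqrt 2 ^+ k * (z ^+ k * q).
  have sE : s = Num.sqrt 2 * z * Num.sqrt m%:R.
    rewrite mulrAC -sqrtrM// -natrM -nm mulrC /z divfK// gt_eqF//.
  by rewrite /q {1}sE !exprMn; ring.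
rewrite /c0 -mulrA -mulrBr normrM (@ger0_norm _ (_ ^+ k)) ?exprn_ge0//.
have -> : z ^+ k * q - G = z ^+ k * (q - G) + G * (z ^+ k - 1) by ring.
have zk : z ^+ k <= 2 ^+ k by rewrite lerXn2r ?nnegrE.
have zk0 : 0 <= z ^+ k by exact: exprn_ge0.
have qG : `|q - G| <= G * (2 * k%:R ^+ 2 / s ^+ 2).
  rewrite distrC ger0_norm ?subr_ge0//.
  apply: (@le_trans _ _ (G * (k%:R * (1 - n%:R / (n + k)%:R)))).
    apply: (@le_trans _ _ (G * (1 - (n%:R / (n + k)%:R) ^+ k))); first by lra.
    rewrite ler_pM2l//; apply: Bernoulli_le; rewrite divr_ge0//=.
    by rewrite ler_pdivrMr ?mul1r ?ler_nat ?leq_addr// natrD ltr_wpDr.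
  rewrite ler_pM2l// natrD.
  have nk : 0 < n%:R + k%:R :> R by rewrite ltr_wpDr.
  rewrite (_ : 1 - _ = k%:R / (n%:R + k%:R)); last by field; rewrite gt_eqF.
  have h : (n%:R + k%:R)^-1 <= 2 / s ^+ 2.
    rewrite ler_pdivlMr ?exprn_gt0// mulrC ler_pdivrMr//.
    have : 0 <= k%:R :> R by [].
    by move: nu; move: (n%:R) (k%:R) (s ^+ 2) => a b c; lra.
  rewrite [leLHS](_ : _ = k%:R ^+ 2 * (n%:R + k%:R)^-1); last by ring.
  rewrite [leRHS](_ : _ = k%:R ^+ 2 * (2 / s ^+ 2)); last by ring.
  by rewrite ler_wpM2l// sqr_ge0.
have zz : `|z - 1| <= 2 * `|(n%:R - s ^+ 2) / s ^+ 2|.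
  apply: (@le_trans _ _ `|z ^+ 2 - 1|).
    have -> : z ^+ 2 - 1 = (z - 1) * (z + 1) by ring.
    rewrite normrM ler_peMr// ger0_norm; lra.
  rewrite z2E (_ : _ - 1 = - ((n%:R - s ^+ 2) / n%:R)); last by field; rewrite gt_eqF.
  rewrite normrN !normrM mulrCA ler_wpM2l// !normfV (gtr0_norm n0).
  rewrite (@gtr0_norm _ (s ^+ 2)) ?exprn_gt0// -[leLHS]mul1r ler_pdivrMr//.
  by rewrite mulrAC ler_pdivlMr ?exprn_gt0// mul1r; move: nu; lra.
have amgm : `|(n%:R - s ^+ 2) / s ^+ 2| <=
    (s^-1 + (n%:R - s ^+ 2) ^+ 2 / s ^+ 3) / 2.
  rewrite (_ : (n%:R - s ^+ 2) ^+ 2 / s ^+ 3 =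
      `|(n%:R - s ^+ 2) / s ^+ 2| ^+ 2 * s); last first.
    by rewrite real_normK ?num_real//; field; rewrite gt_eqF.
  move: `|_| => y; rewrite -subr_ge0.
  rewrite (_ : _ - y = (s^-1 - y) ^+ 2 * s / 2); last by field; rewrite gt_eqF.
  by rewrite divr_ge0// mulr_ge0 ?sqr_ge0// ltW.
have zk1 := @normr_expr_sub1_le k z; rewrite z0 zle2 in zk1; have {}zk1 := zk1 isT.
have K0 : 0 <= k%:R * 2 ^+ k :> R by rewrite mulr_ge0// exprn_ge0.
have h1 : z ^+ k * `|q - G| <= 2 ^+ k * (G * (2 * k%:R ^+ 2 / s ^+ 2)).
  by apply: ler_pM.
have h2 : `|z ^+ k - 1| <= k%:R * 2 ^+ k * (s^-1 + (n%:R - s ^+ 2) ^+ 2 / s ^+ 3).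
  apply: le_trans zk1 _; rewrite ler_wpM2l//; lra.
have h3 : `|z ^+ k * (q - G) + G * (z ^+ k - 1)| <=
    G * ((C / (2 * s) + B / s ^+ 2) + C / (2 * s ^+ 3) * (n%:R - s ^+ 2) ^+ 2).
  apply: le_trans (ler_normD _ _) _; rewrite (normrM (z ^+ k)) (normrM G) (ger0_norm zk0) (gtr0_norm G_gt0).
  apply: le_trans (lerD h1 (ler_wpM2l (ltW G_gt0) h2)) _.
  rewrite le_eqVlt; apply/orP; left; apply/eqP; rewrite /B /C !(exprS 2 k).
  by apply: collect_terms; rewrite gt_eqF.
have w0 : 0 <= Num.sqrt 2 ^+ k :> R by rewrite exprn_ge0.
have := ler_wpM2l w0 h3; rewrite /c0 => h4.
apply: le_trans h4 _; rewrite [leRHS]addrA -[leLHS]addr0; apply: lerD => //.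
by rewrite (mulrDr G) mulrDr !mulrA lexx.
Qed.

(** Take Poisson means in the pointwise estimate: the main term is the
probability of being even, close to 1/2, the variance bounds the deviations from
the mean, and the mean of t^n makes the small values exponentially unlikely. *)
Lemma angular_laplace_asymptotic : exists A : R, forall s, 1 <= s ->
  `|s ^+ k * angular_laplace k.+1 (s ^+ 2) - c0 / 2| <= A / s.
Proof.
exists (c0 * C + c0 * B + 12%:R ^+ k * (12%:R * k.+1`!%:R) + 12%:R * c0 + c0) => s s1.
have s0 : 0 < s by lra.
have ss1 : 1 <= s ^+ 2 by rewrite exprn_ege1.
have ss0 : 0 <= s ^+ 2 by lra.
have B0 : 0 <= B by rewrite mulr_ge0 ?exprn_ge0.
have C0 : 0 <= C by rewrite mulr_ge0 ?exprn_ge0.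
have sk0 : 0 <= s ^+ k by rewrite exprn_ge0// ltW.
have cge := ltW c0_gt0.
pose a := c0 * (C / (2 * s) + B / s ^+ 2).
pose b := c0 * C / (2 * s ^+ 3).
pose g := (s ^+ k + c0) * expR (s ^+ 2 / 4).
have a0 : 0 <= a.
  apply: mulr_ge0 => //; apply: addr_ge0; apply: divr_ge0 => //.
  by apply: mulr_ge0 => //; exact: ltW.
have b0 : 0 <= b.
  apply: divr_ge0; first exact: mulr_ge0.
  by apply: mulr_ge0 => //; apply: exprn_ge0; exact: ltW.
have g0 : 0 <= g by apply: mulr_ge0; [exact: addr_ge0|exact: expR_ge0].
pose h n := a * 1 ^+ n + (b * (n%:R - s ^+ 2) ^+ 2 + g * expR (- 2^-1) ^+ n).
have sq0 n : 0 <= (n%:R - s ^+ 2) ^+ 2 by exact: sqr_ge0.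
have ex0 n : 0 <= expR (- 2^-1 : R) ^+ n by rewrite exprn_ge0// expR_ge0.
have one0 n : 0 <= (1 : R) ^+ n by rewrite exprn_ge0.
pose hm := a + (b * s ^+ 2 + g * expR (s ^+ 2 * (expR (- 2^-1) - 1))).
have hE : poisson_mean (s ^+ 2) h = hm%:E.
  rewrite /h poisson_meanD//; last 2 first.
  - by move=> n; exact: mulr_ge0.
  - by move=> n; apply: addr_ge0; exact: mulr_ge0.
  rewrite poisson_meanD//; last 2 first.
  - by move=> n; exact: mulr_ge0.
  - by move=> n; exact: mulr_ge0.
  rewrite !poisson_meanZ// !poisson_mean_pow poisson_mean_variance.
  by rewrite subrr mulr0 expR0 mule1 -!EFinM -!EFinD.
have h0 n : 0 <= h n by apply: addr_ge0; [|apply: addr_ge0]; exact: mulr_ge0.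
have cm0 := @coordinate_moment_ge0 k.+1.
have even0 n : 0 <= (~~ odd n)%:R :> R by [].
pose e := (1 + expR (- (2 * s ^+ 2))) / 2.
have eE : poisson_mean (s ^+ 2) (fun n => (~~ odd n)%:R) = e%:E.
  exact: poisson_mean_even.
have le1 : s ^+ k * angular_laplace k.+1 (s ^+ 2) <= c0 * e + hm.
  rewrite -lee_fin EFinD (EFinM c0) (EFinM (s ^+ k)) -angular_laplaceE// -eE -hE.
  rewrite -!poisson_meanZ// -poisson_meanD//; last by move=> n; exact: mulr_ge0.
  apply: le_poisson_mean => // n; first exact: mulr_ge0.
  have := pointwise n s1; rewrite ler_norml => /andP[_].
  by rewrite -/a -/b -/g -/(h n); move: (h n) => hn; lra.
have le2 : c0 * e <= s ^+ k * angular_laplace k.+1 (s ^+ 2) + hm.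
  rewrite -lee_fin EFinD (EFinM c0) (EFinM (s ^+ k)) -angular_laplaceE// -eE -hE.
  rewrite -!poisson_meanZ// -poisson_meanD//; last by move=> n; exact: mulr_ge0.
  apply: le_poisson_mean => // n; first exact: mulr_ge0.
  have := pointwise n s1; rewrite ler_norml => /andP[+ _].
  by rewrite -/a -/b -/g -/(h n); move: (h n) => hn; lra.
have sV : 0 < s^-1 by rewrite invr_gt0.
have s2V : (s ^+ 2)^-1 <= s^-1.
  by rewrite lef_pV2 ?posrE ?exprn_gt0// expr2 ler_peMr// ltW.
pose x := s ^+ 2 / 12%:R.
have x0 : 0 < x by rewrite /x; lra.
have xV : x^-1 = 12%:R * (s ^+ 2)^-1 by rewrite /x invf_div.
have ex1 : expR (- x) <= 12%:R / s.
  have := exprn_expRN_le 0 x0; rewrite expr0 mul1r (_ : 1`! = 1%N)// mul1r xV; lra.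
have ex2 : s ^+ k * expR (- x) <= 12%:R ^+ k * (12%:R * k.+1`!%:R) / s.
  have h1 : s ^+ k <= 12%:R ^+ k * x ^+ k.
    rewrite -exprMn /x mulrC divfK ?pnatr_eq0// -exprM mulnC exprM expr2.
    by rewrite ler_peMr// exprn_ege1.
  apply: le_trans (ler_wpM2r (expR_ge0 _) h1) _; rewrite -!mulrA ler_wpM2l ?exprn_ge0//.
  apply: le_trans (exprn_expRN_le k x0) _; rewrite xV mulrCA ler_wpM2l//.
  by rewrite ler_wpM2l.
have ex3 : expR (s ^+ 2 / 4) * expR (s ^+ 2 * (expR (- 2^-1) - 1)) <= expR (- x).
  rewrite -expRD ler_expR.
  have : expR (- 2^-1 : R) <= 2 / 3.
    rewrite expRN; have := expR_ge1Dx (2^-1 : R).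
    move: (expR (2^-1 : R)) (expR_gt0 (2^-1 : R)) => t t0 ht.
    by rewrite -(ler_pM2l t0) divff ?gt_eqF//; lra.
  move: (expR _) => t ht.
  have : s ^+ 2 * t <= s ^+ 2 * (2 / 3) by rewrite ler_wpM2l.
  rewrite /x; lra.
have hmle : hm <= (c0 * C + c0 * B + 12%:R ^+ k * (12%:R * k.+1`!%:R) + 12%:R * c0) / s.
  rewrite /hm.
  have -> : a = c0 * C / 2 * s^-1 + c0 * B * (s ^+ 2)^-1.
    by rewrite /a; field; rewrite gt_eqF.
  have -> : b * s ^+ 2 = c0 * C / 2 * s^-1 by rewrite /b; field; rewrite gt_eqF.
  have gle : g * expR (s ^+ 2 * (expR (- 2^-1) - 1)) <=
      (12%:R ^+ k * (12%:R * k.+1`!%:R)) * s^-1 + 12%:R * c0 * s^-1.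
    rewrite /g -mulrA; apply: le_trans (ler_wpM2l _ ex3) _; first exact: addr_ge0.
    by rewrite mulrDl lerD// (mulrC 12%:R c0) -(mulrA c0) ler_wpM2l.
  have : c0 * B * (s ^+ 2)^-1 <= c0 * B * s^-1 by rewrite ler_wpM2l// mulr_ge0.
  move: gle; rewrite !mulrDl.
  move: (c0 * C) (c0 * B * _) (c0 * B / s) => *; lra.
have ee : c0 * e - c0 / 2 = c0 / 2 * expR (- (2 * s ^+ 2)) by rewrite /e; field.
have e2 : c0 / 2 * expR (- (2 * s ^+ 2)) <= c0 / s.
  have : expR (- (2 * s ^+ 2)) <= s^-1.
    have u0 : 0 < 2 * s ^+ 2 by lra.
    have := exprn_expRN_le 0 u0; rewrite expr0 mul1r (_ : 1`! = 1%N)// mul1r invfM.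
    by move: (expR _) (s ^+ 2)^-1 s^-1 s2V sV => *; lra.
  move=> h1; apply: le_trans (ler_wpM2l _ h1) _; first by lra.
  by rewrite ler_wpM2r// ?(ltW sV)//; lra.
have e0 : 0 <= c0 / 2 * expR (- (2 * s ^+ 2)) by rewrite mulr_ge0 ?expR_ge0//; lra.
have : s ^+ k * angular_laplace k.+1 (s ^+ 2) - c0 / 2 <= hm + c0 / s.
  by clear - le1 ee e2; lra.
have : - (hm + c0 / s) <= s ^+ k * angular_laplace k.+1 (s ^+ 2) - c0 / 2.
  by clear - le2 ee e2 e0 sV cge; have := mulr_ge0 cge (ltW sV); lra.
rewrite mulrDl ler_norml; clear - hmle => h1 h2; apply/andP; split.
  by apply: le_trans h1; rewrite lerN2 lerD2r.
by apply: le_trans h2 _; rewrite lerD2r.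
Qed.

End angular_laplace.

(** * The Laplace transform of the cosine *)

Section cosine_laplace_transform.
Context {R : realType} {d : nat}.
Variable mu : probability 'rV[R]_d R.
Hypothesis mu_sph : spherically_symmetric mu.

Local Notation nrm := (@euclidean_norm R d).
Local Notation NZ := [set x : 'rV[R]_d | 0 < nrm x].

Let mNZ : measurable NZ. Proof. exact: measurable_nrm_gt. Qed.

Let term (e : 'rV[R]_d) u n x : R :=
  expR (- u) * (u ^+ n / n`!%:R) * ((- cosine e x) ^+ n + cosine e x ^+ n).

Let term_odd e u n x : odd n -> term e u n x = 0.
Proof.
by move=> on; rewrite /term exprNn -signr_odd on/= expr1 mulN1r addNr mulr0.
Qed.

Let term_even e u n x : ~~ odd n ->
  term e u n x = expR (- u) * (u ^+ n / n`!%:R) * 2 * cosine e x ^+ n.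
Proof.
move=> en; rewrite /term exprNn -signr_odd (negPf en)/= expr0 mul1r.
by rewrite -mulr2n -[_ *+ 2]mulr_natl mulrA.
Qed.

Let term_ge0 e u n x : 0 <= u -> 0 <= term e u n x.
Proof.
move=> u0; case: (boolP (odd n)) => [on|en]; first by rewrite term_odd.
rewrite term_even// mulr_ge0//.
  by rewrite !mulr_ge0 ?expR_ge0 ?exprn_ge0 ?invr_ge0.
rewrite -[n]odd_double_half (negPf en) add0n -mul2n exprM exprn_ge0//.
exact: sqr_ge0.
Qed.

Let term_series e u x : (\sum_(0 <= n <oo) (term e u n x)%:E =
  (expR (- (u * (1 + cosine e x))) + expR (- (u * (1 - cosine e x))))%:E)%E.
Proof.
rewrite /term; move: (cosine e x) => c; apply: eseries_cvg.
rewrite (_ : series _ = (fun N => expR (- u) * (series (exp_coeff (- (u * c))) N +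
    series (exp_coeff (u * c)) N))); last first.
  apply/funext => N; rewrite /series/= -big_split/= mulr_sumr.
  apply: eq_bigr => n _; rewrite /exp_coeff/= -mulrN !(exprMn _ u).
  move: ((- c) ^+ n) (c ^+ n) (u ^+ n) (n`!%:R^-1) (expR _) => p q r t v.
  by ring.
have -> : expR (- (u * (1 + c))) + expR (- (u * (1 - c))) =
    expR (- u) * (expR (- (u * c)) + expR (u * c)).
  by rewrite (mulrDr (expR _)) -!expRD; congr (expR _ + expR _); ring.
by apply: cvgMl_tmp; apply: cvgD; exact: is_cvg_series_exp_coeff.
Qed.

(** The law of the cosine is symmetric, so that only the even terms of the
exponential series contribute. *)
Lemma cosine_laplace e u : (0 < d)%N -> nrm e = 1 -> 0 <= u ->
  (\int[mu]_(x in NZ) (expR (- (u * (1 + cosine e x))))%:E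
   = (fine (mu NZ) * angular_laplace d u)%:E)%E.
Proof.
move=> d0 e1 u0.
have mc : measurable_fun setT (cosine e) by exact: measurable_cosine.
have mf (s : R) : measurable_fun setT (fun x => expR (- (u * (1 + s * cosine e x)))).
  apply: (measurableT_comp (@measurable_expR R)); apply: measurableT_comp => //.
  by apply: measurable_funM => //; apply: measurable_funD => //; exact: measurable_funM.
set I := (\int[mu]_(x in NZ) _)%E.
have IN : I = (\int[mu]_(x in NZ) (expR (- (u * (1 - cosine e x))))%:E)%E.
  have eN1 : nrm (- e) = 1 by rewrite nrmN.
  have mg : measurable_fun setT (fun r : R => (expR (- (u * (1 + r))))%:E).
    apply/measurable_EFinP; apply: (measurableT_comp (@measurable_expR R)).
    by apply: measurableT_comp => //; apply: measurable_funM => //; exact: measurable_funD.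
  have g0 (r : R) : (0 <= (expR (- (u * (1 + r))))%:E)%E.
    by rewrite lee_fin expR_ge0.
  rewrite /I (cosine_integral_invariant mu_sph e1 eN1 mg g0).
  by apply: eq_integral => x _; rewrite /cosine dotNr mulNr.
have Ifin : I \is a fin_num.
  apply: integrable_fin_num => //.
  apply: (@bounded_integrable _ _ mu _ _ 1) => //.
    by have := mf 1; under eq_fun do rewrite mul1r.
  move=> x; rewrite ger0_norm ?expR_ge0// -[leRHS]expR0 ler_expR oppr_le0 mulr_ge0//.
  by have := normr_cosine_le1 x e1; rewrite ler_norml => /andP[+ _]; lra.
have mterm n : measurable_fun NZ (fun x => (term e u n x)%:E).
  apply/measurable_funTS/measurable_EFinP; apply: measurable_funM => //.
  apply: measurable_funD; apply: measurable_funX => //.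
  exact: measurableT_comp.
have termE n : (\int[mu]_(x in NZ) (term e u n x)%:E =
    (2 * fine (mu NZ))%:E *
    (expR (- u) * (u ^+ n / n`!%:R) * coordinate_moment d n)%:E)%E.
  rewrite /coordinate_moment; case: ifPn => [on|en].
    rewrite mulr0 mule0; apply: integral0_eq => x _.
    by rewrite term_odd.
  under eq_integral do rewrite term_even// EFinM.
  have nE : n = (2 * n./2)%N by rewrite mul2n -[LHS]odd_double_half (negPf en).
  rewrite integralZl//=; last first.
    apply: (@bounded_integrable _ _ mu _ _ 1) => //; first exact: measurable_cosine_pow.
    by move=> x; rewrite normrX exprn_ile1// normr_cosine_le1.
  have := momentE mu_sph n./2 e1; rewrite -nE /moment /Rintegral => h.
  rewrite -[X in (_ * X)%E]fineK.
    by rewrite h -!EFinM /sphere_moment; congr EFin; ring.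
  apply: integrable_fin_num => //.
  apply: (@bounded_integrable _ _ mu _ _ 1) => //; first exact: measurable_cosine_pow.
  by move=> x; rewrite normrX exprn_ile1// normr_cosine_le1.
have II : (I + I = (2 * (fine (mu NZ) * angular_laplace d u))%:E)%E.
  have m1 : measurable_fun NZ (fun x => (expR (- (u * (1 + cosine e x))))%:E).
    apply/measurable_funTS/measurable_EFinP.
    by have := mf 1; under eq_fun do rewrite mul1r.
  have m2 : measurable_fun NZ (fun x => (expR (- (u * (1 - cosine e x))))%:E).
    apply/measurable_funTS/measurable_EFinP.
    by have := mf (-1); under eq_fun do rewrite mulN1r.
  rewrite {2}IN /I -ge0_integralD//; do ?[exact: m1|exact: m2
    |by move=> x _; rewrite lee_fin expR_ge0].
  under eq_integral do rewrite -EFinD -term_series.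
  rewrite integral_nneseries//; last by move=> n x _; rewrite lee_fin term_ge0.
  rewrite (eq_eseriesr (fun n _ => termE n)) nneseriesZl; last first.
    move=> n _; rewrite lee_fin mulr_ge0 ?coordinate_moment_ge0//.
    by rewrite !mulr_ge0 ?expR_ge0 ?exprn_ge0 ?invr_ge0.
  by rewrite -/(poisson_mean _ _) angular_laplaceE// -EFinM mulrA.
move: II; rewrite -(fineK Ifin) -EFinD => h; congr EFin.
have : fine I + fine I = 2 * (fine (mu NZ) * angular_laplace d u).
  exact: EFin_inj h.
move: (fine I) (fine (mu NZ) * _) => x y; lra.
Qed.

End cosine_laplace_transform.

(** * Radial tails and cones *)

Section radial_tail.
Context {R : realType} {d : nat}.
Variable mu : probability 'rV[R]_d R.
Hypothesis mu_sph : spherically_symmetric mu.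
Hypothesis d0 : (0 < d)%N.

Local Notation nrm := (@euclidean_norm R d).
Local Notation NZ := [set x : 'rV[R]_d | 0 < nrm x].

Variables a b N eps Lam : R.
Hypotheses (a0 : 0 < a) (b0 : 0 < b) (N0 : 0 < N).
Hypotheses (eps0 : 0 <= eps) (eps1 : 2 * eps <= 1).
Hypotheses (Lam0 : 0 <= Lam) (Lam_small : Lam * b <= a / 2).

(** The rescaled length; its law is close to that of a standard exponential
variable divided by N. *)
Definition excess (x : 'rV[R]_d) : R := (nrm x - a) / b.

Hypothesis tail : forall q, `|q| <= Lam ->
  `|N * pr mu [set x | q < excess x] * expR q - 1| <= eps.

Lemma measurable_excess : measurable_fun setT excess.
Proof.
apply: measurable_funM => //; apply: measurable_funB => //.
exact: measurable_nrm.
Qed.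

Lemma nrm_excess x : nrm x = a + excess x * b.
Proof. by rewrite /excess divfK ?gt_eqF//; ring. Qed.

Lemma measurable_excess_gt q : measurable [set x | q < excess x].
Proof. by apply: measurable_preimage_gt; exact: measurable_excess. Qed.

Lemma measurable_excess_window q K :
  measurable [set x | q < excess x /\ excess x <= K].
Proof.
rewrite (_ : [set x | _] = [set x | q < excess x] `&` ~` [set x | K < excess x]).
  apply: measurableI; first exact: measurable_excess_gt.
  by apply: measurableC; exact: measurable_excess_gt.
by apply/seteqP; split => x /=; rewrite leNgt => -[-> /negP].
Qed.

Lemma tail_le q : `|q| <= Lam ->
  N * pr mu [set x | q < excess x] <= (1 + eps) * expR (- q).
Proof.
move=> qL; have := tail qL; rewrite ler_norml => /andP[_ h].
rewrite expRN ler_pdivlMr ?expR_gt0//; lra.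
Qed.

Lemma tail_ge q : `|q| <= Lam ->
  (1 - eps) * expR (- q) <= N * pr mu [set x | q < excess x].
Proof.
move=> qL; have := tail qL; rewrite ler_norml => /andP[h _].
rewrite expRN ler_pdivrMr ?expR_gt0//; lra.
Qed.

Lemma pr_window q K : q <= K ->
  pr mu [set x | q < excess x /\ excess x <= K] =
  pr mu [set x | q < excess x] - pr mu [set x | K < excess x].
Proof.
move=> qK.
rewrite (pr_split mu (measurable_excess_gt q) (measurable_excess_gt K)).
rewrite (_ : _ `&` [set x | K < excess x] = [set x | K < excess x]); last first.
  apply/seteqP; split => x /=; first by case.
  by move=> Kx; split => //; exact: le_lt_trans Kx.
rewrite addrC addKr; congr (pr mu _).
by apply/seteqP; split => x /=; rewrite leNgt => -[-> /negP].
Qed.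

Lemma window_le q K : - Lam <= q -> K <= Lam ->
  N * pr mu [set x | q < excess x /\ excess x <= K] <= (1 + eps) * expR (- q).
Proof.
move=> qL KL; have [qK|Kq] := leP q K.
  apply: (@le_trans _ _ (N * pr mu [set x | q < excess x])).
    rewrite ler_pM2l//; apply: le_pr; last by move=> x [].
      exact: measurable_excess_window.
    exact: measurable_excess_gt.
  by apply: tail_le; rewrite ler_norml qL (le_trans qK).
rewrite (_ : [set x | _] = set0) /pr ?measure0 ?mulr0.
  by rewrite mulr_ge0 ?expR_ge0// addr_ge0.
by apply/seteqP; split => x //= [qx xK]; have := lt_le_trans qx xK; rewrite ltNge ltW.
Qed.

(** The truncation at K loses at most 2 exp (- K), which is below the geometric mean
of 2 exp (- K) and 2 exp (- q) when q <= K; when K < q the window is empty, and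
this mean exceeds the left-hand side. An error of this form can be averaged over
the directions, on which q depends. *)
Lemma window_ge q K : - Lam <= q -> 0 <= K <= Lam ->
  (1 - eps) * expR (- q) <= N * pr mu [set x | q < excess x /\ excess x <= K]
    + 2 * expR (- (K / 2)) * expR (- (q / 2)).
Proof.
move=> qL /andP[K0 KL].
have qE : expR (- q) = expR (- (q / 2)) * expR (- (q / 2)).
  by rewrite -expRD; congr expR; field.
have KE : expR (- K) = expR (- (K / 2)) * expR (- (K / 2)).
  by rewrite -expRD; congr expR; field.
have epos := expR_gt0 (- (q / 2)); have Kpos := expR_gt0 (- (K / 2)).
have [qK|Kq] := leP q K.
  rewrite pr_window// mulrBr.
  have h1 : (1 - eps) * expR (- q) <= N * pr mu [set x | q < excess x].
    by apply: tail_ge; rewrite ler_norml qL (le_trans qK).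
  have h2 : N * pr mu [set x | K < excess x] <= (1 + eps) * expR (- K).
    apply: tail_le; rewrite ler_norml KL andbT.
    by apply: le_trans K0; rewrite lerNl oppr0.
  have h3 : (1 + eps) * expR (- K) <= 2 * expR (- (K / 2)) * expR (- (q / 2)).
    have e2 : 1 + eps <= 2 by have := eps1; have := eps0; lra.
    have hK : expR (- (K / 2)) * expR (- (K / 2)) <= expR (- (K / 2)) * expR (- (q / 2)).
      by rewrite ler_wpM2l ?expR_ge0// ler_expR; move: qK; lra.
    rewrite KE -[leRHS]mulrA; apply: ler_pM => //; first exact: addr_ge0.
  lra.
have h : (1 - eps) * expR (- q) <= 2 * expR (- (K / 2)) * expR (- (q / 2)).
  rewrite qE mulrA ler_wpM2r ?expR_ge0//.
  have h1 : expR (- (q / 2)) <= expR (- (K / 2)) by rewrite ler_expR; lra.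
  apply: (@le_trans _ _ (1 * expR (- (q / 2)))); last lra.
  by rewrite ler_wpM2r ?expR_ge0//; move: eps0; lra.
have := mulr_ge0 (ltW N0) (pr_ge0 mu [set x | q < excess x /\ excess x <= K]).
lra.
Qed.

Lemma excess_nrm_gt0 x : - Lam < excess x -> 0 < nrm x.
Proof.
move=> h; rewrite nrm_excess.
have : - Lam * b < excess x * b by rewrite ltr_pM2r.
by move: Lam_small a0; lra.
Qed.

Lemma pr_NZ_gt0 : 0 < pr mu NZ.
Proof.
have h : (1 - eps) * expR (- 0) <= N * pr mu [set x | 0 < excess x].
  by apply: tail_ge; rewrite normr0.
have h2 : pr mu [set x | 0 < excess x] <= pr mu NZ.
  apply: le_pr; [exact: measurable_excess_gt|exact: measurable_nrm_gt|].
  move=> x /= x0; apply: excess_nrm_gt0; apply: le_lt_trans x0.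
  by rewrite lerNl oppr0.
rewrite -(pmulr_rgt0 _ N0); have := ler_wpM2l (ltW N0) h2.
move: h eps1; rewrite oppr0 expR0; lra.
Qed.

(** The shape, up to the values of the parameters, of the set of points far from a
given point of direction e. *)
Definition cone e q u K : set 'rV[R]_d := [set x | 0 < nrm x /\
  (q + u * (1 + cosine e x) < excess x /\ excess x <= K)].

Let threshold q u K : set (R * R) :=
  [set z | q + u * (1 + z.1) < (z.2 - a) / b /\ (z.2 - a) / b <= K].

Let measurable_threshold q u K : measurable (threshold q u K).
Proof.
have m2 : measurable_fun setT (fun z : R * R => (z.2 - a) / b).
  by apply: measurable_funM => //; exact: measurable_funB.
have m1 : measurable_fun setT (fun z : R * R => (z.2 - a) / b - (q + u * (1 + z.1))).
  apply: measurable_funB => //; apply: measurable_funD => //.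
  by apply: measurable_funM => //; exact: measurable_funD.
rewrite (_ : threshold q u K =
    [set z | 0 < (z.2 - a) / b - (q + u * (1 + z.1))] `&`
    ~` [set z | K < (z.2 - a) / b]).
  apply: measurableI; first exact: measurable_preimage_gt.
  by apply: measurableC; exact: measurable_preimage_gt.
by apply/seteqP; split => z; rewrite /threshold /= subr_gt0 leNgt => -[-> /negP].
Qed.

Lemma measurable_cone e q u K : measurable (cone e q u K).
Proof.
apply: measurableI; first exact: measurable_nrm_gt.
have mf : measurable_fun setT (fun x => (cosine e x, nrm x)).
  by apply: measurable_fun_pair; [exact: measurable_cosine|exact: measurable_nrm].
exact: measurable_preimageT mf (measurable_threshold q u K).
Qed.

Let slice q u K (y e : 'rV[R]_d) : R := pr mu [set x | 0 < nrm x /\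
  threshold q u K (cosine e y, nrm x)].

Let slice_set q u K (y e : 'rV[R]_d) : - Lam <= q + u * (1 + cosine e y) ->
  [set x : 'rV[R]_d | 0 < nrm x /\ threshold q u K (cosine e y, nrm x)] =
  [set x | q + u * (1 + cosine e y) < excess x /\ excess x <= K].
Proof.
move=> h; apply/seteqP; split => x /=; first by case.
by move=> [h1 h2]; split => //; apply: excess_nrm_gt0; exact: le_lt_trans h1.
Qed.

Let cos1 (e y : 'rV[R]_d) : nrm e = 1 -> 0 <= 1 + cosine e y.
Proof.
by move=> e1; have := normr_cosine_le1 y e1; rewrite ler_norml => /andP[+ _]; lra.
Qed.

Let mexp (e : 'rV[R]_d) q u : measurable_fun setT (fun x => expR (- (q + u * (1 + cosine e x)))).
Proof.
apply: (measurableT_comp (@measurable_expR R)); apply: measurableT_comp => //.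
apply: measurable_funD => //; apply: measurable_funM => //.
by apply: measurable_funD => //; exact: measurable_cosine.
Qed.

Let mslice_set q u K (y e : 'rV[R]_d) :
  measurable [set x : 'rV[R]_d | 0 < nrm x /\ threshold q u K (cosine e y, nrm x)].
Proof.
apply: measurableI; first exact: measurable_nrm_gt.
have mf : measurable_fun setT (fun x : 'rV[R]_d => (cosine e y, nrm x)).
  by apply: measurable_fun_pair => //; exact: measurable_nrm.
exact: measurable_preimageT mf (measurable_threshold q u K).
Qed.

Let mslice q u K e : measurable_fun setT (fun y => (slice q u K y e)%:E).
Proof.
pose W := [set z : 'rV[R]_d * 'rV[R]_d | 0 < nrm z.2 /\
   threshold q u K (cosine e z.1, nrm z.2)].
have mW : measurable W.
  apply: measurableI.
    exact: (measurable_preimageT measurable_snd (measurable_nrm_gt 0)).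
  have mf : measurable_fun setT (fun z : 'rV[R]_d * 'rV[R]_d => (cosine e z.1, nrm z.2)).
    apply: measurable_fun_pair; first exact: (measurableT_comp (measurable_cosine e)).
    exact: (measurableT_comp measurable_nrm).
  exact: measurable_preimageT mf (measurable_threshold q u K).
have := measurable_fun_xsection mu mW; apply: eq_measurable_fun => y _.
rewrite /slice -prE//=; congr (mu _).
by apply/seteqP; split => x; rewrite /xsection/= in_setE.
Qed.

Let cone_slice e q u K : nrm e = 1 ->
  ((pr mu NZ * pr mu (cone e q u K))%:E =
   \int[mu]_(y in NZ) (slice q u K y e)%:E)%E.
Proof.
move=> e1; rewrite EFinM -!prE//; last 2 first.
- exact: measurable_cone.
- exact: measurable_nrm_gt.
have := angle_norm_independent mu_sph e1 (measurable_threshold q u K).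
rewrite -/(cone e q u K) => ->.
by apply: eq_integral => y _; rewrite /slice -prE.
Qed.

Let laplace_integral e q u (c : R) : nrm e = 1 -> 0 <= u -> 0 <= c ->
  (\int[mu]_(y in NZ) (c * expR (- (q + u * (1 + cosine e y))))%:E =
   (pr mu NZ * (c * expR (- q) * angular_laplace d u))%:E)%E.
Proof.
move=> e1 u0 c0.
rewrite (eq_integral (fun y => (c * expR (- q))%:E *
    (expR (- (u * (1 + cosine e y))))%:E)%E); last first.
  by move=> y _; rewrite -EFinM -mulrA -expRD opprD.
have mN : measurable_fun NZ (fun y => (expR (- (u * (1 + cosine e y))))%:E).
  apply/measurable_funTS/measurable_EFinP.
  by have := mexp e 0 u; under eq_fun do rewrite add0r.
have mNZ : measurable NZ by exact: measurable_nrm_gt.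
rewrite ge0_integralZl_EFin//; do ?[exact: mN|by rewrite mulr_ge0 ?expR_ge0
  |by move=> y _; rewrite lee_fin expR_ge0].
rewrite (cosine_laplace mu_sph d0 e1 u0) -EFinM; congr EFin.
by rewrite /pr; ring.
Qed.

(** The length is independent of the direction, so that, given the cosine, the
excess exceeds the threshold with probability about exp (- threshold) / N;
averaging over the direction produces the angular Laplace transform. *)
Lemma pr_cone_le e q u K : nrm e = 1 -> 0 <= u -> - Lam <= q -> K <= Lam ->
  N * pr mu (cone e q u K) <= (1 + eps) * expR (- q) * angular_laplace d u.
Proof.
move=> e1 u0 qL KL; rewrite -(ler_pM2l pr_NZ_gt0) mulrCA -ler_pdivlMl//.
rewrite -lee_fin cone_slice//.
have mE := mexp e q u.
have -> : N^-1 * (pr mu NZ * ((1 + eps) * expR (- q) * angular_laplace d u)) =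
    pr mu NZ * ((1 + eps) / N * expR (- q) * angular_laplace d u) by ring.
have c0 : 0 <= (1 + eps) / N by apply: divr_ge0; [exact: addr_ge0|exact: ltW].
rewrite -(laplace_integral _ e1 u0 c0).
apply: ge0_le_integral.
- exact: measurable_nrm_gt.
- by move=> y _; rewrite lee_fin pr_ge0.
- by apply: measurable_funTS; exact: mslice.
- by apply/measurable_funTS/measurable_EFinP; apply: measurable_funM.
- move=> y _; rewrite lee_fin mulrAC ler_pdivlMr// mulrC.
  have h : - Lam <= q + u * (1 + cosine e y).
    by apply: le_trans qL _; rewrite lerDl mulr_ge0// cos1.
  by rewrite /slice slice_set//; exact: window_le.
Qed.

Lemma pr_cone_ge e q u K : nrm e = 1 -> 0 <= u -> - Lam <= q -> 0 <= K <= Lam ->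
  (1 - eps) * expR (- q) * angular_laplace d u <= N * pr mu (cone e q u K) +
    2 * expR (- (K / 2)) * expR (- (q / 2)) * angular_laplace d (u / 2).
Proof.
move=> e1 u0 qL /andP[K0 KL].
have u20 : 0 <= u / 2 by rewrite divr_ge0.
have cA : 0 <= (1 - eps) / N by apply: divr_ge0; [move: eps1 eps0; lra|exact: ltW].
have cB : 0 <= 2 * expR (- (K / 2)) / N.
  by apply: divr_ge0; [apply: mulr_ge0 => //; exact: expR_ge0|exact: ltW].
pose A y := (1 - eps) / N * expR (- (q + u * (1 + cosine e y))).
pose B y := 2 * expR (- (K / 2)) / N * expR (- (q / 2 + u / 2 * (1 + cosine e y))).
have A0 y : 0 <= A y by apply: mulr_ge0 => //; exact: expR_ge0.
have B0 y : 0 <= B y by apply: mulr_ge0 => //; exact: expR_ge0.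
have mA : measurable_fun NZ (fun y => (A y)%:E).
  by apply/measurable_funTS/measurable_EFinP; apply: measurable_funM.
have mB : measurable_fun NZ (fun y => (B y)%:E).
  by apply/measurable_funTS/measurable_EFinP; apply: measurable_funM.
have mS : measurable_fun NZ (fun y => (slice q u K y e)%:E).
  by apply: measurable_funTS; exact: mslice.
have S0 y : (0 <= (slice q u K y e)%:E)%E by rewrite lee_fin pr_ge0.
have mNZ : measurable NZ by exact: measurable_nrm_gt.
have : (\int[mu]_(y in NZ) (A y)%:E <=
    \int[mu]_(y in NZ) ((slice q u K y e)%:E + (B y)%:E))%E.
  apply: ge0_le_integral.
  - exact: mNZ.
  - by move=> y _; rewrite lee_fin.
  - exact: mA.
  - exact: emeasurable_funD.
  - move=> y _; rewrite -EFinD lee_fin /A /B.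
    have h : - Lam <= q + u * (1 + cosine e y).
      by apply: le_trans qL _; rewrite lerDl mulr_ge0// cos1.
    have KL' : 0 <= K <= Lam by rewrite K0 KL.
    have := window_ge h KL'; rewrite -(@slice_set q u K y e h) -/(slice q u K y e).
    rewrite (_ : (q + u * (1 + cosine e y)) / 2 =
      q / 2 + u / 2 * (1 + cosine e y)); last by ring.
    move: (slice _ _ _ _ _) (expR _) (expR _) (expR _) => sl E3 E2 E1 hw.
    rewrite -(ler_pM2l N0).
    have -> : N * ((1 - eps) / N * E1) = (1 - eps) * E1 by field; rewrite gt_eqF.
    have -> : N * (sl + 2 * E2 / N * E3) = N * sl + 2 * E2 * E3 by field; rewrite gt_eqF.
    exact: hw.
rewrite ge0_integralD//; last by move=> y _; rewrite lee_fin.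
rewrite (laplace_integral _ e1 u0 cA) (laplace_integral _ e1 u20 cB) -cone_slice//.
rewrite -EFinD lee_fin -mulrDr ler_pM2l ?pr_NZ_gt0//.
move: (pr mu (cone _ _ _ _)) (expR _) (expR _) (expR _) (angular_laplace _ _) (angular_laplace _ _).
move=> p E3 E2 E1 L2 L1; rewrite -(ler_pM2l N0).
have -> : N * ((1 - eps) / N * E1 * L1) = (1 - eps) * E1 * L1 by field; rewrite gt_eqF.
have -> : N * (p + 2 * E2 / N * E3 * L2) = N * p + 2 * E2 * E3 * L2 by field; rewrite gt_eqF.
by [].
Qed.

End radial_tail.

(** * Exponential moments of a truncated variable *)

Lemma integral_inv {R : realType} (A B : R) : 0 < A -> A < B ->
  (\int[lebesgue_measure]_(u in `[A, B]) (u^-1)%:E = (ln B - ln A)%:E)%E.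
Proof.
move=> A0 AB; rewrite (@continuous_FTC2 _ (fun u => u^-1) (@ln R) A B)//.
- apply: continuous_in_subspaceT => u; rewrite inE/= in_itv/= => /andP[Au _].
  by apply: inv_continuous; rewrite gt_eqF// (lt_le_trans A0).
- split.
  + move=> u; rewrite in_itv/= => /andP[Au _].
    by apply: ex_derive; apply: is_derive1_ln; exact: lt_trans Au.
  + by apply: cvg_at_right_filter; exact: continuous_ln.
  + by apply: cvg_at_left_filter; apply: continuous_ln; exact: lt_trans AB.
- move=> u; rewrite in_itv/= => /andP[Au _]; rewrite derive1E.
  by apply: derive_val; apply: is_derive1_ln; exact: lt_trans Au.
Qed.

Section exponential_moment_of_window.
Context {disp : measure_display} {T : measurableType disp} {R : realType}.
Variables (mu : probability T R) (Z : T -> R) (al be : R).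
Hypotheses (mZ : measurable_fun setT Z) (albe : al <= be).
Local Notation window y := [set w : T | y < Z w /\ Z w <= be].
Local Notation leb := (@lebesgue_measure R).

Let mle (f : T -> R) (c : R) : measurable_fun setT f -> measurable [set w | f w <= c].
Proof.
move=> mf; rewrite (_ : [set w | _] = ~` [set w | c < f w]).
  by apply: measurableC; exact: measurable_preimage_gt.
by apply/seteqP; split => w /=; rewrite leNgt => /negP.
Qed.

Let mwindow y : measurable (window y).
Proof. by apply: measurableI; [exact: measurable_preimage_gt|exact: mle]. Qed.

Let W : set (T * R) := [set z | (expR al <= z.2 /\ z.2 <= expR be) /\
  (z.2 < expR (Z z.1) /\ Z z.1 <= be)].

Let mW : measurable W.
Proof.
have m1 : measurable [set z : T * R | z.2 \in `[expR al, expR be]].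
  have : measurable `[expR al, expR be] by exact: measurable_itv.
  exact: measurable_preimageT (measurable_snd).
have m2 : measurable [set z : T * R | 0 < expR (Z z.1) - z.2].
  apply: measurable_preimage_gt; apply: measurable_funB => //.
  exact: (measurableT_comp (@measurable_expR R) (measurableT_comp mZ measurable_fst)).
have m3 : measurable [set z : T * R | Z z.1 <= be].
  exact: (measurable_preimageT measurable_fst (mle be mZ)).
rewrite (_ : W = [set z : T * R | z.2 \in `[expR al, expR be]] `&`
  ([set z : T * R | 0 < expR (Z z.1) - z.2] `&` [set z : T * R | Z z.1 <= be])).
  by apply: measurableI => //; exact: measurableI.
apply/seteqP; split => z; rewrite /W/= in_itv/= subr_gt0.
  by move=> [[-> ->]].
by move=> [/andP[-> ->]].
Qed.

Let Wx w : leb [set u | W (w, u)] =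
  (if (al < Z w) && (Z w <= be) then expR (Z w) - expR al else 0)%:E.
Proof.
case: ifPn => [/andP[alZ Zbe]|].
  rewrite (_ : [set u | _] = `[expR al, expR (Z w)[%classic).
    by rewrite lebesgue_measure_itv/= lte_fin ltr_expR alZ.
  apply/seteqP; split => u; rewrite /W/= in_itv/=.
    by move=> [[-> _] [-> _]].
  move=> /andP[-> h]; do ![split => //]; apply: (le_trans (ltW h)).
  by rewrite ler_expR.
move=> h; rewrite (_ : [set u | _] = set0) ?measure0//.
apply/seteqP; split => u //; rewrite /W/= => -[[alu _] [uZ Zbe]].
by move/negP: h; apply; rewrite Zbe andbT -ltr_expR (le_lt_trans alu).
Qed.

Let Wy u : mu [set w | W (w, u)] =
  (if u \in `[expR al, expR be] then pr mu (window (ln u)) else 0)%:E.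
Proof.
case: ifPn => [|h].
  rewrite in_itv/= => /andP[alu ube]; rewrite -prE//; congr (mu _).
  have u0 : 0 < u by apply: lt_le_trans alu; exact: expR_gt0.
  apply/seteqP; split => w; rewrite /W/=.
    by move=> [_ [uZ ->]]; split => //; rewrite -ltr_expR lnK.
  by move=> [uZ ->]; do ![split => //]; rewrite -[u]lnK// ltr_expR.
rewrite (_ : [set w | _] = set0) ?measure0//.
apply/seteqP; split => w //; rewrite /W/= => -[[alu ube] _].
by move/negP: h; apply; rewrite in_itv/= alu.
Qed.

(** Measure in two ways the region between the level exp al and the graph of
exp Z; with levels on the exponential scale, the sections have an explicit
length. *)
Lemma layer_cake_window :
  (\int[mu]_(w in window al) (expR (Z w))%:E =
   (expR al * pr mu (window al))%:E +
   \int[leb]_(u in `[expR al, expR be]) (pr mu (window (ln u)))%:E)%E.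
Proof.
have mEx : measurable_fun (window al) (fun w => (expR (Z w) - expR al)%:E).
  apply/measurable_funTS/measurable_EFinP; apply: measurable_funB => //.
  exact: (measurableT_comp (@measurable_expR R)).
have -> : (\int[mu]_(w in window al) (expR (Z w))%:E =
    \int[mu]_(w in window al) ((expR al)%:E + (expR (Z w) - expR al)%:E))%E.
  by apply: eq_integral => w _; rewrite -EFinD subrKC.
rewrite ge0_integralD//; do ?[by move=> w _; rewrite lee_fin expR_ge0
  |by move=> w [/ltW h _]; rewrite lee_fin subr_ge0 ler_expR].
congr (_ + _)%E.
  by rewrite integral_cst// EFinM; congr (_ * _)%E; exact: prE.
transitivity ((mu \x leb)%E W).
  rewrite product_measure_xsections [LHS]integral_mkcond.
  apply: eq_integral => w _; apply: etrans (esym (Wx w)); rewrite patchE.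
  have -> : (w \in window al) = (al < Z w) && (Z w <= be).
    by apply/idP/idP; rewrite inE => /andP.
  by case: ifP.
rewrite product_measure_ysections// [RHS]integral_mkcond.
apply: eq_integral => u _; apply: etrans (Wy u) _; rewrite patchE.
have -> : (u \in `[expR al, expR be]%classic) = (u \in `[expR al, expR be]).
  by rewrite mem_setE.
by case: ifP.
Qed.

Let mG : measurable_fun `[expR al, expR be]
  (fun u => (pr mu (window (ln u)))%:E).
Proof.
have := measurable_fun_ysection mu mW.
move/(measurable_funS measurableT (@subsetT _ `[expR al, expR be])).
apply: eq_measurable_fun => u; rewrite inE/= => uI.
have := Wy u; rewrite uI => <-; congr (mu _).
by apply/seteqP; split => w; rewrite /ysection/= in_setE.
Qed.

Let integral_inv_exp (c : R) : 0 <= c ->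
  (\int[leb]_(u in `[expR al, expR be]) (c / u)%:E = (c * (be - al))%:E)%E.
Proof.
move=> c0.
under eq_integral do rewrite EFinM.
rewrite ge0_integralZl_EFin//; last 2 first.
- move=> u; rewrite /= in_itv/= => /andP[h _].
  by rewrite lee_fin invr_ge0 (le_trans _ h)// expR_ge0.
- apply/measurable_EFinP; apply: measurable_funTS; exact: measurable_inv.
move: albe; rewrite le_eqVlt => /orP[/eqP <-|lt_albe].
  by rewrite set_itv1 integral_set1 subrr mule0 mulr0.
by rewrite integral_inv ?expR_gt0 ?ltr_expR// !expRK.
Qed.

(** A density c exp (- y) makes exp Z integrate to c times the length of the
window, and the term 1 comes from the part below the level exp al. *)
Lemma exponential_moment_window_le (c : R) : 0 <= c ->
  (forall y, al <= y <= be -> pr mu (window y) <= c * expR (- y)) ->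
  (\int[mu]_(w in window al) (expR (Z w))%:E <= (c * (1 + (be - al)))%:E)%E.
Proof.
move=> c0 h; rewrite layer_cake_window mulrDr mulr1 EFinD; apply: leeD.
  have := h al; rewrite lexx albe => /(_ isT).
  by rewrite lee_fin expRN ler_pdivlMr ?expR_gt0// mulrC.
rewrite -integral_inv_exp//; apply: ge0_le_integral.
- exact: measurable_itv.
- by move=> u _; rewrite lee_fin pr_ge0.
- exact: mG.
- apply/measurable_EFinP; apply: measurable_funM => //.
  by apply: measurable_funTS; exact: measurable_inv.
- move=> u; rewrite /= in_itv/= => /andP[u1 u2].
  have u0 : 0 < u by apply: lt_le_trans u1; exact: expR_gt0.
  rewrite lee_fin; have := h (ln u); rewrite expRN lnK//; apply.
  by rewrite -[al]expRK -[be]expRK !ler_ln ?posrE ?expR_gt0// u1.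
Qed.

Lemma exponential_moment_window_ge (c C : R) : 0 <= c -> 0 <= C ->
  (forall y, al <= y <= be -> c * expR (- y) <= pr mu (window y) + C * expR (- be)) ->
  ((c * (be - al) - C)%:E <= \int[mu]_(w in window al) (expR (Z w))%:E)%E.
Proof.
move=> c0 C0 h; rewrite layer_cake_window.
have hC : (\int[leb]_(u in `[expR al, expR be]) (C * expR (- be))%:E <= C%:E)%E.
  apply: (@le_trans _ _ ((C * expR (- be))%:E * leb `[expR al, expR be]%classic)%E).
    by rewrite integral_cst//; exact: measurable_itv.
  rewrite lebesgue_measure_itv/= lte_fin ltr_expR; case: ifPn => _; last first.
    by rewrite mule0 lee_fin.
  rewrite -EFinM lee_fin -mulrA ler_piMr// expRN mulrC ler_pdivrMr ?expR_gt0//.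
  by rewrite mul1r gerBl expR_ge0.
have h2 : ((c * (be - al))%:E <=
   \int[leb]_(u in `[expR al, expR be]) ((pr mu (window (ln u)))%:E
      + (C * expR (- be))%:E))%E.
  rewrite -integral_inv_exp//; apply: ge0_le_integral.
  - exact: measurable_itv.
  - move=> u; rewrite /= in_itv/= => /andP[u1 _].
    by rewrite lee_fin divr_ge0// (le_trans _ u1)// expR_ge0.
  - apply/measurable_EFinP; apply: measurable_funM => //.
    by apply: measurable_funTS; exact: measurable_inv.
  - by apply: emeasurable_funD.
  - move=> u; rewrite /= in_itv/= => /andP[u1 u2].
    have u0 : 0 < u by apply: lt_le_trans u1; exact: expR_gt0.
    rewrite -EFinD lee_fin; have := h (ln u); rewrite expRN lnK//; apply.
    by rewrite -[al]expRK -[be]expRK !ler_ln ?posrE ?expR_gt0// u1.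
rewrite ge0_integralD// in h2; last 2 first.
- by move=> u _; rewrite lee_fin pr_ge0.
- by move=> u _; rewrite lee_fin mulr_ge0 ?expR_ge0.
rewrite EFinB leeBlDr//.
apply: (le_trans h2); apply: leeD => //; rewrite leeDr// lee_fin.
by rewrite mulr_ge0 ?expR_ge0 ?pr_ge0.
Qed.

End exponential_moment_of_window.

(** * Far pairs *)

Lemma integral_le_bound {disp : measure_display} {T : measurableType disp}
    {R : realType} (m : {measure set T -> \bar R}) (D : set T) (f : T -> \bar R)
    (C : R) : measurable D -> measurable_fun setT f -> 0 <= C ->
  (forall x, 0 <= f x)%E -> (forall x, D x -> f x <= C%:E)%E ->
  (forall x, ~ D x -> f x = 0)%E ->
  (\int[m]_x f x <= C%:E * m D)%E.
Proof.
move=> mD mf C0 f0 fC fD; rewrite -integral_cst// [leRHS]integral_mkcond.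
apply: ge0_le_integral => //.
- by apply/(measurable_restrictT _ mD); exact: measurable_cst.
- move=> x _; rewrite patchE; case: ifPn => [|hx]; first by rewrite inE => /fC.
  by rewrite fD// => hx'; move/negP: hx; apply; rewrite inE.
Qed.

Section far_pairs.
Context {R : realType} {d : nat}.
Variable mu : probability 'rV[R]_d R.
Hypothesis mu_sph : spherically_symmetric mu.
Hypothesis d0 : (0 < d)%N.

Local Notation nrm := (@euclidean_norm R d).

Lemma nrm_triangle (x y : 'rV[R]_d) : nrm (x - y) <= nrm x + nrm y.
Proof.
rewrite -ler_sqr ?nnegrE ?nrm_ge0 ?addr_ge0 ?nrm_ge0// nrmB_sqr sqrrD.
by have := normr_dot_le x y; rewrite ler_norml => /andP[+ _]; lra.
Qed.

Lemma nrmB_cosine (x y : 'rV[R]_d) : 0 < nrm x -> 0 < nrm y ->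
  nrm (x - y) ^+ 2 = (nrm x + nrm y) ^+ 2
    - 2 * nrm x * nrm y * (1 + cosine ((nrm x)^-1 *: x) y).
Proof.
move=> x0 y0; rewrite nrmB_sqr /cosine dotZr (dotC y x).
by move: (nrm x) (nrm y) (dot x y) x0 y0 => X Y D x0 y0; field; rewrite !gt_eqF.
Qed.

Variables a b N eps Lam : R.
Hypotheses (a0 : 0 < a) (b0 : 0 < b) (N0 : 0 < N).
Hypotheses (eps0 : 0 <= eps) (eps1 : 2 * eps <= 1).
Hypotheses (Lam0 : 0 <= Lam) (Lam_small : Lam * b <= a / 2).
Hypothesis tail : forall q : R, `|q| <= Lam ->
  `|N * pr mu [set x : 'rV[R]_d | q < excess a b x] * expR q - 1| <= eps.
Variables s K : R.
Hypotheses (s0 : s <= 0) (sK : - Lam <= s - K) (K0 : 0 <= K) (KL : K <= Lam).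

Local Notation exc := (@excess R d a b).
Local Notation rV2 := ('rV[R]_d * 'rV[R]_d)%type.

(** Without the truncation at K, a single very long point would be far from many
others, and far pairs sharing a point would not be negligible. *)
Definition far_pair : set rV2 := [set z |
  [/\ exc z.1 <= K, exc z.2 <= K & 2 * a + s * b < nrm (z.1 - z.2)]].

Lemma measurable_far_pair : measurable far_pair.
Proof.
have m1 : measurable [set x : 'rV[R]_d | exc x <= K].
  rewrite (_ : [set x | _] = ~` [set x | K < exc x]).
    by apply: measurableC; exact: measurable_excess_gt.
  by apply/seteqP; split => w /=; rewrite leNgt => /negP.
have m3 : measurable [set z : rV2 | 2 * a + s * b < nrm (z.1 - z.2)].
  apply: measurable_preimage_gt.
  rewrite (_ : (fun z : rV2 => _) = (fun z => Num.sqrt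
      (nrm z.1 ^+ 2 + nrm z.2 ^+ 2 - 2 * dot z.1 z.2))); last first.
    by apply/funext => z; rewrite -nrmB_sqr sqrtr_sqr ger0_norm// nrm_ge0.
  apply: (measurableT_comp (continuous_measurable_fun (@sqrt_continuous R))).
  apply: measurable_funB; last first.
    by apply: measurable_funM => //; exact: measurable_dot2.
  apply: measurable_funD; apply: measurable_funX.
    exact: (measurableT_comp measurable_nrm).
  exact: (measurableT_comp measurable_nrm).
rewrite (_ : far_pair = ([set z : rV2 | exc z.1 <= K] `&` [set z | exc z.2 <= K])
    `&` [set z | 2 * a + s * b < nrm (z.1 - z.2)]).
  apply: measurableI m3; apply: measurableI.
    exact: (measurable_preimageT measurable_fst m1).
  exact: (measurable_preimageT measurable_snd m1).
by apply/seteqP; split => z; rewrite /far_pair/= => -[]// []; split.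
Qed.

Let zeta := Lam * b / a.

Let zeta_le : 2 * zeta <= 1.
Proof. by rewrite /zeta mulrA ler_pdivrMr//; move: Lam_small; lra. Qed.

Let zeta_ge0 : 0 <= zeta.
Proof. by apply: divr_ge0; [apply: mulr_ge0 => //|]; exact: ltW. Qed.

(** Both are a / (2 b) up to the relative size of the fluctuations of the
lengths. *)
Definition curvature_lo := (1 - Lam * b / a) ^+ 2 / (1 + Lam * b / a) * (a / (2 * b)).
Definition curvature_hi := (1 + Lam * b / a) ^+ 2 / (1 - Lam * b / a) * (a / (2 * b)).

Let c1 : 0 < 1 - zeta. Proof. by move: zeta_le; lra. Qed.
Let c2 : 0 < 1 + zeta. Proof. by move: zeta_ge0; lra. Qed.

Lemma curvature_lo_ge0 : 0 <= curvature_lo.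
Proof.
by rewrite /curvature_lo mulr_ge0// divr_ge0 ?sqr_ge0 ?mulr_ge0 ?ltW.
Qed.

Lemma curvature_hi_ge0 : 0 <= curvature_hi.
Proof.
by rewrite /curvature_hi mulr_ge0// divr_ge0 ?sqr_ge0 ?mulr_ge0 ?ltW.
Qed.

Let nrm_bounds x : - Lam <= exc x -> exc x <= Lam ->
  (1 - zeta) * a <= nrm x /\ nrm x <= (1 + zeta) * a.
Proof.
move=> h1 h2; rewrite (nrm_excess a b0).
have -> : (1 - zeta) * a = a + - Lam * b by rewrite /zeta; field; rewrite gt_eqF.
have -> : (1 + zeta) * a = a + Lam * b by rewrite /zeta; field; rewrite gt_eqF.
by rewrite !lerD2l !ler_pM2r.
Qed.

Let radius_ge : (2 - zeta) * a <= 2 * a + s * b.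
Proof.
have -> : (2 - zeta) * a = 2 * a + - Lam * b by rewrite /zeta; field; rewrite gt_eqF.
by rewrite lerD2l ler_pM2r//; move: sK K0; lra.
Qed.

Let radius_gt0 : 0 < 2 * a + s * b.
Proof.
apply: lt_le_trans radius_ge; apply: mulr_gt0 => //.
by move: zeta_le; lra.
Qed.

Lemma far_pair_excess x y : far_pair (x, y) -> s < exc x + exc y.
Proof.
move=> [_ _ /=] /lt_le_trans/(_ (nrm_triangle x y)).
rewrite (nrm_excess a b0 x) (nrm_excess a b0 y) => h.
by rewrite -(ltr_pM2r b0); move: h; lra.
Qed.

Lemma far_pair_excess1 x y : far_pair (x, y) -> s - K < exc x /\ exc x <= K.
Proof.
move=> h; have := far_pair_excess h; case: h => /= hx hy _.
by split => //; move: hy; lra.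
Qed.

Let unit_dir (x : 'rV[R]_d) : 0 < nrm x -> nrm ((nrm x)^-1 *: x) = 1.
Proof.
by move=> x0; rewrite nrmZ ger0_norm ?invr_ge0 ?ltW// mulVf// gt_eqF.
Qed.

Let cos_ge0 (x y : 'rV[R]_d) : 0 < nrm x -> 0 <= 1 + cosine ((nrm x)^-1 *: x) y.
Proof.
move=> /unit_dir/(normr_cosine_le1 y); rewrite ler_norml => /andP[+ _]; lra.
Qed.

(** The cosine law turns distance into excess: a direction deviating from the
antipode costs an amount proportional to 1 + cosine. *)
Lemma far_pair_sub_cone x : 0 < nrm x ->
  [set y | far_pair (x, y)] `<=`
  cone a b ((nrm x)^-1 *: x) (s - exc x) curvature_lo K.
Proof.
move=> x0 y /= far.
have [x1 x2] := far_pair_excess1 far.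
have hxy := far_pair_excess far.
have y1 : s - K < exc y by move: hxy x2; lra.
case: far => /= _ y2 hr.
have y0 : 0 < nrm y.
  by apply: (excess_nrm_gt0 a0 b0 Lam_small); exact: le_lt_trans y1.
split => //; split => //.
have [X1 X2] := nrm_bounds (ltW (le_lt_trans sK x1)) (le_trans x2 KL).
have [Y1 Y2] := nrm_bounds (ltW (le_lt_trans sK y1)) (le_trans y2 KL).
have C0 := cos_ge0 y x0.
have h2 : (2 * a + s * b) ^+ 2 < nrm (x - y) ^+ 2.
  by rewrite ltr_sqr// nnegrE ?nrm_ge0 ?ltW.
rewrite nrmB_cosine// in h2.
move: C0 h2; set C := 1 + cosine _ _ => C0 h2.
set r := 2 * a + s * b in h2 *.
have rE : nrm x + nrm y - r = (exc x + exc y - s) * b.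
  by rewrite (nrm_excess a b0 x) (nrm_excess a b0 y) /r; ring.
have g0 : 0 < (exc x + exc y - s) * b by apply: mulr_gt0 => //; rewrite subr_gt0.
(* Difference of squares: the first factor is a combination of excesses, and the
second one is below 4 (1 + zeta) a. *)
have h3 : 2 * ((1 - zeta) ^+ 2 * a ^+ 2) * C <
    (exc x + exc y - s) * b * (4 * ((1 + zeta) * a)).
  apply: (@le_lt_trans _ _ (2 * nrm x * nrm y * C)).
    apply: ler_wpM2r => //; rewrite -mulrA ler_pM2l// -exprMn expr2.
    by apply: ler_pM => //; rewrite mulr_ge0 ?ltW.
  apply: (@lt_le_trans _ _ ((nrm x + nrm y - r) * (nrm x + nrm y + r))).
    by move: h2; rewrite -subr_sqr; lra.
  rewrite rE ler_pM2l//.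
  have : nrm x + nrm y - r > 0 by rewrite rE.
  by move: X2 Y2; lra.
have -> : s - exc x + curvature_lo * C = s - exc x +
   2 * ((1 - zeta) ^+ 2 * a ^+ 2) * C / (b * (4 * ((1 + zeta) * a))).
  rewrite /curvature_lo -/zeta; move: (1 - zeta) (1 + zeta) c2 => z1 z2 z20.
  by field; rewrite !gt_eqF.
suff : 2 * ((1 - zeta) ^+ 2 * a ^+ 2) * C / (b * (4 * ((1 + zeta) * a)))
   < exc x + exc y - s by lra.
rewrite ltr_pdivrMr; first by rewrite [ltRHS]mulrA.
by rewrite !mulr_gt0.
Qed.

(** The converse inclusion, with the extreme values of the lengths exchanged. *)
Lemma cone_sub_far_pair x : s < exc x -> exc x <= 0 ->
  cone a b ((nrm x)^-1 *: x) (s - exc x) curvature_hi K `<=`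
  [set y | far_pair (x, y)].
Proof.
move=> x1 x2 y [y0 [y1 y2]].
have sL : - Lam <= s by move: sK K0; lra.
have x0 : 0 < nrm x.
  by apply: (excess_nrm_gt0 a0 b0 Lam_small); exact: le_lt_trans x1.
have C0 := cos_ge0 y x0.
move: C0 y1; set C := 1 + cosine _ _ => C0 y1.
have cC : 0 <= curvature_hi * C by rewrite mulr_ge0 ?curvature_hi_ge0.
have y3 : - Lam <= exc y by move: y1 x2; lra.
have [X1 X2] := nrm_bounds (ltW (le_lt_trans sL x1)) (le_trans x2 Lam0).
have [Y1 Y2] := nrm_bounds y3 (le_trans y2 KL).
split => //=; first exact: le_trans K0.
rewrite -ltr_sqr ?nnegrE ?nrm_ge0 ?ltW// nrmB_cosine// -/C.
set r := 2 * a + s * b.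
have rE : nrm x + nrm y - r = (exc x + exc y - s) * b.
  by rewrite (nrm_excess a b0 x) (nrm_excess a b0 y) /r; ring.
have g : curvature_hi * C * b < nrm x + nrm y - r.
  by rewrite rE ltr_pM2r//; move: y1; lra.
have g4 : 4 * ((1 - zeta) * a) <= nrm x + nrm y + r.
  have : 0 <= curvature_hi * C * b by rewrite mulr_ge0// ltW.
  move: g radius_ge; rewrite -/r => g1 g2 g3.
  have : 0 <= zeta * a by rewrite mulr_ge0// ltW.
  by move: g1 g2 g3; lra.
have p4 : 0 < 4 * ((1 - zeta) * a) by rewrite !mulr_gt0.
have : 2 * nrm x * nrm y * C < (nrm x + nrm y - r) * (nrm x + nrm y + r).
  apply: (@le_lt_trans _ _ (curvature_hi * C * b * (4 * ((1 - zeta) * a)))).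
    have -> : curvature_hi * C * b * (4 * ((1 - zeta) * a)) =
        2 * ((1 + zeta) * a * ((1 + zeta) * a)) * C.
      rewrite /curvature_hi -/zeta; move: (1 - zeta) (1 + zeta) c1 => z1 z2 z10.
      by field; rewrite !gt_eqF.
    apply: ler_wpM2r => //; rewrite -mulrA ler_pM2l//.
    by apply: ler_pM => //; rewrite nrm_ge0.
  apply: (@lt_le_trans _ _ ((nrm x + nrm y - r) * (4 * ((1 - zeta) * a)))).
    by rewrite ltr_pM2r.
  have g0 : 0 <= nrm x + nrm y - r.
    by apply: le_trans (ltW g); apply: mulr_ge0 => //; exact: ltW.
  exact: ler_wpM2l.
by rewrite -subr_sqr; lra.
Qed.

Let h x : R := pr mu [set y | far_pair (x, y)].

Let mfar x : measurable [set y | far_pair (x, y)].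
Proof.
have := measurable_xsection x measurable_far_pair.
rewrite (_ : xsection _ _ = [set y | far_pair (x, y)])//.
by apply/seteqP; split => y; rewrite /xsection/= in_setE.
Qed.

Let mh : measurable_fun setT (fun x => (h x)%:E).
Proof.
have := measurable_fun_xsection mu measurable_far_pair.
apply: eq_measurable_fun => x _; rewrite /h -prE//; congr (mu _).
by apply/seteqP; split => y; rewrite /xsection/= in_setE.
Qed.

Let h_eq0 x : ~ (s - K < exc x /\ exc x <= K) -> h x = 0.
Proof.
move=> hx; rewrite /h (_ : [set y | _] = set0) /pr ?measure0//.
by apply/seteqP; split => y //= /far_pair_excess1.
Qed.

Let h_le x : s - K < exc x -> exc x <= K ->
  N * h x <= (1 + eps) * expR (exc x - s) * angular_laplace d curvature_lo.
Proof.
move=> x1 x2.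
have x0 : 0 < nrm x.
  by apply: (excess_nrm_gt0 a0 b0 Lam_small); exact: le_lt_trans x1.
apply: (@le_trans _ _ (N * pr mu (cone a b ((nrm x)^-1 *: x) (s - exc x) curvature_lo K))).
  rewrite ler_pM2l//; apply: le_pr; [exact: mfar|exact: measurable_cone|].
  exact: far_pair_sub_cone.
rewrite -[exc x - s]opprB.
apply: (pr_cone_le mu_sph d0 a0 b0 N0 eps0 eps1 Lam0 Lam_small tail) => //.
- exact: unit_dir.
- exact: curvature_lo_ge0.
- by apply: le_trans sK _; move: x2; lra.
Qed.

Lemma pr_far_section_le x :
  N * pr mu [set y | far_pair (x, y)] <=
  (1 + eps) * expR (K - s) * angular_laplace d curvature_lo.
Proof.
rewrite -/(h x); have phi0 := angular_laplace_ge0 d curvature_lo_ge0.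
have e1 : 0 <= 1 + eps by rewrite addr_ge0.
have [[x1 x2]|/h_eq0 ->] := pselect (s - K < exc x /\ exc x <= K).
  apply: (le_trans (h_le x1 x2)); apply: ler_wpM2r => //.
  by rewrite ler_wpM2l// ler_expR lerD2r.
by rewrite mulr0 !mulr_ge0// expR_ge0.
Qed.

Let far_integral : ((mu \x mu) far_pair = \int[mu]_x (h x)%:E)%E.
Proof.
rewrite product_measure_xsections; apply: eq_integral => x _.
by rewrite /h -prE.
Qed.

(** The section of the far pairs at a point of excess t has probability at most
a constant times exp (t - s), and t ranges between s - K and K. *)
Lemma pr_far_pair_le : ((mu \x mu) far_pair <=
  ((1 + eps) ^+ 2 * expR (- s) * angular_laplace d curvature_lo *
    (1 + (2 * K - s)) / N ^+ 2)%:E)%E.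
Proof.
have phi0 := angular_laplace_ge0 d curvature_lo_ge0.
have e1 : 0 <= 1 + eps by rewrite addr_ge0.
set C := (1 + eps) * expR (- s) * angular_laplace d curvature_lo / N.
have C0 : 0 <= C by apply: divr_ge0; [do ![apply: mulr_ge0] => //; exact: expR_ge0|exact: ltW].
have mW := @measurable_excess_window R d a b (s - K) K.
have mE : measurable_fun setT (fun x => (expR (exc x))%:E).
  apply/measurable_EFinP; apply: (measurableT_comp (@measurable_expR R)).
  exact: measurable_excess.
rewrite far_integral.
apply: (@le_trans _ _ (C%:E *
   \int[mu]_(x in [set x | (s - K < exc x /\ exc x <= K)%R]) (expR (exc x))%:E)%E).
  rewrite -ge0_integralZl_EFin//; do ?[exact: measurable_funTS
    |by move=> x _; rewrite lee_fin expR_ge0].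
  rewrite [leRHS]integral_mkcond; apply: ge0_le_integral.
  - exact: measurableT.
  - by move=> x _; rewrite lee_fin pr_ge0.
  - exact: mh.
  - apply/(measurable_restrictT _ mW).
    by apply: measurable_funTS; apply: emeasurable_funM => //.
  - move=> x _; rewrite patchE; case: ifPn => [|hx].
      rewrite inE/= => -[x1 x2]; rewrite -EFinM lee_fin.
      have := h_le x1 x2; rewrite expRD /C => hh.
      rewrite -(ler_pM2l N0); apply: (le_trans hh); rewrite le_eqVlt; apply/orP; left.
      by apply/eqP; field; rewrite gt_eqF.
    rewrite h_eq0//; by move=> hx'; move/negP: hx; apply; rewrite inE.
have K1 : s - K <= K by move: s0 K0; lra.
apply: (@le_trans _ _ (C%:E * ((1 + eps) / N * (1 + (K - (s - K))))%:E)%E).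
  apply: lee_wpmul2l; first by rewrite lee_fin.
  apply: exponential_moment_window_le => //; first exact: measurable_excess.
    exact: divr_ge0 e1 (ltW N0).
  move=> y /andP[y1 y2]; rewrite -(ler_pM2l N0).
  have := window_le N0 eps0 tail (le_trans sK y1) KL.
  move/le_trans; apply; rewrite le_eqVlt; apply/orP; left.
  by apply/eqP; field; rewrite gt_eqF.
rewrite -EFinM lee_fin le_eqVlt; apply/orP; left; apply/eqP; rewrite /C.
have -> : K - (s - K) = 2 * K - s by ring.
by move: (expR _) (angular_laplace _ _) (2 * K - s) => E L S; field; rewrite gt_eqF.
Qed.

Let Bhi := (1 - eps) * angular_laplace d curvature_hi -
  2 * expR (- (K / 2)) * angular_laplace d (curvature_hi / 2).

Let h_ge x : s < exc x -> exc x <= 0 -> expR (exc x - s) * Bhi <= N * h x.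
Proof.
move=> x1 x2.
have hE : expR (- ((s - exc x) / 2)) <= expR (exc x - s).
  by rewrite ler_expR; move: x1; lra.
have sL : - Lam <= s by move: sK K0; lra.
have x0 : 0 < nrm x.
  by apply: (excess_nrm_gt0 a0 b0 Lam_small); exact: le_lt_trans x1.
apply: (@le_trans _ _ (N * pr mu (cone a b ((nrm x)^-1 *: x) (s - exc x) curvature_hi K))); last first.
  rewrite ler_pM2l//; apply: le_pr; [exact: measurable_cone|exact: mfar|].
  exact: cone_sub_far_pair.
have KK : 0 <= K <= Lam by rewrite K0.
have qL : - Lam <= s - exc x by move: x2; lra.
have := pr_cone_ge mu_sph d0 a0 b0 N0 eps0 eps1 Lam0 Lam_small tail
  (unit_dir x0) curvature_hi_ge0 qL KK.
rewrite (_ : - (s - exc x) = exc x - s); last by ring.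
have u2 : 0 <= curvature_hi / 2 by rewrite divr_ge0// curvature_hi_ge0.
have := angular_laplace_ge0 d u2; rewrite /Bhi.
have e20 : 0 <= 2 * expR (- (K / 2)) by rewrite mulr_ge0// expR_ge0.
move: (angular_laplace _ _) (angular_laplace _ _) => L1 L2 L10 hh.
have := ler_wpM2l (mulr_ge0 e20 L10) hE.
move: (expR (- (K / 2))) (expR (- ((s - exc x) / 2))) (expR (exc x - s)) hh.
move=> E1 E2 E3; lra.
Qed.

(** The range s < t <= 0 of the first excess already carries the main term. *)
Lemma pr_far_pair_ge : 0 <= Bhi ->
  ((expR (- s) * Bhi * ((1 - eps) * (- s) - (1 + eps)) / N ^+ 2)%:E <=
   (mu \x mu) far_pair)%E.
Proof.
move=> B0; rewrite far_integral.
have e1 : 0 <= 1 + eps by rewrite addr_ge0.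
have e2 : 0 <= 1 - eps by move: eps1 eps0; lra.
set C := expR (- s) * Bhi / N.
have C0 : 0 <= C by apply: divr_ge0; [do ![apply: mulr_ge0] => //; exact: expR_ge0|exact: ltW].
have mW := @measurable_excess_window R d a b s 0.
have mE : measurable_fun setT (fun x => (expR (exc x))%:E).
  apply/measurable_EFinP; apply: (measurableT_comp (@measurable_expR R)).
  exact: measurable_excess.
apply: (@le_trans _ _ (C%:E *
   \int[mu]_(x in [set x | (s < exc x /\ exc x <= 0)%R]) (expR (exc x))%:E)%E); last first.
  rewrite -ge0_integralZl_EFin//; do ?[exact: measurable_funTS
    |by move=> x _; rewrite lee_fin expR_ge0].
  rewrite [leLHS]integral_mkcond; apply: ge0_le_integral.
  - exact: measurableT.
  - move=> x _; rewrite patchE; case: ifP => // _.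
    by rewrite -EFinM lee_fin mulr_ge0// expR_ge0.
  - apply/(measurable_restrictT _ mW).
    by apply: measurable_funTS; apply: emeasurable_funM => //.
  - exact: mh.
  - move=> x _; rewrite patchE; case: ifPn => [|hx]; last by rewrite lee_fin pr_ge0.
    rewrite inE/= => -[x1 x2]; rewrite -EFinM lee_fin.
    have := h_ge x1 x2; rewrite expRD /C => hh.
    rewrite -(ler_pM2l N0); apply: le_trans hh; rewrite le_eqVlt; apply/orP; left.
    by apply/eqP; field; rewrite gt_eqF.
have sL : - Lam <= s by move: sK K0; lra.
apply: (@le_trans _ _ (C%:E * ((1 - eps) / N * (0 - s) - (1 + eps) / N)%:E)%E).
  rewrite -EFinM lee_fin le_eqVlt; apply/orP; left; apply/eqP; rewrite /C.
  by move: (expR _) Bhi => E L; field; rewrite gt_eqF.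
apply: lee_wpmul2l; first by rewrite lee_fin.
apply: exponential_moment_window_ge => //; first exact: measurable_excess.
- exact: divr_ge0 e2 (ltW N0).
- exact: divr_ge0 e1 (ltW N0).
move=> y /andP[y1 y2]; rewrite pr_window//.
have yL : `|y| <= Lam by rewrite ler_norml (le_trans sL y1) (le_trans y2 Lam0).
have zL : `|0 : R| <= Lam by rewrite normr0.
have := tail_ge tail yL; have := tail_le tail zL.
move: (pr mu _) (pr mu _) (expR _) (expR _) => p2 p1 E2 E1 h1 h2.
rewrite -(ler_pM2l N0).
have -> : N * ((1 - eps) / N * E2) = (1 - eps) * E2 by field; rewrite gt_eqF.
have -> : N * (p2 - p1 + (1 + eps) / N * E1) = N * p2 - N * p1 + (1 + eps) * E1.
  by field; rewrite gt_eqF.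
by move: h1 h2; lra.
Qed.

(** Two far pairs sharing a point are much rarer than one, uniformly over the
position of the shared point. *)
Lemma pr_far_chain_le :
  (((mu \x mu) \x mu) [set z : rV2 * 'rV[R]_d | far_pair z.1 /\ far_pair (z.1.1, z.2)] <=
  ((1 + eps) * expR (K - s) * angular_laplace d curvature_lo / N)%:E *
    (mu \x mu) far_pair)%E.
Proof.
set C := _ / N.
have C0 : 0 <= C.
  apply: divr_ge0; last exact: ltW.
  apply: mulr_ge0; last exact: angular_laplace_ge0 curvature_lo_ge0.
  by apply: mulr_ge0; [exact: addr_ge0|exact: expR_ge0].
pose rot (p : rV2 * 'rV[R]_d) := (p.1.1, p.2).
have mrot : measurable_fun setT rot.
  apply: measurable_fun_pair; last exact: measurable_snd.
  exact: (measurableT_comp measurable_fst measurable_fst).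
pose S := [set p : rV2 * 'rV[R]_d | far_pair p.1 /\ far_pair (p.1.1, p.2)].
have mS : measurable S.
  apply: measurableI.
    exact: (measurable_preimageT measurable_fst measurable_far_pair).
  exact: (measurable_preimageT mrot measurable_far_pair).
have -> : (((mu \x mu) \x mu) S = \int[mu \x mu]_z mu [set y | S (z, y)])%E.
  apply: eq_integral => z _ /=; congr (mu _).
  by apply/seteqP; split => y; rewrite /xsection/= in_setE.
apply: integral_le_bound => //.
- exact: measurable_far_pair.
- have := measurable_fun_xsection mu mS; apply: eq_measurable_fun => z _.
  by congr (mu _); apply/seteqP; split => y; rewrite /xsection/= in_setE.
- move=> z hz; rewrite (_ : [set y | _] = [set y | far_pair (z.1, y)]); last first.
    by apply/seteqP; split => y //= -[].
  rewrite (prE mu (mfar z.1)) lee_fin /C ler_pdivlMr// mulrC.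
  exact: pr_far_section_le.
- move=> z hz; rewrite (_ : [set y | _] = set0) ?measure0//.
  by apply/seteqP; split => y //= -[].
Qed.

End far_pairs.

(** * Pairs of independent identically distributed points *)

Lemma product_measure_ext {d1 d2 : measure_display} {T1 : measurableType d1}
    {T2 : measurableType d2} {R : realType}
    (m1 m1' : {measure set T1 -> \bar R}) (m2 m2' : {measure set T2 -> \bar R})
    (S : set (T1 * T2)) :
  (forall B, measurable B -> m1 B = m1' B) ->
  (forall B, measurable B -> m2 B = m2' B) ->
  measurable S -> (m1 \x m2)%E S = (m1' \x m2')%E S.
Proof.
move=> e1 e2 mS.
transitivity (\int[m1]_x m2' (xsection S x))%E.
  by apply: eq_integral => x _; apply: e2; exact: measurable_xsection.
by apply: eq_measure_integral => B mB _; exact: e1.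
Qed.

Section iid_pairs.
Context {disp disp' : measure_display} {T : measurableType disp}
  {T' : measurableType disp'} {R : realType}.
Variables (P : probability T R) (X : nat -> {RV P >-> T'}).
Hypothesis indepX : mutually_independent P X.
Hypothesis identX : identically_distributed P X.
Local Notation mu := (distribution P (X 0%N)).

Lemma iid_pair_law i j (F : set (T' * T')) : i != j -> measurable F ->
  P [set w | F (X i w, X j w)] = (mu \x mu)%E F.
Proof.
move=> ij mF; rewrite (indep_product_law (P := P) (Y := X i) (Z := X j))//.
  by apply: product_measure_ext => // B mB; exact: identX.
move=> B C mB mC; apply: (indep_disjoint_families indepX (S := [set i]) (S' := [set j])).
- by apply/seteqP; split => // k [/= ->] /eqP; rewrite (negbTE ij).
- by apply: sub_sigma_algebra; exact: cylinders_coord.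
- by apply: sub_sigma_algebra; exact: cylinders_coord.
Qed.

Lemma iid_triple_law i j k (S : set (T' * T' * T')) :
  i != j -> i != k -> j != k -> measurable S ->
  P [set w | S (X i w, X j w, X k w)] = ((mu \x mu) \x mu)%E S.
Proof.
move=> ij ik jk mS.
have mY : measurable_fun setT (fun w => (X i w, X j w)) by exact: measurable_fun_pair.
pose Y : {mfun T >-> _} := mfun_Sub (mem_set mY).
have := @indep_product_law _ _ _ _ _ _ _ P Y (X k).
move=> ->//.
  apply: product_measure_ext => // B mB; last exact: identX.
  by rewrite /distribution /pushforward; apply: iid_pair_law.
move=> B C mB mC.
apply: (indep_disjoint_families indepX (S := [set i; j]) (S' := [set k])).
- apply/seteqP; split => // l [/= [->|->]] /eqP; first by rewrite (negbTE ik).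
  by rewrite (negbTE jk).
- by apply: measurable_cylinders_pair => //; [left|right].
- by apply: sub_sigma_algebra; exact: cylinders_coord.
Qed.

Variable F : set (T' * T').
Hypothesis mF : measurable F.
Hypothesis symF : forall x y, F (x, y) -> F (y, x).
Let A i j : set T := [set w | F (X i w, X j w)].

Let mA i j : measurable (A i j).
Proof.
have mY : measurable_fun setT (fun w => (X i w, X j w)) by exact: measurable_fun_pair.
exact: measurable_preimageT mY mF.
Qed.

Let pair_free_cylinders (J : seq nat) : <<s cylinders X [set` J] >> (pair_free A J).
Proof.
rewrite pair_freeE.
apply: (@bigcap_measurableType _ (g_sigma_algebraType (cylinders X [set` J]))) => i iJ.
apply: (@bigcap_measurableType _ (g_sigma_algebraType (cylinders X [set` J]))) => j jJ.
case: ifP => _; last exact: measurableT.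
by apply: measurableC; exact: measurable_cylinders_pair.
Qed.

(** Pair-freeness of J depends on the coordinates in J only, so that it is
independent of any pair outside J. *)
Lemma iid_pair_free_Poisson (q : R) (n : nat) (p := fine ((mu \x mu)%E F)) :
  (((mu \x mu) \x mu) [set z | F z.1 /\ F (z.1.1, z.2)] <= q%:E)%E ->
  n%:R * p <= 1 ->
  `|pr P (pair_free A (iota 1 n)) - expR (- (p * (n%:R * (n%:R - 1)) / 2))|
    <= n%:R ^+ 3 * (2 * (p ^+ 2 + q)).
Proof.
move=> hq np.
have mF2 : measurable [set z : T' * T' * T' | F z.1 /\ F (z.1.1, z.2)].
  apply: measurableI; first exact: (measurable_preimageT measurable_fst mF).
  have mrot : measurable_fun setT (fun z : T' * T' * T' => (z.1.1, z.2)).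
    apply: measurable_fun_pair; last exact: measurable_snd.
    exact: (measurableT_comp measurable_fst measurable_fst).
  exact: measurable_preimageT mrot mF.
have := @pair_free_Poisson _ _ _ P A mA _ p q _ _ _ _ (iota 1 n).
rewrite size_iota; apply => //.
- by move=> i j; apply/seteqP; split => w; exact: symF.
- rewrite -lee_fin; apply: le_trans hq; exact: measure_ge0.
- by move=> i j ij; rewrite /pr /p -(iid_pair_law ij mF).
- move=> i j k ij ik jk; rewrite -lee_fin -prE; last exact: measurableI.
  by rewrite (iid_triple_law ij ik jk mF2) in hq *.
- move=> J i j ij iJ jJ; rewrite /pr.
  rewrite (indep_disjoint_families indepX (S := [set` J]) (S' := [set i; j])).
  + by rewrite fineM ?fin_num_measure ?(iid_pair_law ij mF)//; exact: measurable_pair_free.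
  + apply/seteqP; split => // k [/= kJ [|] /= kE]; move: kJ; rewrite kE.
      by rewrite (negbTE iJ).
    by rewrite (negbTE jJ).
  + exact: pair_free_cylinders.
  + by apply: measurable_cylinders_pair => //; [left|right].
- exact: iota_uniq.
Qed.

End iid_pairs.

(** * The maximal distance at a fixed sample size *)

Section maximum_distance.
Context {disp : measure_display} {T : measurableType disp} {R : realType} {d : nat}.
Variables (P : probability T R) (X : nat -> {RV P >-> 'rV[R]_d}).
Hypothesis indepX : mutually_independent P X.
Hypothesis identX : identically_distributed P X.
Hypothesis sphX : spherically_symmetric (distribution P (X 0%N)).
Hypothesis d0 : (0 < d)%N.
Local Notation mu := (distribution P (X 0%N)).
Local Notation nrm := (@euclidean_norm R d).

Lemma M2_le n w (r : R) : 0 <= r -> (M2 X n w <= r) <->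
  (forall i j, i \in iota 1 n -> j \in iota 1 n -> i != j ->
    nrm (X i w - X j w) <= r).
Proof.
move=> r0; split=> [h i j|h].
  wlog ij : i j / (i < j)%N => [hw iI jI ij|].
    have [ij'|ji] := ltnP i j; first exact: hw.
    rewrite -nrmN opprB; apply: hw => //; last by rewrite eq_sym.
    by rewrite ltn_neqAle eq_sym ij.
  rewrite !mem_iota !add1n => /andP[i1 iN] /andP[j1 jN] _.
  apply: le_trans h; rewrite /M2.
  have iI : i \in index_iota 1 n.+1 by rewrite mem_index_iota i1.
  have jI : j \in index_iota i.+1 n.+1 by rewrite mem_index_iota ij.
  apply: (@bigmax_sup_seq _ _ _ _ _ i) => //.
  by apply: (@le_bigmax_seq _ _ _ _ _ j xpredT (fun j => nrm (X i w - X j w))).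
rewrite /M2 big_seq; apply: bigmax_le => // i; rewrite mem_index_iota => /andP[i1 iN].
rewrite big_seq; apply: bigmax_le => // j; rewrite mem_index_iota => /andP[ij jN].
apply: h; rewrite ?mem_iota ?add1n ?i1//; last by rewrite neq_ltn ij.
by rewrite jN andbT (leq_trans _ ij).
Qed.

Variables a b N eps Lam : R.
Variables s K : R.
Hypotheses (a0 : 0 < a) (b0 : 0 < b).
Hypotheses (radius_ge0 : 0 <= 2 * a + s * b).

Let A i j : set T := [set w | far_pair a b s K (X i w, X j w)].

Let mA i j : measurable (A i j).
Proof.
have mY : measurable_fun setT (fun w => (X i w, X j w)) by exact: measurable_fun_pair.
exact: measurable_preimageT mY (measurable_far_pair _ _ _ _).
Qed.

Let mM n : measurable [set w | M2 X n w <= 2 * a + s * b].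
Proof.
rewrite (_ : [set w | _] = ~` [set w | 2 * a + s * b < M2 X n w]).
  by apply: measurableC; apply: measurable_preimage_gt; exact: measurable_M2.
by apply/seteqP; split => w /=; rewrite leNgt => /negP.
Qed.

Lemma M2_le_pair_free n :
  pr P [set w | M2 X n w <= 2 * a + s * b] <= pr P (pair_free A (iota 1 n)).
Proof.
apply: le_pr; [exact: mM|exact: measurable_pair_free|].
move=> w /= /(M2_le _ _ radius_ge0) h i j iI jI ij [/= _ _].
by rewrite ltNge h.
Qed.

(** Once no point is exceptionally long, the maximal distance exceeds the radius
only if some pair is far. *)
Lemma pair_free_le_M2 n : pr P (pair_free A (iota 1 n)) <=
  pr P [set w | M2 X n w <= 2 * a + s * b] +
  n%:R * pr mu [set x | K < excess a b x].
Proof.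
pose G i : set T := [set w | K < excess a b (X i w)].
have mG i : measurable (G i).
  have := measurable_preimageT (measurable_funPT (X i)) (@measurable_excess_gt R d a b K).
  exact.
have prG i : pr P (G i) = pr mu [set x | K < excess a b x].
  rewrite /pr; congr fine.
  have := identX i 0%N (@measurable_excess_gt R d a b K).
  by rewrite /distribution /pushforward.
have mU : measurable (\big[setU/set0]_(i <- iota 1 n) G i).
  by rewrite -bigcup_seq; apply: bigcup_measurable.
have hU := @pr_bigU_le _ _ _ P (iota 1 n) G (pr mu [set x | K < excess a b x]) mG.
rewrite size_iota in hU.
apply: (le_trans _ (lerD (lexx _) (hU _))); last by move=> i _; rewrite prG.
have hUU : pr P ([set w | M2 X n w <= 2 * a + s * b] `|`
    \big[setU/set0]_(i <- iota 1 n) G i) <=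
    pr P [set w | M2 X n w <= 2 * a + s * b] +
    pr P (\big[setU/set0]_(i <- iota 1 n) G i).
  by rewrite (prU P (mM n) mU) gerBl pr_ge0.
apply: le_trans hUU; apply: le_pr; [exact: measurable_pair_free|exact: measurableU|].
move=> w hw; have [|nG] := pselect ((\big[setU/set0]_(i <- iota 1 n) G i) w).
  by right.
left; apply/(M2_le _ _ radius_ge0) => i j iI jI ij.
rewrite leNgt; apply/negP => hr; apply: (hw i j iI jI ij).
have small l : l \in iota 1 n -> excess a b (X l w) <= K.
  move=> lI; rewrite leNgt; apply/negP => hl; apply: nG.
  by rewrite -bigcup_seq; exists l.
by split => //=; exact: small.
Qed.

Hypotheses (eps0 : 0 <= eps) (eps1 : 2 * eps <= 1).
Hypotheses (Lam0 : 0 <= Lam) (Lam_small : Lam * b <= a / 2).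
Hypotheses (sK : - Lam <= s - K) (K0 : 0 <= K) (KL : K <= Lam).

(** Far pairs sharing a point have probability at most H / n times p, which is
the bound q of the Poisson approximation. *)
Lemma M2_Poisson n (p := fine ((mu \x mu)%E (far_pair a b s K)))
    (H := (1 + eps) * expR (K - s) *
            angular_laplace d (curvature_lo a b Lam)) :
  (0 < n)%N ->
  (forall q : R, `|q| <= Lam ->
    `|n%:R * pr mu [set x : 'rV[R]_d | q < excess a b x] * expR q - 1| <= eps) ->
  n%:R * p <= 1 ->
  `|pr P [set w | M2 X n w <= 2 * a + s * b] -
     expR (- (p * (n%:R * (n%:R - 1)) / 2))|
    <= n%:R ^+ 3 * (2 * (p ^+ 2 + H / n%:R * p)) + (1 + eps) * expR (- K).
Proof.
move=> n0 tail np.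
have N0 : 0 < n%:R :> R by rewrite ltr0n.
have mF := @measurable_far_pair R d a b s K.
have symF (x y : 'rV[R]_d) : far_pair a b s K (x, y) -> far_pair a b s K (y, x).
  by move=> [/= h1 h2 h3]; split => //=; rewrite -nrmN opprB.
have hq : (((mu \x mu) \x mu) [set z | far_pair a b s K z.1 /\
    far_pair a b s K (z.1.1, z.2)] <= (H / n%:R * p)%:E)%E.
  have := pr_far_chain_le sphX d0 a0 b0 N0 eps0 eps1 Lam0 Lam_small tail sK K0 KL.
  move/le_trans; apply; rewrite [leRHS]EFinM /p fineK//.
  rewrite -(iid_pair_law indepX identX (i := 0%N) (j := 1%N) isT mF).
  by apply: fin_num_measure; exact: (mA 0%N 1%N).
have hP := iid_pair_free_Poisson indepX identX mF symF hq np.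
have h1 := M2_le_pair_free n; have h2 := pair_free_le_M2 n.
have hK : `|K| <= Lam by rewrite ger0_norm.
have h3 := tail_le tail hK.
move: hP h1 h2 h3; rewrite -/p !ler_norml.
move: (pr P _) (pr P _) (expR _) (expR _) (_ * pr mu _) => P1 P2 E1 E2 T1.
by move=> /andP[h1 h2] h3 h4 h5; apply/andP; split; lra.
Qed.

End maximum_distance.

(** * Limits at infinity *)

Section limits.
Context {R : realType}.
Implicit Types f g : R^nat.

Lemma cvg0_bound f g : (\forall n \near \oo, `|f n| <= g n) ->
  g @ \oo --> 0 -> f @ \oo --> 0.
Proof.
move=> fg /cvgr0Pnorm_le g0; apply/cvgr0Pnorm_le => e e0; near=> n.
apply: (@le_trans _ _ (g n)); first by near: n.
by apply: le_trans (ler_norm _) _; near: n; exact: g0.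
Unshelve. all: by end_near. Qed.

Lemma cvgy_inv f : f @ \oo --> +oo -> (fun n => (f n)^-1) @ \oo --> 0.
Proof.
move=> /cvgryPge fy; apply/cvgr0Pnorm_le => e e0; near=> n.
have fn : e^-1 <= f n by near: n; exact: fy.
have f0 : 0 < f n by apply: lt_le_trans fn; rewrite invr_gt0.
rewrite ger0_norm; last by rewrite invr_ge0 ltW.
by rewrite -[leRHS]invrK lef_pV2// posrE// invr_gt0.
Unshelve. all: by end_near. Qed.

Lemma cvgy_expRN n f : f @ \oo --> +oo ->
  (fun m => f m ^+ n * expR (- f m)) @ \oo --> 0.
Proof.
move=> fy; apply: (@cvg0_bound _ (fun m => n.+1`!%:R * (f m)^-1)).
  have /cvgryPge/(_ 1) := fy; apply: filterS => m f1.
  have f0 : 0 < f m by exact: lt_le_trans f1.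
  rewrite ger0_norm; first exact: exprn_expRN_le.
  by apply: mulr_ge0; [apply: exprn_ge0; exact: ltW|exact: expR_ge0].
by rewrite -[X in _ --> X](mulr0 n.+1`!%:R); apply: cvgMl_tmp; exact: cvgy_inv.
Qed.

Lemma cvgy_ln f : f @ \oo --> +oo -> (fun n => ln (f n)) @ \oo --> +oo.
Proof.
move=> /cvgryPge fy; apply/cvgryPge => A; have := fy (expR A); apply: filterS => n fA.
by rewrite -[A]expRK ler_ln ?posrE ?expR_gt0// (lt_le_trans _ fA)// expR_gt0.
Qed.

(** Only the limit of the ratio theta matters, because the decay is that of a
power. *)
Lemma angular_laplace_cvg (k : nat) (rho theta : R^nat) (th : R) :
  rho @ \oo --> +oo -> theta @ \oo --> th -> 0 < th ->
  (fun n => Num.sqrt (rho n) ^+ k * angular_laplace k.+1 (rho n * theta n)) @ \oo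
  --> (Num.sqrt th)^-1 ^+ k *
      (Num.sqrt 2 ^+ k * (gauss_moment k / gauss_moment 0) / 2).
Proof.
move=> rhoy thetath th0; have [A hA] := @angular_laplace_asymptotic R k.
have th2 : th / 2 < th by rewrite ltr_pdivrMr// ltr_pMr// ltr1n.
have th20 : 0 < th / 2 by rewrite divr_gt0.
have near_th : \forall n \near \oo, th / 2 <= theta n by exact: cvgr_ge thetath _ th2.
pose sg n := Num.sqrt (rho n * theta n).
have sgy : sg @ \oo --> +oo.
  apply/cvgryPge => M; move/cvgryPge: rhoy => /(_ (M ^+ 2 / (th / 2))) rhoM.
  near=> n.
  have h1 : th / 2 <= theta n by near: n.
  have h2 : M ^+ 2 / (th / 2) <= rho n by near: n.
  apply: le_trans (ler_norm M) _; rewrite -sqrtr_sqr; apply: ler_wsqrtr.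
  have -> : M ^+ 2 = M ^+ 2 / (th / 2) * (th / 2) by rewrite divfK// gt_eqF.
  apply: ler_pM => //; last exact: ltW.
  by rewrite divr_ge0 ?sqr_ge0// ltW.
have lim2 : (fun n => sg n ^+ k * angular_laplace k.+1 (sg n ^+ 2)) @ \oo -->
    Num.sqrt 2 ^+ k * (gauss_moment k / gauss_moment 0) / 2.
  apply/cvgrPdistC_le => e e0.
  have sg0 : (fun n => A * (sg n)^-1) @ \oo --> 0.
    by rewrite -[X in _ --> X](mulr0 A); apply: cvgMl_tmp; exact: cvgy_inv.
  move/cvgr0Pnorm_le: sg0 => /(_ e e0) sge; move/cvgryPge: sgy => /(_ 1) sg1.
  near=> n; apply: (@le_trans _ _ (A / sg n)).
    by apply: hA; near: n.
  by apply: le_trans (ler_norm _) _; near: n.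
have lim1 : (fun n => (Num.sqrt (theta n))^-1 ^+ k) @ \oo --> (Num.sqrt th)^-1 ^+ k.
  have lim0 : (fun n => (Num.sqrt (theta n))^-1) @ \oo --> (Num.sqrt th)^-1.
    apply: cvgV; first by rewrite gt_eqF// sqrtr_gt0.
    by apply: continuous_cvg => //; exact: sqrt_continuous.
  exact: (continuous_cvg _ (@exprn_continuous R k _) lim0).
apply: cvg_trans (cvgM lim1 lim2); apply: near_eq_cvg.
move/cvgryPge: rhoy => /(_ 0) rho0; near=> n => /=.
have h1 : th / 2 <= theta n by near: n.
have h2 : 0 <= rho n by near: n.
have t0 : 0 < theta n by apply: lt_le_trans h1.
rewrite /sg sqr_sqrtr ?mulr_ge0 ?(ltW t0)//.
rewrite mulrA -exprMn_comm; last exact: mulrC.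
rewrite sqrtrM// [Num.sqrt (rho n) * _]mulrC mulrA mulVf ?mul1r//.
by rewrite gt_eqF// sqrtr_gt0.
Unshelve. all: by end_near. Qed.

End limits.

(** * Limits of the parameters *)

Section parameters.
Context {R : realType}.
Variables (k : nat) (c x : R).

(** These are functions of r = a / b: the range of the excesses for which the tail
is known, the truncation of the excesses, the rescaled radius corresponding to
the value x of the normalized maximum, and the curvatures relative to r. *)
Definition fluctuation (r : R) : R := k%:R / 2 * ln r.
Definition truncation (r : R) : R := ln (ln r) / 2.
Definition level (r : R) : R := x - fluctuation r + ln (ln r) + ln c.
Definition relative_lo (r : R) : R :=
  (1 - fluctuation r / r) ^+ 2 / (1 + fluctuation r / r) / 2.
Definition relative_hi (r : R) : R :=
  (1 + fluctuation r / r) ^+ 2 / (1 - fluctuation r / r) / 2.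

Let g : R := Num.sqrt 2 ^+ k * (gauss_moment k / gauss_moment 0) / 2.
Hypotheses (k0 : (0 < k)%N) (c0 : 0 < c).
Hypothesis c_eq : (Num.sqrt 2^-1)^-1 ^+ k * g * (k%:R / 2) = 2 * c.

Variables (rho eps : R^nat).
Hypotheses (rhoy : rho @ \oo --> +oo) (epsl : eps @ \oo --> 0).

Let L n := ln (rho n).
Let lam n := ln (L n).
Let Ly : L @ \oo --> +oo. Proof. exact: cvgy_ln. Qed.
Let lamy : lam @ \oo --> +oo. Proof. exact: cvgy_ln. Qed.
Let iL0 : (fun n => (L n)^-1) @ \oo --> 0. Proof. exact: cvgy_inv. Qed.

Let near_pos : \forall n \near \oo, 0 < rho n /\ 0 < L n /\ 0 < lam n.
Proof.
near=> n; split; [|split]; apply: (@lt_le_trans _ _ 1) => //; near: n.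
- by move/cvgryPge: rhoy; apply.
- by move/cvgryPge: Ly; apply.
- by move/cvgryPge: lamy; apply.
Unshelve. all: by end_near. Qed.

Let lamL : (fun n => lam n / L n) @ \oo --> 0.
Proof.
apply: cvg_trans (cvgy_expRN 1 lamy); apply: near_eq_cvg.
apply: filterS near_pos => n [_ [L0 _]].
by rewrite expr1 expRN /lam lnK.
Qed.

Let z0 : (fun n => fluctuation (rho n) / rho n) @ \oo --> 0.
Proof.
have h := cvgy_expRN 1 Ly.
have : (fun n => k%:R / 2 * (L n ^+ 1 * expR (- L n))) @ \oo --> (k%:R / 2 * 0 : R).
  exact: cvgMl_tmp h.
rewrite mulr0; apply: cvg_trans; apply: near_eq_cvg.
apply: filterS near_pos => n [r0 _].
by rewrite expr1 expRN /L lnK// /fluctuation mulrA.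
Qed.

Let c1z : (fun n => 1 - fluctuation (rho n) / rho n) @ \oo --> (1 : R).
Proof.
by rewrite -[X in _ --> X]subr0; apply: cvgB; [exact: cvg_cst|exact: z0].
Qed.

Let c2z : (fun n => 1 + fluctuation (rho n) / rho n) @ \oo --> (1 : R).
Proof.
by rewrite -[X in _ --> X]addr0; apply: cvgD; [exact: cvg_cst|exact: z0].
Qed.

Let ratio_cvg f h : f @ \oo --> (1 : R) -> h @ \oo --> (1 : R) ->
  (fun n => f n ^+ 2 / h n / 2) @ \oo --> (2^-1 : R).
Proof.
move=> f1 h1.
have : (fun n => f n * f n * (h n)^-1 * 2^-1) @ \oo --> (1 * 1 * 1^-1 * 2^-1 : R).
  apply: cvgM; last exact: cvg_cst.
  by apply: cvgM; [exact: cvgM|apply: cvgV => //; exact: oner_neq0].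
by rewrite invr1 !mul1r.
Qed.

Let lo_cvg : (fun n => relative_lo (rho n)) @ \oo --> (2^-1 : R).
Proof. exact: ratio_cvg. Qed.

Let hi_cvg : (fun n => relative_hi (rho n)) @ \oo --> (2^-1 : R).
Proof. exact: ratio_cvg. Qed.

Let sqrt_powE n : 0 < rho n -> expR (fluctuation (rho n)) = Num.sqrt (rho n) ^+ k.
Proof.
move=> r0; have -> : Num.sqrt (rho n) = expR (L n / 2).
  rewrite -[rho n]lnK ?posrE// -/(L n).
  have -> : expR (L n) = expR (L n / 2) ^+ 2 by rewrite -expRM_natl; congr expR; field.
  by rewrite sqrtr_sqr ger0_norm// expR_ge0.
by rewrite -expRM_natl /fluctuation -/(L n); congr expR; field.
Qed.

Let levelE n : 0 < rho n -> 0 < L n ->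
  expR (- level (rho n)) * L n = expR (- x) / c * Num.sqrt (rho n) ^+ k.
Proof.
move=> r0 L0; rewrite -sqrt_powE//.
have -> : - level (rho n) = - x + fluctuation (rho n) - lam n - ln c.
  by rewrite /level /lam /L; ring.
rewrite !expRD !(expRN (ln c)) (expRN (lam n)) /lam !lnK//.
move: (expR _) (expR _) L0 => E1 E2 L0.
by move: (L n) L0 => l l0; field; rewrite !gt_eqF.
Qed.

Let weight (theta : R^nat) (th : R) : theta @ \oo --> th -> 0 < th ->
  (fun n => expR (- level (rho n)) * L n * angular_laplace k.+1 (rho n * theta n))
    @ \oo --> expR (- x) / c * ((Num.sqrt th)^-1 ^+ k * g).
Proof.
move=> tht th0; have := @angular_laplace_cvg R k _ _ _ rhoy tht th0.
move=> /(cvgMl_tmp (a := expR (- x) / c)); apply: cvg_trans; apply: near_eq_cvg.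
by apply: filterS near_pos => n [r0 [L0 _]]; rewrite levelE// mulrA.
Qed.

Let g0 : 0 < g.
Proof.
rewrite /g; apply: divr_gt0 => //; apply: mulr_gt0.
  by rewrite exprn_gt0// sqrtr_gt0.
by rewrite divr_gt0// gauss_moment_gt0.
Qed.

Let wlim : expR (- x) / c * ((Num.sqrt 2^-1)^-1 ^+ k * g) * (k%:R / 2) =
  2 * expR (- x).
Proof.
by rewrite -mulrA c_eq; move: (expR _) => E; field; rewrite gt_eqF.
Qed.

Let slope : (fun n => - level (rho n) / L n) @ \oo --> (k%:R / 2 : R).
Proof.
have : (fun n => k%:R / 2 - lam n / L n - (x + ln c) * (L n)^-1) @ \oo -->
    (k%:R / 2 - 0 - (x + ln c) * 0 : R).
  apply: cvgB; last exact: cvgMl_tmp.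
  by apply: cvgB => //; exact: cvg_cst.
rewrite mulr0 !subr0; apply: cvg_trans; apply: near_eq_cvg.
apply: filterS near_pos => n [r0 [L0 _]].
rewrite /level /fluctuation -/(L n) -/(lam n).
by move: (L n) (lam n) (ln c) L0 => l la lc l0; field; rewrite gt_eqF.
Qed.

Let onep : (fun n => 1 + eps n) @ \oo --> (1 : R).
Proof. by rewrite -[X in _ --> X]addr0; apply: cvgD => //; exact: cvg_cst. Qed.

Let onem : (fun n => 1 - eps n) @ \oo --> (1 : R).
Proof. by rewrite -[X in _ --> X]subr0; apply: cvgB => //; exact: cvg_cst. Qed.

Let truncy : (fun n => truncation (rho n)) @ \oo --> +oo.
Proof.
apply/cvgryPge => A; move/cvgryPge: lamy => /(_ (2 * A)); apply: filterS => n.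
by rewrite /truncation -/(L n) -/(lam n); lra.
Qed.

Lemma expRN_truncation_cvg : (fun n => expR (- truncation (rho n))) @ \oo --> 0.
Proof. by have := cvgy_expRN 0 truncy; under eq_fun do rewrite expr0 mul1r. Qed.

Let expRN_half_truncation : (fun n => expR (- (truncation (rho n) / 2))) @ \oo --> 0.
Proof.
have h : (fun n => truncation (rho n) / 2) @ \oo --> +oo.
  apply/cvgryPge => A; move/cvgryPge: truncy => /(_ (2 * A)); apply: filterS => n.
  by lra.
by have := cvgy_expRN 0 h; under eq_fun do rewrite expr0 mul1r.
Qed.

(** In the product, exp (- level) contributes r^(k/2) / ln r, the Laplace transform
r^(- k/2) and the range of the excesses ln r. *)
Lemma mean_upper_cvg :
  (fun n => (1 + eps n) ^+ 2 * expR (- level (rho n)) *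
     angular_laplace k.+1 (rho n * relative_lo (rho n)) *
     (1 + (2 * truncation (rho n) - level (rho n)))) @ \oo --> (2 * expR (- x) : R).
Proof.
have h2 : 0 < 2^-1 :> R by [].
have w := weight lo_cvg h2.
have t : (fun n => - level (rho n) / L n + (L n)^-1 + lam n / L n) @ \oo -->
    (k%:R / 2 + 0 + 0 : R).
  by apply: cvgD => //; exact: cvgD.
have := cvgM (cvgM (cvgM onep onep) w) t.
rewrite !addr0 !mul1r wlim => h; apply: cvg_trans (h _ _ _); apply: near_eq_cvg.
apply: filterS near_pos => n [r0 [L0 _]] /=.
rewrite /truncation -/(L n) -/(lam n).
move: (lam n) (L n) (level _) L0 (expR _) (angular_laplace _ _) => *.
by field; rewrite gt_eqF.
Qed.

Let lower_factor n := (1 - eps n) * angular_laplace k.+1 (rho n * relative_hi (rho n)) -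
  2 * expR (- (truncation (rho n) / 2)) *
  angular_laplace k.+1 (rho n * relative_hi (rho n) / 2).

Let lower_factor_cvg : (fun n => expR (- level (rho n)) * L n * lower_factor n) @ \oo -->
  expR (- x) / c * ((Num.sqrt 2^-1)^-1 ^+ k * g).
Proof.
have h2 : 0 < 2^-1 :> R by [].
have h4 : 0 < 2^-1 * 2^-1 :> R by rewrite mulr_gt0.
have w := weight hi_cvg h2.
have hi2 : (fun n => relative_hi (rho n) / 2) @ \oo --> (2^-1 * 2^-1 : R).
  by apply: cvgM => //; exact: cvg_cst.
have w2 := weight hi2 h4.
have := cvgB (cvgM onem w) (cvgM (cvgMl_tmp (a := 2) expRN_half_truncation) w2).
rewrite mulr0 mul0r subr0 mul1r => h; apply: cvg_trans (h _ _ _ _); apply: near_eq_cvg.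
apply: nearW => n; rewrite /lower_factor.
transitivity ((1 - eps n) * (expR (- level (rho n)) * L n *
    angular_laplace k.+1 (rho n * relative_hi (rho n))) -
  2 * expR (- (truncation (rho n) / 2)) * (expR (- level (rho n)) * L n *
    angular_laplace k.+1 (rho n * (relative_hi (rho n) / 2)))); first by [].
rewrite (mulrA (rho n) (relative_hi (rho n)) 2^-1).
move: (angular_laplace _ _) (angular_laplace _ _) (expR _) (expR _) => *.
by ring.
Qed.

Lemma mean_lower_cvg :
  (fun n => expR (- level (rho n)) * lower_factor n *
     ((1 - eps n) * (- level (rho n)) - (1 + eps n))) @ \oo --> (2 * expR (- x) : R).
Proof.
have t : (fun n => (1 - eps n) * (- level (rho n) / L n) - (1 + eps n) * (L n)^-1)
    @ \oo --> (1 * (k%:R / 2) - 1 * 0 : R).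
  by apply: cvgB; exact: cvgM.
have := cvgM lower_factor_cvg t.
rewrite mulr0 subr0 mul1r wlim => h; apply: cvg_trans (h _); apply: near_eq_cvg.
apply: filterS near_pos => n [r0 [L0 _]] /=.
move: (L n) (level _) L0 (expR _) (lower_factor _) => *.
by field; rewrite gt_eqF.
Qed.

Lemma lower_factor_ge0 : \forall n \near \oo, 0 <= lower_factor n.
Proof.
have w0 : 0 < expR (- x) / c * ((Num.sqrt 2^-1)^-1 ^+ k * g).
  apply: mulr_gt0; first by rewrite divr_gt0// expR_gt0.
  apply: mulr_gt0; last exact: g0.
  by apply: exprn_gt0; rewrite invr_gt0 sqrtr_gt0 invr_gt0.
have h := @cvgr_ge _ _ \oo _ _ _ lower_factor_cvg _ w0.
apply: filterS2 near_pos (h _) => n [r0 [L0 _]].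
by rewrite pmulr_rge0// mulr_gt0// expR_gt0.
Qed.

(** Compared with the mean, the factor exp (truncation), of order (ln r)^(1/2),
replaces the length of the range of excesses, of order ln r. *)
Lemma section_bound_cvg :
  (fun n => (1 + eps n) * expR (truncation (rho n) - level (rho n)) *
     angular_laplace k.+1 (rho n * relative_lo (rho n))) @ \oo --> 0.
Proof.
have h2 : 0 < 2^-1 :> R by [].
have w := weight lo_cvg h2.
have := cvgM (cvgM onep w) expRN_truncation_cvg.
rewrite mulr0 => h; apply: cvg_trans (h _ _); apply: near_eq_cvg.
apply: filterS near_pos => n [r0 [L0 _]] /=.
have -> : L n = expR (truncation (rho n)) ^+ 2.
  rewrite -expRM_natl (_ : 2%:R * truncation (rho n) = lam n); last first.
    by rewrite /truncation -/(L n) -/(lam n); field.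
  by rewrite /lam lnK.
rewrite expRD (expRN (truncation _)); have := expR_gt0 (truncation (rho n)).
move: (angular_laplace _ _) (expR (- level _)) (expR _) => A E F F0.
by field; rewrite gt_eqF.
Qed.

Lemma parameters_admissible : \forall n \near \oo,
  [/\ 0 <= fluctuation (rho n), fluctuation (rho n) / rho n <= 1 / 2,
      level (rho n) <= 0,
      - fluctuation (rho n) <= level (rho n) - truncation (rho n) &
      0 <= truncation (rho n) /\ truncation (rho n) <= fluctuation (rho n)].
Proof.
have k0' : 0 < k%:R / 2 :> R by rewrite divr_gt0// ltr0n.
have half : 0 < 1 / 2 :> R by rewrite divr_gt0.
have hz := @cvgr_le _ _ \oo _ _ _ z0 _ half.
have hs := @cvgr_ge _ _ \oo _ _ _ slope _ k0'.
have k1 : 0 < k%:R :> R by rewrite ltr0n.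
have hl := @cvgr_le _ _ \oo _ _ _ lamL _ k1.
move/cvgryPge: lamy => /(_ (- 2 * (x + ln c))) hlam.
apply: filterS2 (filterI near_pos (filterI (hz _) (hs _))) (filterI (hl _) hlam).
move=> n [[r0 [L0 lam0]] [hzn hsn]] [hln hlamn].
rewrite /truncation -/(L n) -/(lam n); split.
- by rewrite /fluctuation -/(L n) mulr_ge0// ltW.
- exact: hzn.
- by move: hsn; rewrite pmulr_lge0 ?invr_gt0// oppr_ge0.
- rewrite /level -/(L n) -/(lam n); move: hlamn; lra.
- split; first by rewrite divr_ge0// ltW.
  move: hln; rewrite ler_pdivrMr// /fluctuation -/(L n); move: (L n) (lam n).
  by move=> *; lra.
Qed.

End parameters.

(** * The normalizing constant and the uniform tail *)

Lemma normalizing_constant {R : realType} (k : nat) : (0 < k)%N ->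
  0 < c_ R k.+1 /\
  (Num.sqrt 2^-1)^-1 ^+ k *
    (Num.sqrt 2 ^+ k * (gauss_moment k / gauss_moment 0) / 2) * (k%:R / 2) =
  2 * c_ R k.+1.
Proof.
move=> k0.
have pi0 : 0 < Num.sqrt (pi : R) by rewrite sqrtr_gt0 pi_gt0.
have gk0 := @gauss_moment_gt0 R k.
have k0' : 0 < k%:R :> R by rewrite ltr0n.
have two : (2 : R) != 0 by [].
have t0 : 0 < (2 : R) ^ (k.+1%:Z - 4) by rewrite exprz_gt0.
have tE : (2 : R) ^ (k.+1%:Z - 4) * 8 = 2 ^+ k.
  have -> : (8 : R) = 2 ^ (3 : int) by rewrite -exprnP; ring.
  rewrite -expfzDr// (_ : k.+1%:Z - 4 + 3 = k%:Z) ?exprnP//.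
  by rewrite -addn1 PoszD; ring.
have cE : c_ R k.+1 = k%:R * 2 ^ (k.+1%:Z - 4) * (2 * gauss_moment k) / Num.sqrt pi.
  rewrite /c_ Gamma_half ?ltnS//= (_ : k.+1%:R - 1 = k%:R)//.
  by rewrite -natr1 addrK.
split.
  by rewrite cE divr_gt0// !mulr_gt0.
have ss : Num.sqrt (2 : R) ^+ k * Num.sqrt 2 ^+ k = 2 ^ (k.+1%:Z - 4) * 8.
  by rewrite tE -expr2 -exprM mulnC exprM sqr_sqrtr.
rewrite cE sqrtrV// invrK gauss_moment0; move: ss.
move: (2 ^ _) (Num.sqrt 2 ^+ k) (gauss_moment k) (Num.sqrt pi) pi0 (k%:R).
move=> E S g sp sp0 kk ss; rewrite (mulrA S) (mulrA S) ss.
by field; rewrite gt_eqF.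
Qed.

(** Were the deviations not uniformly small, a sequence of bad values of q would
contradict the hypothesis. *)
Lemma uniform_tail {R : realType} (Tail : nat -> R -> R) (Lam : R^nat) :
  (\forall n \near \oo, 0 <= Lam n) ->
  (forall t : nat -> R, (\forall n \near \oo, `|t n| <= Lam n) ->
    (fun n => Tail n (t n)) ~_\oo (fun n => n%:R^-1 * expR (- t n))) ->
  exists2 eps : R^nat, eps @ \oo --> 0 &
    \forall n \near \oo, 0 <= eps n /\
      forall q, `|q| <= Lam n -> `|n%:R * Tail n q * expR q - 1| <= eps n.
Proof.
move=> Lam0 tail.
pose dev n q := `|n%:R * Tail n q * expR q - 1|.
have unif e : 0 < e -> \forall n \near \oo, forall q, `|q| <= Lam n -> dev n q <= e.
  move=> e0.
  have [t ht] : {t : nat -> R & forall n, (`|t n| <= Lam n /\ e < dev n (t n)) \/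
      (t n = 0 /\ forall q, `|q| <= Lam n -> dev n q <= e)}.
    apply: (@choice _ _ (fun n q => (`|q| <= Lam n /\ e < dev n q) \/
      (q = 0 /\ forall q, `|q| <= Lam n -> dev n q <= e))) => n.
    have [[q hq]|nh] := pselect (exists q, `|q| <= Lam n /\ e < dev n q).
      by exists q; left.
    exists 0; right; split => // q qL; rewrite leNgt; apply/negP => h.
    by apply: nh; exists q.
  have tL : \forall n \near \oo, `|t n| <= Lam n.
    apply: filterS Lam0 => n L0.
    by have [[]//|[-> _]] := ht n; rewrite normr0.
  have /eqaddoP/(_ e e0) := tail t tL.
  have n1 : \forall n \near \oo, (0 < n)%N by exists 1%N.
  apply: filterS2 n1 => n n0 /= hn q qL.
  have [[_ bad]|[_ good]] := ht n; last exact: good.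
  exfalso; move: bad; rewrite ltNge => /negP; apply; rewrite /dev.
  have n0' : 0 < n%:R :> R by rewrite ltr0n.
  have E0 := expR_gt0 (t n).
  rewrite [X in X <= _](_ : _ = n%:R * expR (t n) *
      `|Tail n (t n) - n%:R^-1 * expR (- t n)|).
    rewrite mulrC -ler_pdivlMr ?mulr_gt0//.
    apply: le_trans hn _; rewrite normrM !gtr0_norm ?invr_gt0 ?expR_gt0//.
    by rewrite expRN invfM.
  rewrite -[in RHS](@gtr0_norm _ (n%:R * expR (t n))) ?mulr_gt0//.
  rewrite -normrM; congr (`|_|); rewrite expRN.
  by move: (Tail _ _) (expR _) E0 => F E E0; field; rewrite !gt_eqF.
pose S n := [set e | exists2 q, `|q| <= Lam n & e = dev n q].
exists (fun n => sup (S n)).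
  apply/cvgr0Pnorm_le => e e0; apply: filterS2 (unif e e0) Lam0 => n hn L0.
  have S0 : S n (dev n 0) by exists 0 => //; rewrite normr0.
  have Sub : ubound (S n) e by move=> _ [q qL ->]; exact: hn.
  rewrite ger0_norm; first by apply: ge_sup => //; exists (dev n 0).
  apply: le_trans (ub_le_sup _ S0); first exact: normr_ge0.
  by exists e.
apply: filterS2 (unif 1 ltr01) Lam0 => n hn L0.
have S0 : S n (dev n 0) by exists 0 => //; rewrite normr0.
have Sub : has_ubound (S n) by exists 1 => _ [q qL ->]; exact: hn.
split.
  by apply: le_trans (ub_le_sup Sub S0); exact: normr_ge0.
by move=> q qL; apply: ub_le_sup => //; exists q.
Qed.

(** * Convergence of the distribution functions *)

(** With n^2 p convergent, n^3 p^2 is of order 1 / n and n^3 (H / n) p of order H. *)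
Lemma Poisson_limit {R : realType} (M p H kt : R^nat) (m : R) :
  (fun n => n%:R ^+ 2 * p n) @ \oo --> 2 * m -> H @ \oo --> 0 -> kt @ \oo --> 0 ->
  (\forall n \near \oo, `|M n - expR (- (p n * (n%:R * (n%:R - 1)) / 2))| <=
    n%:R ^+ 3 * (2 * (p n ^+ 2 + H n / n%:R * p n)) + kt n) ->
  M @ \oo --> expR (- m).
Proof.
move=> ym H0 kt0 hM; pose y n := n%:R ^+ 2 * p n.
have in0 : (fun n => (n%:R : R)^-1) @ \oo --> 0.
  by apply: cvgy_inv; apply/cvgryPge => A; exact: nbhs_infty_ger.
have n1 : \forall n \near \oo, (0 < n)%N by exists 1%N.
have c1 : (fun n => 1 - (n%:R : R)^-1) @ \oo --> (1 - 0 : R).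
  by apply: cvgB; [exact: cvg_cst|exact: in0].
have mean : (fun n => y n * (1 - n%:R^-1) * 2^-1) @ \oo --> (2 * m * (1 - 0) * 2^-1 : R).
  by apply: cvgM; [exact: cvgM|exact: cvg_cst].
have expl : (fun n => expR (- (y n * (1 - n%:R^-1) * 2^-1))) @ \oo --> expR (- m).
  have h : (fun n => - (y n * (1 - n%:R^-1) * 2^-1)) @ \oo --> - m.
    rewrite (_ : m = 2 * m * (1 - 0) * 2^-1); first exact: cvgN.
    by rewrite subr0 mulr1 mulrAC mulfV// mul1r.
  exact: (continuous_cvg _ (@continuous_expR R _) h).
have err : (fun n => 2 * (y n * y n * n%:R^-1) + 2 * (H n * y n) + kt n) @ \oo -->
    (2 * (2 * m * (2 * m) * 0) + 2 * (0 * (2 * m)) + 0 : R).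
  apply: cvgD => //; apply: cvgD; apply: cvgMl_tmp; last exact: cvgM.
  by apply: cvgM => //; exact: cvgM.
rewrite !(mulr0, mul0r, addr0) in err.
have diff : (fun n => M n - expR (- (y n * (1 - n%:R^-1) * 2^-1))) @ \oo --> 0.
  apply: cvg0_bound err; apply: filterS2 hM n1 => n hn n0.
  have N0 : n%:R != 0 :> R by rewrite pnatr_eq0 -lt0n.
  have e1 : p n * (n%:R * (n%:R - 1)) / 2 = y n * (1 - n%:R^-1) * 2^-1.
    by rewrite /y; move: (p n) (n%:R : R) N0 => P N N0; field.
  have e2 : n%:R ^+ 3 * (2 * (p n ^+ 2 + H n / n%:R * p n)) + kt n =
      2 * (y n * y n * n%:R^-1) + 2 * (H n * y n) + kt n.
    by rewrite /y; move: (p n) (n%:R : R) N0 => P N N0; field.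
  by move: hn; rewrite e1 e2.
have := cvgD diff expl; rewrite add0r => h; apply: cvg_trans (h _).
by apply: near_eq_cvg; apply: nearW => n /=; rewrite subrK.
Qed.

Lemma cvg_ratio {R : realType} (a b : R^nat) :
  (\forall n \near \oo, 0 < a n) -> (\forall n \near \oo, 0 < b n) ->
  b =o_\oo a -> (fun n => a n / b n) @ \oo --> +oo.
Proof.
move=> a0 b0 /eqoP ba; apply/cvgryPge => A.
have M0 : 0 < `|A| + 1 by rewrite ltr_wpDl.
have h := ba _ (ltac:(by rewrite invr_gt0; exact: M0) : 0 < (`|A| + 1)^-1).
apply: filterS2 (filterI a0 b0) h => n [an bn] /=.
rewrite (gtr0_norm an) (gtr0_norm bn) => hn; rewrite ler_pdivlMr//.
apply: (@le_trans _ _ ((`|A| + 1) * b n)).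
  by rewrite ler_pM2r// (le_trans (ler_norm A))// lerDl.
by rewrite mulrC -ler_pdivlMr// mulrC.
Qed.

Section curvature.
Context {R : realType} (k : nat) (a b : R).
Hypotheses (a0 : 0 < a) (b0 : 0 < b).

Let ratioE (z : R) : z * b / a = z / (a / b).
Proof. by rewrite invf_div mulrA. Qed.

Let halfE (u v : R) : u / v * (a / (2 * b)) = a / b * (u / v / 2).
Proof. by move: (u / v) => z; field; rewrite gt_eqF. Qed.

Lemma curvature_lo_relative : curvature_lo a b (fluctuation k (a / b)) =
  a / b * relative_lo k (a / b).
Proof. by rewrite /curvature_lo /relative_lo ratioE halfE. Qed.

Lemma curvature_hi_relative : curvature_hi a b (fluctuation k (a / b)) =
  a / b * relative_hi k (a / b).
Proof. by rewrite /curvature_hi /relative_hi ratioE halfE. Qed.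

Lemma excess_gtE d q : [set x : 'rV[R]_d | q < excess a b x] =
  [set x | a + q * b < euclidean_norm x].
Proof.
by apply/seteqP; split => x; rewrite /excess /= ltr_pdivlMr// ltrBrDl.
Qed.

End curvature.

Section main.
Context {disp : measure_display} {T : measurableType disp} {R : realType}.
Variables (P : probability T R) (k : nat) (X : nat -> {RV P >-> 'rV[R]_k.+1}).
Hypotheses (k0 : (0 < k)%N) (indepX : mutually_independent P X).
Hypothesis identX : identically_distributed P X.
Hypothesis sphX : spherically_symmetric (distribution P (X 0%N)).
Variables a b : R^nat.
Hypotheses (a0 : \forall n \near \oo, 0 < a n) (b0 : \forall n \near \oo, 0 < b n).
Hypothesis ba : b =o_\oo a.
Local Notation mu := (distribution P (X 0%N)).
Local Notation rho := (fun n => a n / b n).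
Local Notation Lam n := (fluctuation k (a n / b n)).
Local Notation K n := (truncation (a n / b n)).
Hypothesis tail : forall t : nat -> R, (\forall n \near \oo, `|t n| <= Lam n) ->
  (fun n => pr mu [set x | t n < excess (a n) (b n) x])
    ~_\oo (fun n => n%:R^-1 * expR (- t n)).
Variable x : R.
Local Notation c := (c_ R k.+1).
Local Notation s n := (level k c x (a n / b n)).

Lemma M2_level_cvg :
  (fun n => pr P [set w | M2 X n w <= 2 * a n + s n * b n]) @ \oo -->
  expR (- expR (- x)).
Proof.
have rhoy : rho @ \oo --> +oo by exact: cvg_ratio.
have [c0 c_eq] := @normalizing_constant R k k0.
have adm := parameters_admissible c x k0 rhoy.
have L0 : \forall n \near \oo, 0 <= Lam n by apply: filterS adm => n [].
have [eps eps0 unif] := @uniform_tail R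
  (fun n q => pr mu [set y | q < excess (a n) (b n) y]) _ L0 tail.
have eps1 : \forall n \near \oo, 2 * eps n <= 1.
  move/cvgr0Pnorm_le: eps0 => /(_ 2^-1 (ltac:(by []) : 0 < 2^-1 :> R)).
  apply: filterS => n /(le_trans (ler_norm _)) h.
  by rewrite mulrC -ler_pdivlMr// mul1r.
have n1 : \forall n \near \oo, (0 < n)%N by exists 1%N.
pose p n := fine ((mu \x mu)%E (far_pair (a n) (b n) (s n) (K n))).
have pE n : ((mu \x mu)%E (far_pair (a n) (b n) (s n) (K n)) = (p n)%:E)%E.
  have mF := @measurable_far_pair R k.+1 (a n) (b n) (s n) (K n).
  have mY : measurable_fun setT (fun w => (X 0%N w, X 1%N w)).
    exact: measurable_fun_pair.
  rewrite /p fineK// -(iid_pair_law indepX identX (i := 0%N) (j := 1%N) isT mF).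
  by apply: fin_num_measure; exact: measurable_preimageT mY mF.
have low := mean_lower_cvg (x := x) c0 c_eq rhoy eps0.
have low0 := lower_factor_ge0 k x c0 rhoy eps0.
have up := mean_upper_cvg (x := x) c0 c_eq rhoy eps0.
have ylim : (fun n => n%:R ^+ 2 * p n) @ \oo --> 2 * expR (- x).
  apply: squeeze_cvgr low up.
  apply: filterS2 (filterI (filterI adm unif) (filterI eps1 n1))
    (filterI low0 (filterI a0 b0)).
  move=> n [[[A1 A2 A3 A4 [A5 A6]] [e0 tl]] [e1 n0]] [l0 [an bn]].
  have N0 : 0 < n%:R :> R by rewrite ltr0n.
  have N2 : 0 < n%:R ^+ 2 :> R by rewrite exprn_gt0.
  have Ls : Lam n * b n <= a n / 2.
    move: A2; rewrite ler_pdivrMr ?divr_gt0// => A2.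
    by rewrite -ler_pdivlMr//; apply: le_trans A2 _; rewrite le_eqVlt mul1r mulrAC mulrC eqxx.
  have lo := pr_far_pair_ge sphX (isT : (0 < k.+1)%N) an bn N0 e0 e1 A1 Ls tl A3 A4 A5 A6.
  have hi := pr_far_pair_le sphX (isT : (0 < k.+1)%N) an bn N0 e0 e1 A1 Ls tl A3 A4 A5 A6.
  rewrite pE (curvature_lo_relative k (a n) bn) lee_fin ler_pdivlMr// in hi.
  rewrite pE (curvature_hi_relative k (a n) bn) in lo.
  have := lo l0; rewrite lee_fin ler_pdivrMr// => lo'.
  by rewrite (mulrC (n%:R ^+ 2)) lo' hi.
have Hlim := section_bound_cvg k x c0 rhoy eps0.
have Klim : (fun n => (1 + eps n) * expR (- K n)) @ \oo --> 0.
  have e1 : (fun n => 1 + eps n) @ \oo --> (1 + 0 : R).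
    by apply: cvgD => //; exact: cvg_cst.
  have := cvgM e1 (expRN_truncation_cvg rhoy).
  by rewrite mulr0 => h; exact: h.
apply: (Poisson_limit ylim Hlim Klim).
have np1 : \forall n \near \oo, n%:R * p n <= 1.
  have in0 : (fun n => (n%:R : R)^-1) @ \oo --> 0.
    by apply: cvgy_inv; apply/cvgryPge => A; exact: nbhs_infty_ger.
  have := cvgM in0 ylim; rewrite mul0r => h.
  have h0 : (fun n => n%:R^-1 * (n%:R ^+ 2 * p n)) @ \oo --> (0 : R) by exact: h.
  move/cvgr0Pnorm_le: h0 => /(_ 1 ltr01).
  apply: filterS2 n1 => n n0 /(le_trans (ler_norm _)) /=.
  by rewrite expr2 -mulrA mulKf// pnatr_eq0 -lt0n.
apply: filterS2 (filterI (filterI adm unif) (filterI eps1 n1))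
    (filterI np1 (filterI a0 b0)).
move=> n [[[A1 A2 A3 A4 [A5 A6]] [e0 tl]] [e1 n0]] [np [an bn]].
have Ls : Lam n * b n <= a n / 2.
  move: A2; rewrite ler_pdivrMr ?divr_gt0// => A2.
  by rewrite -ler_pdivlMr//; apply: le_trans A2 _; rewrite le_eqVlt mul1r mulrAC mulrC eqxx.
have r0 : 0 <= 2 * a n + s n * b n.
  have : - Lam n * b n <= s n * b n.
    by rewrite ler_pM2r//; move: A4 A5; lra.
  by move: Ls an; lra.
have := @M2_Poisson _ _ _ _ P X indepX identX sphX (isT : (0 < k.+1)%N)
  (a n) (b n) (eps n) (Lam n) (s n) (K n).
rewrite -(curvature_lo_relative k (a n) bn).
by apply.
Qed.

End main.

(** * The limit theorem *)

Theorem theorem1p1 (R : realType) (d : nat) (hd : (2 <= d)%N)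
    (disp : measure_display) (T : measurableType disp) (P : probability T R)
    (X : nat -> {RV P >-> 'rV[R]_d})
    (X_independent : mutually_independent P X)
    (X_identically_distributed : identically_distributed P X)
    (X_symmetric : spherically_symmetric (distribution P (X 0%N)))
    (a b : nat -> R)
    (a_gt0 : forall n, (0 < n)%N -> 0 < a n)
    (b_gt0 : forall n, (0 < n)%N -> 0 < b n)
    (b_o_a : b =o_\oo a)
    (tail : forall t : nat -> R,
      (\forall n \near \oo,
         `|t n| <= (d%:R - 1) / 2 * ln (a n / b n)) ->
      (fun n => fine (P [set w | a n + t n * b n < euclidean_norm (X 0%N w)]))
        ~_\oo (fun n => n%:R^-1 * expR (- t n)))
    (disp' : measure_display) (T' : measurableType disp')
    (P' : probability T' R) (V : {RV P' >-> R}) (V_gumbel : gumbel P' V) :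
  converges_in_distribution P P' (fun n => normalized_M2 X a b n) V.
Proof.
case: d hd X X_independent X_identically_distributed X_symmetric tail =>
  [//|k] hd X indepX identX sphX tail.
have k0 : (0 < k)%N by [].
have kE : k.+1%:R - 1 = k%:R :> R by rewrite -natr1 addrK.
have n1 : \forall n \near \oo, (0 < n)%N by exists 1%N.
have a_near : \forall n \near \oo, 0 < a n by apply: filterS n1 => n /a_gt0.
have b_near : \forall n \near \oo, 0 < b n by apply: filterS n1 => n /b_gt0.
move=> x _; rewrite V_gumbel.
have tail' (t : nat -> R) :
    (\forall n \near \oo, `|t n| <= fluctuation k (a n / b n)) ->
    (fun n => pr (distribution P (X 0%N)) [set y | t n < excess (a n) (b n) y])
      ~_\oo (fun n => n%:R^-1 * expR (- t n)).
  rewrite /fluctuation -kE => ht.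
  apply/eqaddoP => e e0; have /eqaddoP/(_ e e0) := tail t ht.
  apply: filterS2 b_near => n bn; congr (`|_ - _| <= _).
  by rewrite /pr excess_gtE.
have lim := M2_level_cvg (x := x) k0 indepX identX sphX a_near b_near b_o_a tail'.
apply/fine_cvgP; split.
  by apply: nearW => n; apply: fin_num_measure; exact: measurable_itv.
apply: cvg_trans lim; apply: near_eq_cvg; apply: filterS b_near => n bn.
rewrite /= /cdf /distribution /pushforward /pr; congr (fine (P _)).
apply/seteqP; split => w; rewrite /preimage /= in_itv /= /normalized_M2 kE /level
  /fluctuation => h.
  have : (M2 X n w - 2 * a n) / b n <= x - k%:R / 2 * ln (a n / b n)
      + ln (ln (a n / b n)) + ln (c_ R k.+1).
    by move: h; rewrite ler_pdivrMr// lerBlDl.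
  by lra.
by rewrite -lerBlDl -ler_pdivrMr//; move: h; lra.
Qed.
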